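(* Let $\varepsilon>0$ and let $k\ge k_0(\varepsilon)$ for a sufficiently large $k_0(\varepsilon)$. Suppose that $d=2m/n\le(2-\varepsilon)k\ln k$. There exists a function $f(n)=o(n)$ such that the following is true. Let $\mathcal{D}$ be any graph property such that $G(n,m)$ has $\mathcal{D}$ with probability $1-o(1)$, and let $\mathcal{E}$ be any property of pairs $(G,\sigma)\in\Lambda_{n,m}$. If for all sufficiently large $n$ $$\Pr_{\mathcal{P}_{n,m}}\big[(G,\sigma)\text{ has }\mathcal{E}\ \big|\ G\text{ has }\mathcal{D}\big]\ge 1-\exp(-f(n)),$$ then $\Pr_{\mathcal{U}_{n,m}}[(G,\sigma)\text{ has }\mathcal{E}]=1-o(1)$.
   Context: $G(n,m)$ is a uniformly random graph on $V=\{1,\dots,n\}$ with $m$ edges. $\Lambda_{n,m}$ is the set of pairs $(G,\sigma)$ where $G$ is a graph on $V$ with $m$ edges and $\sigma\in\{1,\dots,k\}^n$ is a proper $k$-coloring of $G$. $\mathcal{U}_{n,m}$ is the distribution on $\Lambda_{n,m}$ obtained by choosing $G=G(n,m)$ and then a uniformly random $k$-coloring $\sigma$ of $G$ (if one exists). $\mathcal{P}_{n,m}$ (the planted model) is the distribution obtained by choosing $\sigma\in\{1,\dots,k\}^n$ uniformly at random and then choosing $G$ uniformly among all graphs with $m$ edges each of which joins two vertices of different colors under $\sigma$; output $(G,\sigma)$. *)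

(* Defs.v *)
From HB Require Import structures.
From mathcomp Require Import all_boot all_order all_algebra.
From mathcomp Require Import all_classical all_reals all_analysis.

Set Implicit Arguments.
Unset Strict Implicit.
Unset Printing Implicit Defensive.

Import Order.TTheory GRing.Theory Num.Theory.
Import numFieldNormedType.Exports.

Local Open Scope ring_scope.

(* Simple graphs on the labelled vertex set 'I_n, given by their edge sets. *)
Record graph (n : nat) := Graph {
  edges : {set {set 'I_n}};
  edges_card2 : [forall e in edges, #|e| == 2%N] }.

HB.instance Definition _ (n : nat) := [isSub for @edges n].
HB.instance Definition _ (n : nat) := [Finite of graph n by <:].

Definition adj (n : nat) (G : graph n) (x y : 'I_n) : bool :=
  [set x; y]%SET \in edges G.

Definition coloring (k n : nat) := {ffun 'I_n -> 'I_k}.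

Definition proper_coloring (k n : nat) (G : graph n) (s : coloring k n) : bool :=
  [forall x, forall y, adj G x y ==> (s x != s y)].

Definition graphs_with (n m : nat) : {set graph n} :=
  [set G | #|edges G| == m]%SET.

Definition colorings_of (k n : nat) (G : graph n) : {set coloring k n} :=
  [set s | proper_coloring G s]%SET.

Definition Lambda (k n m : nat) : {set graph n * coloring k n} :=
  [set p | (p.1 \in graphs_with n m) && proper_coloring p.1 p.2]%SET.

Definition Pr (R : realType) (T : finType) (mu : T -> R) (A : {set T}) : R :=
  \sum_(x in A) mu x.

(* Equal to 0 when [B] has probability 0. *)
Definition cPr (R : realType) (T : finType) (mu : T -> R) (A B : {set T}) : R :=
  Pr mu (A :&: B)%SET / Pr mu B.

(* Identically 0 when [A] is empty: drawing from an empty set yields no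
   outcome. *)
Definition uniform_mass (R : realType) (T : finType) (A : {set T}) (x : T) : R :=
  if x \in A then (#|A|%:R)^-1 else 0.

Definition Gnm (R : realType) (n m : nat) : graph n -> R :=
  uniform_mass R (graphs_with n m).

(* A graph without proper k-coloring yields no pair, so the total mass is the
   probability that G(n,m) is k-colorable. *)
Definition Unm (R : realType) (k n m : nat) (p : graph n * coloring k n) : R :=
  Gnm R m p.1 * uniform_mass R (colorings_of k p.1) p.2.

(* A color assignment compatible with no graph with m edges yields no pair.
   The missing mass does not affect conditional probabilities, in which the
   normalisation cancels. *)
Definition Pnm (R : realType) (k n m : nat) (p : graph n * coloring k n) : R :=
  uniform_mass R [set: coloring k n]%SET p.2 *
  uniform_mass R [set G in graphs_with n m | proper_coloring G p.2]%SET p.1.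

Definition graph_event (k n : nat) (D : {set graph n}) :
    {set graph n * coloring k n} :=
  [set p | p.1 \in D]%SET.

(* Main.v *)
(** Write Z for the number of k-colorings of G(n,m) and q = 1 - 1/k. The planted
    model charges every pair (G, sigma) at least k^-n / C(q n^2 / 2, m), so a set
    of pairs of planted probability e^-f has uniform probability at most
    e^-f (n + k)^k / c up to a constant factor, on the event that
    Z >= c k^n q^m / (n + k)^k. It therefore suffices to take
    f(n) = (k + 1) ln (n + k) and to show that this lower bound on Z fails with
    probability at most eta, for some c = c(eta) > 0.

    For the lower bound, G(n,m) is compared with a sequence of m independent
    uniform ordered pairs of distinct vertices, the number of vertices being
    rounded up to a multiple k h of k, and Z with the normalised number M of
    exactly balanced colorings. The bound d <= (2 - eps) k ln k makes the second
    moment of M a constant multiple of the squared first moment: an entropy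
    inequality gives a sub-Gaussian bound for the overlap matrix of two balanced
    colorings, and Stein's method, applied to the exchange of the colors of two
    vertices, gives the exact constant. That constant is accounted for by the
    numbers of short cycles: under the uniform measure and under its tilts by one
    or two colorings these are asymptotically independent Poisson variables,
    whose means are mu_l, mu_l (1 + delta_l) and mu_l (1 + delta_l)^2 with
    delta_l = (k - 1) (-1 / (k - 1))^l. Hence, conditionally on the cycle counts,
    M has small variance, and Chebyshev's inequality shows that M is bounded away
    from 0 with probability close to 1. *)

Require Import Defs.
From HB Require Import structures.
From mathcomp Require Import all_boot all_order all_algebra.
From mathcomp Require Import all_classical all_reals all_analysis.
From mathcomp Require Import fintype finset perm.
From mathcomp Require Import ring lra zify.

Set Implicit Arguments.
Unset Strict Implicit.
Unset Printing Implicit Defensive.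

Import Order.TTheory GRing.Theory Num.Theory.
Import numFieldNormedType.Exports.

Local Open Scope ring_scope.

(** * Entropy and sub-Gaussian bounds *)

(** The condition on d enters mainly through the entropy inequality, whose critical case is a pair
    of identical colorings: there the relative density [u] reaches k, and [u ln u] must still beat a
    quadratic whose size is set by [T], about d/2. This is what demands [T < k ln k], with slack.
    The second moment still exceeds the squared first moment by a constant factor, so alone it only
    gives a lower bound on M with probability bounded away from 0.

    Drawing edges independently with replacement makes M a mixture of product densities. Weighting
    by one or two colorings turns the base law into another product law up to an explicit factor, so
    mixed moments of M and the cycle counts are cycle-count probabilities. Repeated edges then
    appear as cycles of length 2. Returning to simple graphs costs only a constant factor.

    The second moment is grown one edge at a time, in place of a Laplace integral: edge t
    contributes [1 / (n (1 - x_t))] to the exponent, and expanding in powers of [x_t] reproduces,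
    term by term, the sum of mu_l delta_l^2. Exact balance makes the rows and columns of the overlap
    matrix sum to zero, which is what closes this recursion. *)

Section Scalar.
Variable R : realType.
Implicit Types (u x y : R).

Lemma ler_of_eq x y : x = y -> x <= y.
Proof. by move=> ->. Qed.

Lemma ln_le_sub1 x : 0 < x -> ln x <= x - 1.
Proof.
move=> x0; have -> : ln x = ln (1 + (x - 1)) by rewrite addrC subrK.
by apply: le_ln1Dx; lra.
Qed.

(** Entropy dominates the squared Hellinger distance: with s the square root of u, this is
    [ln s >= 1 - 1/s]. It serves the range of small u, where [(u - 1)^2 = (s - 1)^2 (s + 1)^2]
    exceeds it by a controlled factor. *)
Lemma xlnx_hellinger u : 0 <= u ->
  (Num.sqrt u - 1) ^+ 2 <= u * ln u - u + 1.
Proof.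
rewrite le_eqVlt => /predU1P[<-|u0].
  by rewrite sqrtr0 !mul0r !sub0r sqrrN expr1n oppr0 add0r.
set s := Num.sqrt u.
have s0 : 0 < s by rewrite sqrtr_gt0.
have us : u = s ^+ 2 by rewrite sqr_sqrtr // ltW.
have h1 : 1 - s^-1 <= ln s.
  have := @ln_le_sub1 s^-1; rewrite invr_gt0 lnV ?posrE // => /(_ s0); lra.
have h2 : s - 1 <= s * ln s.
  have -> : s - 1 = s * (1 - s^-1) by rewrite mulrBr mulr1 divff // gt_eqF.
  by rewrite ler_pM2l.
have -> : ln u = ln s *+ 2 by rewrite us lnXn.
rewrite us -mulr_natl; nra.
Qed.

(** The inequality is nearly tight at u = k, where both sides are about k ln k; this is where the
    threshold for d comes from. The Hellinger bound covers [u <= k / (4 ln k)]. Beyond, u is at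
    least 2 and it suffices to compare a linear function with [ln u - 1], separately below and above
    k/3. *)
Lemma xlnx_quadratic (e : R) : 0 < e -> e < 1 ->
  exists X : R, forall k : R, 0 < k -> X <= ln k ->
  forall u, 0 <= u <= k ->
  (1 - e) * ln k / k * (u - 1) ^+ 2 <= u * ln u - u + 1.
Proof.
move=> e0 e1.
(* The summand 3/e gives [e ln k >= 3], which pays for [ln u - 1 >= ln k - 3] near u = k; the 100
   makes k large compared with ln k. *)
pose X : R := 100 + 3 / e.
exists X => k k0 Xk u /andP[u0 uk].
have X100 : 100 <= ln k by apply: le_trans Xk; rewrite lerDl divr_ge0 // ltW.
have eX : 3 <= e * ln k.
  have : e * X <= e * ln k by rewrite ler_pM2l.
  by apply: le_trans; rewrite /X mulrDr mulrCA divff ?gt_eqF// mulr1; nra.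
set x := ln k in Xk X100 eX *.
have kx : k = expR x by rewrite /x lnK.
have k4 : x ^+ 2 / 4 <= k.
  rewrite kx; have -> : x = x / 2 + x / 2 by lra.
  rewrite expRD.
  have h : 0 <= 1 + x / 2 <= expR (x / 2) by rewrite expR_ge1Dx andbT; lra.
  nra.
have k10 : 8 * x <= k by nra.
have c0 : 0 <= (1 - e) * x / k by rewrite divr_ge0 ?mulr_ge0 //; lra.
have [ule|ugt] := leP u (k / (4 * x)).
- apply: le_trans (xlnx_hellinger u0).
  set s := Num.sqrt u; have s0 : 0 <= s by rewrite sqrtr_ge0.
  have us : u = s ^+ 2 by rewrite sqr_sqrtr.
  have h : (s + 1) ^+ 2 * x <= k.
    have : u * (4 * x) <= k by rewrite -ler_pdivlMr //; lra.
    rewrite us; nra.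
  have -> : (u - 1) ^+ 2 = (s - 1) ^+ 2 * (s + 1) ^+ 2 by rewrite us; ring.
  have s10 : 0 <= (s - 1) ^+ 2 by rewrite sqr_ge0.
  have s11 : 0 <= (s + 1) ^+ 2 * x by rewrite mulr_ge0 ?sqr_ge0 //; lra.
  rewrite mulrCA ler_piMr //.
  have -> : (1 - e) * x / k * (s + 1) ^+ 2 = (1 - e) * ((s + 1) ^+ 2 * x) / k.
    by ring.
  rewrite ler_pdivrMr // mul1r.
  apply: le_trans h; nra.
- have x8 : 0 < 4 * x by lra.
  have u1 : 2 <= u.
    by apply: le_trans (ltW ugt); rewrite ler_pdivlMr //; nra.
  have u00 : 0 < u by lra.
  suff h : (1 - e) * x / k * u <= ln u - 1.
    apply: (@le_trans _ _ ((1 - e) * x / k * u ^+ 2)).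
      by apply: ler_wpM2l => //; nra.
    have : u * ((1 - e) * x / k * u) <= u * (ln u - 1) by rewrite ler_pM2l.
    have -> : u * ((1 - e) * x / k * u) = (1 - e) * x / k * u ^+ 2 by ring.
    lra.
  have [u3|u3] := leP u (k / 3).
  + have lx : ln (4 * x) <= 31 + x / 8.
      have -> : 4 * x = 32 * (x / 8) by lra.
      rewrite lnM ?posrE //; last by lra.
      have := @ln_le_sub1 32; have := @ln_le_sub1 (x / 8); lra.
    have lu : x - ln (4 * x) <= ln u.
      rewrite /x -ln_div ?posrE // ler_ln ?posrE ?divr_gt0 //.
      exact: ltW.
    have : (1 - e) * x / k * u <= (1 - e) * x / k * (k / 3) by exact: ler_wpM2l.
    have -> : (1 - e) * x / k * (k / 3) = (1 - e) * x / 3.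
      by field; rewrite gt_eqF.
    have : 0 <= e * x by nra.
    nra.
  + have lu : x - 2 <= ln u.
      have : ln (k / 3) <= ln u by rewrite ler_ln ?posrE ?divr_gt0 // ltW.
      rewrite ln_div ?posrE // -/x.
      have := @ln_le_sub1 3; lra.
    have : (1 - e) * x / k * u <= (1 - e) * x / k * k by exact: ler_wpM2l.
    have -> : (1 - e) * x / k * k = (1 - e) * x by field; rewrite gt_eqF.
    nra.
Qed.

(* [x ln x - x + 1 >= c (x - 1)^2] on [0, k] says that the relative entropy to
   the uniform distribution on k points dominates [c k] times the squared
   Euclidean distance; by convex duality the uniform distribution is then
   sub-Gaussian. *)
Lemma uniform_subgaussian (k : nat) (kap : R) (t : 'I_k -> R) :
  (0 < k)%N -> 0 < kap ->
  (forall u, 0 <= u <= k%:R ->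
     kap / k%:R * (u - 1) ^+ 2 <= u * ln u - u + 1) ->
  k%:R^-1 * \sum_j expR (t j) <=
  expR (k%:R^-1 * \sum_j t j + (\sum_j t j ^+ 2) / (4 * kap)).
Proof.
move=> k0 kap0 H.
have K0 : 0 < k%:R :> R by rewrite ltr0n.
set Z := _^-1 * _.
have sum0 : 0 < \sum_j expR (t j).
  case: k k0 t {H K0} @Z => // k _ t Z.
  by rewrite big_ord_recl ltr_pwDl ?expR_gt0 // sumr_ge0 // => i _.
have Z0 : 0 < Z by rewrite mulr_gt0 ?invr_gt0.
pose u j := expR (t j) / Z.
have u0 j : 0 < u j by rewrite divr_gt0 // expR_gt0.
have sumu : \sum_j u j = k%:R.
  rewrite -mulr_suml /Z invfM invrK mulrCA divff ?mulr1 //; exact: lt0r_neq0.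
have uk j : u j <= k%:R.
  by rewrite -sumu (bigD1 j) //= lerDl sumr_ge0 // => i _; exact/ltW/u0.
have lnu j : ln (u j) = t j - ln Z.
  by rewrite ln_div ?posrE ?expR_gt0 // expRK.
have key j : kap / k%:R * (u j - 1) ^+ 2 <= u j * (t j - ln Z) - u j + 1.
  by rewrite -lnu; apply: H; rewrite uk ltW.
have young j : (u j - 1) * t j <=
    kap / k%:R * (u j - 1) ^+ 2 + k%:R * (t j ^+ 2 / (4 * kap)).
  rewrite -subr_ge0.
  have -> : kap / k%:R * (u j - 1) ^+ 2 + k%:R * (t j ^+ 2 / (4 * kap)) -
     (u j - 1) * t j = (kap * (u j - 1) - k%:R * t j / 2) ^+ 2 / (kap * k%:R).
    by field; rewrite !gt_eqF.
  by rewrite divr_ge0 ?sqr_ge0 // mulr_ge0 // ltW.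
have h : k%:R * ln Z <= \sum_j t j + k%:R * ((\sum_j t j ^+ 2) / (4 * kap)).
  have h1 : \sum_j (u j - 1) * t j <= \sum_j (u j * (t j - ln Z) - u j + 1) +
       k%:R * ((\sum_j t j ^+ 2) / (4 * kap)).
    rewrite mulr_suml mulr_sumr -big_split /=.
    by apply: ler_sum => j _; apply: le_trans (young j) _; rewrite lerD2r.
  have h2 : \sum_j (u j * (t j - ln Z) - u j + 1) =
      \sum_j (u j - 1) * t j + \sum_j t j - k%:R * ln Z.
    have -> : k%:R * ln Z = \sum_j u j * ln Z by rewrite -mulr_suml sumu.
    have hs : \sum_j (1 - u j) = 0.
      by rewrite sumrB sumu sumr_const card_ord subrr.
    transitivity (\sum_j (u j - 1) * t j + \sum_j t j - \sum_j u j * ln Z +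
        \sum_j (1 - u j)); last by rewrite hs addr0.
    rewrite -sumrN -!big_split /=.
    by apply: eq_bigr => j _; ring.
  lra.
rewrite -[X in X <= _]lnK ?posrE // ler_expR.
rewrite -(ler_pM2l K0); apply: le_trans h _.
by rewrite mulrDr mulVKf ?gt_eqF.
Qed.

(** A discrete Gaussian linearisation: completing the square, the integer just below s gives a
    summand at least [expR (s ^+ 2 / 2 - 1 / 2)]. Exponentials of squares thus become sums of
    exponentials of linear forms, to which sub-Gaussian bounds apply. *)
Lemma expR_half_sqr_lattice (s : R) (N : nat) : `|s| <= N%:R ->
  expR (s ^+ 2 / 2) <=
  expR 1 * \sum_(z < N.*2.+1) expR ((z%:R - N%:R) * s - (z%:R - N%:R) ^+ 2 / 2).
Proof.
move=> sN; have [sl su] : - N%:R <= s /\ s <= N%:R by move: sN; rewrite ler_norml => /andP[].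
have t0 : 0 <= s + N%:R by lra.
have /andP[z1 z2] := truncn_itv t0.
set z := Num.truncn _ in z1 z2.
have zlt : (z < N.*2.+1)%N.
  rewrite ltnS -(ler_nat R) -muln2 natrM; apply: le_trans z1 _; lra.
rewrite (bigD1 (Ordinal zlt)) //= mulrDr.
apply: (@le_trans _ _ (expR 1 * expR ((z%:R - N%:R) * s - (z%:R - N%:R) ^+ 2 / 2))).
  rewrite -expRD ler_expR; move: z2; rewrite -natr1; nra.
rewrite lerDl mulr_ge0 ?expR_ge0 // sumr_ge0 // => i _; exact: expR_ge0.
Qed.

Lemma sum_expRN_le (a : R) (N : nat) : 0 < a ->
  \sum_(z < N.*2.+1) expR (- (a * (z%:R - N%:R) ^+ 2)) <= 2 / (1 - expR (- a)).
Proof.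
move=> a0.
set x := expR (- a).
have x0 : 0 <= x by exact: expR_ge0.
have x1 : x < 1 by rewrite /x expR_lt1; lra.
have geom M : \sum_(i < M) x ^+ i <= 1 / (1 - x).
  rewrite ler_pdivlMr ?subr_gt0 //.
  have := subrX1 x M; rewrite -opprB -[x - 1]opprB mulNr => /oppr_inj h.
  by rewrite mulrC -h gerBl exprn_ge0.
have pt (y : nat) : expR (- (a * y%:R ^+ 2)) <= x ^+ y.
  rewrite -expRM_natl ler_expR mulrN lerN2 [a * _]mulrC ler_wpM2r ?(ltW a0) //.
  by rewrite -natrX ler_nat; case: y => // y; rewrite expnS expn1 leq_pmulr.
have e1 : \sum_(z < N.*2.+1) expR (- (a * (z%:R - N%:R) ^+ 2)) =
   \sum_(0 <= z < N) expR (- (a * (z%:R - N%:R) ^+ 2)) +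
   \sum_(0 <= z < N.+1) expR (- (a * z%:R ^+ 2)).
  rewrite -(big_mkord xpredT (fun z => expR (- (a * (z%:R - N%:R) ^+ 2)))).
  rewrite (big_cat_nat (n := N)) //=; last by rewrite -addnn leqW // leq_addl.
  congr (_ + _).
  rewrite -{1}[N]add0n big_addn -addnn subSn ?leq_addl // addnK.
  apply: eq_big_nat => i _; congr (expR (- (a * _ ^+ 2))).
  by rewrite natrD addrK.
rewrite e1 (_ : 2 / (1 - x) = 1 / (1 - x) + 1 / (1 - x)); last by rewrite -mulrDl.
apply: lerD; last first.
  rewrite big_mkord; apply: le_trans (geom N.+1); apply: ler_sum => i _; exact: pt.
rewrite big_nat_rev big_mkord /=; apply: le_trans (geom N.+1).
rewrite big_ord_recl expr0 [X in _ <= X]addrC ler_wpDr //.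
apply: ler_sum => i _; rewrite add0n.
rewrite (_ : (_ - _) ^+ 2 = (bump 0 i)%:R ^+ 2) ?pt //.
rewrite natrB // -[LHS]sqrrN /bump leq0n add1n.
by congr (_ ^+ 2); ring.
Qed.

Lemma expR_half_sqr_lattices (D : finType) (s : D -> R) (N : nat) :
  (forall d, `|s d| <= N%:R) ->
  expR ((\sum_d s d ^+ 2) / 2) <=
  expR 1 ^+ #|D| * \sum_(z : {ffun D -> 'I_(N.*2.+1)})
     expR (\sum_d (((z d)%:R - N%:R) * s d - ((z d)%:R - N%:R) ^+ 2 / 2)).
Proof.
move=> sN.
rewrite mulr_suml expR_sum -prodr_const.
under [X in _ * X]eq_bigr do rewrite expR_sum.
rewrite -(bigA_distr_bigA (fun d (z : 'I_(N.*2.+1)) =>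
  expR ((z%:R - N%:R) * s d - (z%:R - N%:R) ^+ 2 / 2))) /=.
rewrite [X in X * _](eq_bigl xpredT) // -big_split /=.
by apply: ler_prod => d _; rewrite expR_ge0 expR_half_sqr_lattice.
Qed.

End Scalar.

Definition avg (R : realType) (T : finType) (A : {set T}) (F : T -> R) : R :=
  (\sum_(x in A) F x) / #|A|%:R.

Section Avg.
Variables (R : realType) (T : finType) (A : {set T}).
Implicit Types F G : T -> R.

Lemma eq_avg F G : {in A, F =1 G} -> avg A F = avg A G.
Proof. by move=> FG; rewrite /avg (eq_bigr _ FG). Qed.

Lemma ler_avg F G : {in A, forall x, F x <= G x} -> avg A F <= avg A G.
Proof. by move=> FG; rewrite ler_wpM2r ?invr_ge0 // ler_sum. Qed.

Lemma avg_ge0 F : {in A, forall x, 0 <= F x} -> 0 <= avg A F.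
Proof. by move=> F0; rewrite divr_ge0 // sumr_ge0. Qed.

Lemma avgD F G : avg A (fun x => F x + G x) = avg A F + avg A G.
Proof. by rewrite /avg big_split mulrDl. Qed.

Lemma avgZ a F : avg A (fun x => a * F x) = a * avg A F.
Proof. by rewrite /avg -mulr_sumr mulrA. Qed.

Lemma avgZr a F : avg A (fun x => F x * a) = avg A F * a.
Proof. by rewrite mulrC -avgZ; apply: eq_avg => x _; rewrite mulrC. Qed.

Lemma avg_cst (a : R) : (0 < #|A|)%N -> avg A (fun=> a) = a.
Proof.
by move=> A0; rewrite /avg sumr_const -[a *+ _]mulr_natr mulfK ?pnatr_eq0 -?lt0n.
Qed.

Lemma avg_sum (I : finType) (P : pred I) (F : I -> T -> R) :
  avg A (fun x => \sum_(i | P i) F i x) = \sum_(i | P i) avg A (F i).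
Proof. by rewrite /avg exchange_big mulr_suml. Qed.

End Avg.

Section Overlap.
Variables (R : realType) (k : nat) (V : finType).
Variable sigma : V -> 'I_k.

(** The overlap matrix restricted to W, centred at its mean for a uniformly random tau. With this
    centring the rows sum to zero for every tau, balanced or not. *)
Definition ovl (W : {set V}) (tau : V -> 'I_k) (i j : 'I_k) : R :=
  \sum_(x in W | sigma x == i) ((tau x == j)%:R - k%:R^-1).

Lemma sum_ovl (W : {set V}) (tau : V -> 'I_k) (t : 'I_k -> 'I_k -> R) :
  \sum_i \sum_j t i j * ovl W tau i j =
  \sum_(x in W) (t (sigma x) (tau x) - k%:R^-1 * \sum_j t (sigma x) j).
Proof.
under eq_bigr do under eq_bigr do rewrite mulr_sumr.
under eq_bigr do rewrite exchange_big /=.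
rewrite [RHS](partition_big sigma xpredT) //=.
apply: eq_bigr => i _; apply: eq_bigr => x /andP[_ /eqP ->].
under eq_bigr do rewrite mulrBr.
rewrite big_split /= (bigD1 (tau x)) //= eqxx mulr1 [X in _ + X + _]big1 ?addr0.
  by rewrite sumrN mulr_sumr; congr (_ - _); apply: eq_bigr => j _; rewrite mulrC.
by move=> j /negbTE; rewrite eq_sym => ->; rewrite mulr0.
Qed.

(** Independent colors make the expectation a product over vertices. Each vertex of W contributes
    one centred instance of [uniform_subgaussian], and a row i is met at most b times. *)
Lemma iid_mgf (kap : R) (W : {set V}) (b : nat) (t : 'I_k -> 'I_k -> R) :
  (0 < k)%N -> 0 < kap ->
  (forall u : R, 0 <= u <= k%:R ->
     kap / k%:R * (u - 1) ^+ 2 <= u * ln u - u + 1) ->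
  (forall i, #|[set x in W | sigma x == i]%SET| <= b)%N ->
  avg [set: {ffun V -> 'I_k}]%SET
    (fun tau => expR (\sum_i \sum_j t i j * ovl W tau i j)) <=
  expR (b%:R * (\sum_i \sum_j t i j ^+ 2) / (4 * kap)).
Proof.
move=> k0 kap0 H Wb.
have K0 : 0 < k%:R :> R by rewrite ltr0n.
pose F x j : R := if x \in W then
  expR (t (sigma x) j - k%:R^-1 * \sum_j t (sigma x) j) else 1.
have -> : avg [set: {ffun V -> 'I_k}]%SET
    (fun tau => expR (\sum_i \sum_j t i j * ovl W tau i j)) =
   \prod_x (k%:R^-1 * \sum_j F x j).
  rewrite /avg cardsT card_ffun card_ord natrX big_split /= prodr_const -exprVn.
  rewrite mulrC; congr (_ * _).
  rewrite bigA_distr_bigA /=.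
  rewrite [LHS](eq_bigl xpredT); last by move=> tau; rewrite inE.
  apply: eq_bigr => tau _; rewrite sum_ovl expR_sum big_mkcond /=.
  by apply: eq_bigr => x _; rewrite /F; case: ifP.
have hF x : k%:R^-1 * \sum_j F x j <=
   expR ((x \in W)%:R * (\sum_j t (sigma x) j ^+ 2) / (4 * kap)).
  rewrite /F; case xW: (x \in W); last first.
    by rewrite sumr_const card_ord mulVf ?gt_eqF // !mul0r expR0.
  under eq_bigr do rewrite expRD.
  rewrite -mulr_suml mulrA mul1r expRN ler_pdivrMr ?expR_gt0 // -expRD.
  rewrite [X in expR X]addrC.
  exact: uniform_subgaussian.
apply: (@le_trans _ _ (\prod_x expR ((x \in W)%:R * (\sum_j t (sigma x) j ^+ 2) / (4 * kap)))).
  apply: ler_prod => x _; rewrite hF andbT mulr_ge0 ?invr_ge0 //.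
  by apply: sumr_ge0 => j _; rewrite /F; case: ifP => // _; exact: expR_ge0.
rewrite -expR_sum ler_expR -mulr_suml ler_wpM2r ?invr_ge0 ?mulr_ge0 ?(ltW kap0) //.
rewrite (partition_big sigma xpredT) //= mulr_sumr.
apply: ler_sum => i _.
rewrite (eq_bigr (fun x => (x \in W)%:R * \sum_j t i j ^+ 2)); last first.
  by move=> x /eqP ->.
rewrite -mulr_suml ler_wpM2r //.
  by apply: sumr_ge0 => j _; rewrite sqr_ge0.
rewrite -natr_sum ler_nat; apply: leq_trans (Wb i).
rewrite -sum1_card [X in (_ <= X)%N](eq_bigl (fun x => (sigma x == i) && (x \in W))).
  by rewrite big_mkcondr; apply: eq_leq; apply: eq_bigr => x _; case: (x \in W).
by move=> x; rewrite inE andbC.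
Qed.

Lemma norm_ovl_le (W : {set V}) (tau : V -> 'I_k) i j : `|ovl W tau i j| <= #|V|%:R.
Proof.
apply: le_trans (ler_norm_sum _ _ _) _.
apply: (@le_trans _ _ (\sum_(x in W | sigma x == i) 1)).
  apply: ler_sum => x _.
  have k1 : 0 <= (k%:R^-1 : R) <= 1.
    rewrite invr_ge0 ler0n /=; case: (k) => [|k']; first by rewrite invr0 ler01.
    by rewrite invf_le1 ?ltr0n // ler1n.
  by rewrite ler_norml; case: eqP => _ /=; lra.
rewrite sumr_const ler_nat; exact: max_card.
Qed.

(** The point is that the bound does not depend on V. After linearisation each of the k^2
    coordinates is a theta-like sum, convergent as soon as [a * b < kap]. *)
Lemma iid_exp_sqr (kap a : R) (W : {set V}) (b : nat) :
  (0 < k)%N -> 0 < kap -> 0 <= a ->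
  (forall u : R, 0 <= u <= k%:R ->
     kap / k%:R * (u - 1) ^+ 2 <= u * ln u - u + 1) ->
  (forall i, #|[set x in W | sigma x == i]%SET| <= b)%N ->
  a * b%:R < kap ->
  avg [set: {ffun V -> 'I_k}]%SET
    (fun tau => expR (a * \sum_i \sum_j ovl W tau i j ^+ 2)) <=
  (expR 1 * (2 / (1 - expR (- ((1 - a * b%:R / kap) / 2))))) ^+ (k * k).
Proof.
move=> k0 kap0 a0 H Wb ab.
pose D : finType := ('I_k * 'I_k)%type.
have cD : #|{: D}| = (k * k)%N by rewrite card_prod card_ord.
pose ra : R := Num.sqrt (2 * a).
have ra2 : ra ^+ 2 = 2 * a by rewrite sqr_sqrtr // mulr_ge0.
have ra0 : 0 <= ra by rewrite sqrtr_ge0.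
pose s (tau : {ffun V -> 'I_k}) (d : D) := ra * ovl W tau d.1 d.2.
(* The lattice must reach every value of [s], so N grows with V; it disappears because the theta
   sums are bounded uniformly in N. *)
pose N := (Num.truncn (ra * #|V|%:R)).+1.
have sN tau d : `|s tau d| <= N%:R.
  rewrite normrM (ger0_norm ra0); apply: (@le_trans _ _ (ra * #|V|%:R)).
    by rewrite ler_wpM2l // norm_ovl_le.
  by apply: ltW; rewrite /N; apply: truncnS_gt.
pose zt (z : 'I_(N.*2.+1)) : R := z%:R - N%:R.
have e1 (tau : {ffun V -> 'I_k}) : a * \sum_i \sum_j ovl W tau i j ^+ 2 = (\sum_d s tau d ^+ 2) / 2.
  rewrite pair_bigA /= !mulr_sumr mulr_suml; apply: eq_bigr => d _.
  by rewrite /s exprMn ra2; lra.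
(* What is left of the lattice weight [z^2 / 2] once the generating function has used up
   [a b z^2 / (2 kap)]. *)
pose al : R := (1 - a * b%:R / kap) / 2.
have al0 : 0 < al by rewrite divr_gt0 // subr_gt0 ltr_pdivrMr // mul1r.
apply: (@le_trans _ _ (avg [set: {ffun V -> 'I_k}]%SET (fun tau =>
   expR 1 ^+ (k * k) * \sum_(z : {ffun D -> 'I_(N.*2.+1)})
     (expR (- \sum_d (zt (z d) ^+ 2 / 2)) * expR (\sum_i \sum_j (ra * zt (z (i, j))) * ovl W tau i j))))).
  apply: ler_avg => tau _; rewrite e1.
  apply: le_trans (expR_half_sqr_lattices (sN tau)) _.
  rewrite cD ler_wpM2l ?exprn_ge0 ?expR_ge0 //.
  apply: ler_of_eq; apply: eq_bigr => z _; rewrite -expRD; congr expR.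
  rewrite pair_bigA /= -sumrN -big_split /=; apply: eq_bigr => d _.
  by rewrite /s /zt; case: d => i j /=; ring.
rewrite avgZ exprMn ler_wpM2l ?exprn_ge0 ?expR_ge0 //.
rewrite avg_sum.
apply: (@le_trans _ _ (\sum_(z : {ffun D -> 'I_(N.*2.+1)}) \prod_d expR (- (al * zt (z d) ^+ 2)))).
  apply: ler_sum => z _; rewrite avgZ -expR_sum.
  have h := iid_mgf (fun i j => ra * zt (z (i, j))) k0 kap0 H Wb.
  apply: le_trans (ler_wpM2l (expR_ge0 _) h) _; rewrite -expRD ler_expR.
  rewrite pair_bigA /= -sumrN mulr_sumr mulr_suml -big_split /=.
  apply: ler_sum => -[i j] _ /=; rewrite exprMn ra2 /al.
  apply: ler_of_eq; field; exact: lt0r_neq0.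
rewrite -(bigA_distr_bigA (fun d (z : 'I_(N.*2.+1)) => expR (- (al * zt z ^+ 2)))).
rewrite -cD -prodr_const [X in _ <= X](eq_bigl xpredT) //.
apply: ler_prod => d _; rewrite sum_expRN_le // andbT.
by apply: sumr_ge0 => i _; exact: expR_ge0.
Qed.

End Overlap.

(** * Balanced colorings *)

Section Profiles.
Variables (k : nat) (V : finType).
Local Notation col := {ffun V -> 'I_k}.

Definition profile_set (U : {set V}) (t0 : col) (b : 'I_k -> nat) : {set col} :=
  [set tau : col | [forall x, (x \notin U) ==> (tau x == t0 x)] &&
     [forall j, #|[set x in U | tau x == j]%SET| == b j]]%SET.

(** The multinomial coefficient, by induction on U: fixing the color of one vertex x lowers one
    entry of the profile by one. *)
Lemma card_profile_set (U : {set V}) (t0 : col) (b : 'I_k -> nat) :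
  (\sum_j b j = #|U|)%N ->
  (#|profile_set U t0 b| * \prod_j (b j)`! = (#|U|)`!)%N.
Proof.
move: {2}#|U| (erefl #|U|) => n; elim: n U t0 b => [|n IHn] U t0 b cU sb.
  have U0 : U = set0 by apply/eqP; rewrite -cards_eq0 cU.
  have b0 j : b j = 0%N.
    by apply/eqP; move/eqP: sb; rewrite cU sum_nat_eq0 => /forall_inP /(_ j); exact.
  rewrite cU big1 ?muln1; last by move=> j _; rewrite b0.
  rewrite fact0 -(cards1 t0); apply: eq_card => tau; rewrite !inE U0.
  apply/andP/eqP => [[/forallP h _]|->].
    by apply/ffunP => x; have := h x; rewrite inE => /eqP.
  split; first by apply/forallP => x; rewrite eqxx implybT.
  apply/forallP => j; rewrite b0 cards_eq0; apply/eqP/setP => x.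
  by rewrite !inE.
have [x xU] : exists x, x \in U by apply/set0Pn; rewrite -cards_eq0 cU.
have cUx : #|U :\ x| = n by move: cU; rewrite (cardsD1 x U) xU => -[].
pose t1 j : col := [ffun y => if y == x then j else t0 y].
pose b1 j i := (b i - (i == j))%N.
have cnt (tau : col) i : #|[set y in U | tau y == i]%SET| =
   ((tau x == i) + #|[set y in U :\ x | tau y == i]%SET|)%N.
  rewrite (cardsD1 x) inE xU /=; congr (_ + _)%N.
  by apply: eq_card => y; rewrite !inE andbA.
have fib j : (0 < b j)%N ->
   [set tau in profile_set U t0 b | tau x == j]%SET = profile_set (U :\ x) (t1 j) (b1 j).
  move=> bj; apply/setP => tau; rewrite !inE.
  apply/andP/andP => [[/andP[/forallP h1 /forallP h2] /eqP tx]|[/forallP h1 /forallP h2]].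
    split; [apply/forallP => y|apply/forallP => i].
      rewrite !inE ffunE negb_and negbK; apply/implyP.
      case: eqP => [-> _|_ /=]; first by rewrite tx.
      by have /implyP := h1 y.
    by have /eqP := h2 i; rewrite cnt tx /b1 [i == j]eq_sym => <-; rewrite addKn.
  have tx : tau x = j by have := h1 x; rewrite !inE eqxx /= ffunE eqxx => /eqP.
  split; last by rewrite tx.
  apply/andP; split; [apply/forallP => y|apply/forallP => i].
    apply/implyP => yU; have := h1 y; rewrite !inE ffunE (negbTE yU) andbF /=.
    by case: (y =P x) => // yx; case/negP: yU; rewrite yx.
  have := h2 i; rewrite cnt tx /b1 => /eqP ->; apply/eqP.
  by rewrite [j == i]eq_sym subnKC //; case: eqP => // ->.
have fib0 j : b j = 0%N -> #|[set tau in profile_set U t0 b | tau x == j]%SET| = 0%N.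
  move=> bj; apply/eqP; rewrite cards_eq0; apply/eqP/setP => tau; rewrite !inE.
  apply/negbTE/negP => /andP[/andP[_ /forallP h2] /eqP tx].
  by have := h2 j; rewrite cnt tx eqxx bj.
have split_card : (#|profile_set U t0 b| =
   \sum_j #|[set tau in profile_set U t0 b | tau x == j]%SET|)%N.
  rewrite -sum1_card (partition_big (fun tau : col => tau x) xpredT) //=.
  apply: eq_bigr => j _; rewrite -sum1_card; apply: eq_bigl => tau.
  by rewrite !inE.
rewrite split_card big_distrl /= cU factS -cU -sb big_distrl /=.
apply: eq_bigr => j _.
have [bj|bj] := posnP (b j); first by rewrite fib0 // bj !mul0n.
rewrite fib // -cUx -(IHn (U :\ x) (t1 j) (b1 j)) //; last first.
  rewrite cUx; apply/eqP; rewrite -eqSS -cU -sb (bigD1 j) //= [X in _ == X](bigD1 j) //=.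
  rewrite /b1 eqxx subn1 -addSn prednK //; apply/eqP; congr (_ + _)%N.
  by apply: eq_bigr => i /negbTE ->; rewrite subn0.
rewrite mulnCA; congr (_ * _)%N.
rewrite (bigD1 j) //= [in RHS](bigD1 j) //= mulnA; congr (_ * _)%N.
  by rewrite /b1 eqxx subn1; case: (b j) bj => // c _; rewrite factS.
by apply: eq_bigr => i /negbTE ij; rewrite /b1 ij subn0.
Qed.

(** The Poisson weight [g^c / c!] is maximal at its mean c = g. *)
Lemma fact_tilt (g c : nat) : (g`! * g ^ c <= c`! * g ^ g)%N.
Proof.
have up d : (g`! * g ^ (g + d) <= (g + d)`! * g ^ g)%N.
  elim: d => [|d IH]; first by rewrite addn0.
  rewrite addnS expnS factS mulnCA -mulnA leq_mul //.
  by rewrite leqW // leq_addr.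
have down d : (d <= g)%N -> (g`! * g ^ (g - d) <= (g - d)`! * g ^ g)%N.
  elim: d => [|d IH] dg; first by rewrite subn0.
  have := IH (ltnW dg); have -> : (g - d = (g - d.+1).+1)%N by lia.
  rewrite expnS factS => h.
  have g0 : (0 < g)%N by lia.
  rewrite -(leq_pmul2l g0); apply: (leq_trans (n := ((g - d.+1).+1 * (g - d.+1)`! * g ^ g)%N)).
    by rewrite mulnCA.
  by rewrite -mulnA leq_mul2r; apply/orP; right; lia.
have [cg|cg] := leqP c g.
  by have := down (g - c)%N (leq_subr _ _); rewrite subKn.
by have := up (c - g)%N; rewrite subnKC // ltnW.
Qed.

Lemma fact_expn_le (x a : nat) : (x`! * x ^ a <= (x + a)`!)%N.
Proof.
elim: a => [|a IH]; first by rewrite addn0 muln1.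
by rewrite addnS expnS factS mulnCA leq_mul // leqW // leq_addr.
Qed.

(** The uniform profile maximises the multinomial coefficient: in the product of the instances of
    [fact_tilt] the powers of g cancel, the total being fixed. *)
Lemma prod_fact_ge (g : nat) (b : 'I_k -> nat) :
  (\sum_j b j = k * g)%N -> (g`! ^ k <= \prod_j (b j)`!)%N.
Proof.
move=> sb; case: g sb => [|g] sb.
  by rewrite fact0 exp1n prodn_gt0 // => j; exact: fact_gt0.
have g0 : (0 < (g.+1 ^ g.+1) ^ k)%N by rewrite !expn_gt0.
have e1 a : (a ^ k = \prod_(j < k) a)%N by rewrite prod_nat_const card_ord.
rewrite -(leq_pmul2r g0) (e1 (g.+1 ^ g.+1)%N) -big_split /= -e1 (e1 (g.+1)`!).
have -> : ((g.+1 ^ g.+1) ^ k = \prod_(j < k) g.+1 ^ (b j))%N.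
  by rewrite -expnM -expn_sum sb mulnC.
by rewrite -big_split /=; apply: leq_prod => j _; exact: fact_tilt.
Qed.

End Profiles.

Section Balanced.
Variables (k h : nat) (V : finType).
Hypothesis cV : #|V| = (k * h)%N.
Local Notation col := {ffun V -> 'I_k}.

Definition bal : {set col} :=
  [set tau : col | [forall j, #|[set x | tau x == j]%SET| == h]]%SET.

Lemma balP (tau : col) : reflect (forall j, #|[set x | tau x == j]%SET| = h) (tau \in bal).
Proof. by rewrite inE; apply: (iffP forallP) => H j; apply/eqP. Qed.

Lemma card_bal (t0 : col) : (#|bal| * h`! ^ k = (k * h)`!)%N.
Proof.
have := @card_profile_set k V [set: V]%SET t0 (fun=> h).
rewrite sum_nat_const prod_nat_const card_ord cardsT cV => /(_ erefl) <-.
congr (_ * _)%N; apply: eq_card => tau; rewrite !inE.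
have -> : [forall x, (x \notin [set: V]%SET) ==> (tau x == t0 x)].
  by apply/forallP => x; rewrite inE.
apply: eq_forallb => j; congr (_ == _); apply: eq_card => x.
by rewrite !inE.
Qed.

(** All balanced extensions of one partial coloring have the same profile outside W, and no profile
    is more numerous than the uniform one. *)
Lemma card_bal_completions (W : {set V}) (g : nat) (tau : col) :
  #|~: W| = (k * g)%N ->
  (#|[set t in bal | [forall x in W, t x == tau x]]%SET| * g`! ^ k <= (k * g)`!)%N.
Proof.
move=> cW.
set N := [set t in bal | _]%SET.
have [->|/set0Pn[t1]] := eqVneq N set0; first by rewrite cards0 mul0n.
rewrite inE => /andP[/balP t1b /forall_inP t1W].
pose b j := #|[set x in ~: W | t1 x == j]%SET|.
have sb : (\sum_j b j = #|~: W|)%N.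
  rewrite -[RHS]sum1_card (partition_big t1 xpredT) //=.
  by apply: eq_bigr => j _; rewrite /b -sum1_card; apply: eq_bigl => x; rewrite !inE.
rewrite -cW -(card_profile_set tau sb) leq_mul //; last first.
  by apply: prod_fact_ge; rewrite sb.
apply/subset_leq_card/subsetP => t; rewrite !inE.
move=> /andP[/forallP tb /forall_inP tW].
apply/andP; split; first by apply/forall_inP => x; rewrite inE negbK; exact: tW.
apply/forallP => j; apply/eqP.
have cnt (s : col) : (forall x, x \in W -> s x == tau x) ->
   #|[set x | s x == j]%SET| = (#|[set x in W | tau x == j]%SET| + #|[set x in ~: W | s x == j]%SET|)%N.
  move=> sW; rewrite -(cardsID W [set x | s x == j]%SET); congr (_ + _)%N.
    apply: eq_card => x; rewrite !inE andbC; case xW: (x \in W) => //=.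
    by rewrite (eqP (sW _ xW)).
  by apply: eq_card => x; rewrite !inE.
have := eqP (tb j); rewrite (cnt t tW) -(t1b j) (cnt t1) //.
exact: addnI.
Qed.

Lemma card_agree (W : {set V}) (t : col) :
  #|[set tau : col | [forall x in W, t x == tau x]]%SET| = (k ^ #|~: W|)%N.
Proof.
pose F x : pred 'I_k := if x \in W then pred1 (t x) else predT.
have -> : #|[set tau : col | [forall x in W, t x == tau x]]%SET| = #|family F|.
  apply: eq_card => tau; rewrite inE; apply/forall_inP/familyP => [H x|H x xW].
    rewrite /F; case: ifP => // xW; rewrite !inE eq_sym; exact: H.
  by have := H x; rewrite /F xW !inE eq_sym.
rewrite card_family foldrE big_map big_enum /= (bigID (mem W)) /=.
rewrite big1 ?mul1n; last by move=> x xW; rewrite /F xW card1.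
rewrite -prod_nat_const; apply: eq_big => x; first by rewrite inE.
by move=> /negbTE xW; rewrite /F xW cardT size_enum_ord.
Qed.

Variable R : realType.

(** The probability that a uniform coloring of [k * g] points is exactly balanced. *)
Definition cmult (g : nat) : R := (k * g)`!%:R / (g`!%:R ^+ k * k%:R ^+ (k * g)).

(** Polynomial decay of the balance probability without Stirling's formula. The exponent k is not
    the true one, but only constant ratios and polynomial losses are at stake. *)
Lemma cmult_mono (g d : nat) : (0 < k)%N ->
  cmult g * g%:R ^+ k <= cmult (g + d) * (g + d)%:R ^+ k.
Proof.
move=> k0; elim: d => [|d IH]; first by rewrite addn0.
apply: le_trans IH _; rewrite addnS; move: (g + d)%N => {g d}g.
have K0 : 0 < k%:R :> R by rewrite ltr0n.
have G0 : 0 < g`!%:R :> R by rewrite ltr0n fact_gt0.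
rewrite /cmult factS natrM exprMn.
have -> : (k * g)`!%:R / (g`!%:R ^+ k * k%:R ^+ (k * g)) * g%:R ^+ k =
   ((k * g)`!%:R * (k * g)%:R ^+ k) / (g`!%:R ^+ k * k%:R ^+ (k * g.+1)) :> R.
  rewrite mulnS exprD natrM exprMn; field.
  by rewrite !expf_neq0 ?lt0r_neq0.
have -> : (k * g.+1)`!%:R / (g.+1%:R ^+ k * g`!%:R ^+ k * k%:R ^+ (k * g.+1)) *
   g.+1%:R ^+ k = (k * g.+1)`!%:R / (g`!%:R ^+ k * k%:R ^+ (k * g.+1)) :> R.
  by field; rewrite !expf_neq0 ?lt0r_neq0.
rewrite ler_wpM2r ?invr_ge0 ?mulr_ge0 ?exprn_ge0 ?ler0n //.
rewrite -natrX -natrM ler_nat mulnS addnC.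
exact: fact_expn_le.
Qed.

Lemma cmult1_gt0 : (0 < k)%N -> 0 < cmult 1.
Proof.
move=> k0; rewrite divr_gt0 ?mulr_gt0 ?exprn_gt0 ?ltr0n ?fact_gt0 //.
Qed.

Lemma card_bal_cmult : (0 < k)%N -> #|bal|%:R = cmult h * k%:R ^+ (k * h) :> R.
Proof.
move=> k0.
have [t0 _] : exists t0 : col, true by exists [ffun=> Ordinal k0].
rewrite /cmult -(card_bal t0) natrM natrX; field.
by rewrite !expf_neq0 // pnatr_eq0 -lt0n // fact_gt0.
Qed.

(** A function that ignores [k * g] vertices hardly feels the balance constraint, because the
    ignored vertices can restore it: the density of the balanced law on W is at most
    [cmult g / cmult h]. *)
Lemma bal_density (W : {set V}) (g : nat) (F : col -> R) :
  (0 < k)%N -> (0 < g <= h)%N -> #|~: W| = (k * g)%N ->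
  (forall t, 0 <= F t) ->
  (forall t t' : col, (forall x, x \in W -> t x = t' x) -> F t = F t') ->
  avg bal F <= (h%:R / g%:R) ^+ k * avg [set: col]%SET F.
Proof.
move=> k0 /andP[g0 gh] cW F0 FW.
have K0 : 0 < k%:R :> R by rewrite ltr0n.
have G0 : 0 < g`!%:R :> R by rewrite ltr0n fact_gt0.
pose agr (t tau : col) := [forall x in W, t x == tau x].
have dc : (\sum_(t in bal) F t) * k%:R ^+ (k * g) =
    \sum_tau F tau * #|[set t in bal | agr t tau]%SET|%:R.
  rewrite -natrX -cW mulr_suml.
  transitivity (\sum_(t in bal) \sum_(tau : col) F tau * (agr t tau)%:R).
    apply: eq_bigr => t _; rewrite -(card_agree W t) -sum1_card natr_sum mulr_sumr.
    rewrite big_mkcond; apply: eq_bigr => tau _; rewrite inE -/(agr t tau).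
    case a: (agr t tau); rewrite ?mulr0 ?mulr1 //; apply: FW => x xW.
    by apply/eqP; move/forall_inP: a; exact.
  rewrite exchange_big /=; apply: eq_bigr => tau _; rewrite -mulr_sumr; congr (_ * _).
  rewrite -sum1_card natr_sum big_mkcond [RHS]big_mkcond /=.
  by apply: eq_bigr => t _; rewrite !inE; case: [forall j, _]; case: (agr t tau).
have sF0 : 0 <= \sum_tau F tau by apply: sumr_ge0.
have hN : \sum_tau F tau * #|[set t in bal | agr t tau]%SET|%:R <=
   (\sum_tau F tau) * (cmult g * k%:R ^+ (k * g)).
  rewrite mulr_suml; apply: ler_sum => tau _; apply: ler_wpM2l => //.
  rewrite /cmult invfM mulrA mulfVK ?expf_neq0 ?lt0r_neq0 //.
  rewrite ler_pdivlMr ?exprn_gt0 // -natrX -natrM ler_nat.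
  exact: card_bal_completions.
have hs : \sum_(t in bal) F t <= (\sum_tau F tau) * cmult g.
  have kk : 0 < k%:R ^+ (k * g) :> R by rewrite exprn_gt0.
  by rewrite -(ler_pM2r kk) dc -mulrA.
rewrite /avg (card_bal_cmult k0) cardsT card_ffun card_ord cV natrX.
rewrite [X in _ <= _ * (X / _)](eq_bigl xpredT); last by move=> t; rewrite inE.
have ch : 0 < cmult h.
  by rewrite divr_gt0 ?mulr_gt0 ?exprn_gt0 ?ltr0n ?fact_gt0.
rewrite ler_pdivrMr; last by rewrite mulr_gt0 // exprn_gt0.
rewrite [X in _ <= X](_ : _ = (\sum_tau F tau) * ((h%:R / g%:R) ^+ k * cmult h)); last first.
  by field; rewrite expf_neq0 // lt0r_neq0.
apply: le_trans hs _; apply: ler_wpM2l => //.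
rewrite expr_div_n mulrAC ler_pdivlMr ?exprn_gt0 ?ltr0n //.
rewrite [X in _ <= X]mulrC.
by have := @cmult_mono g (h - g) k0; rewrite subnKC.
Qed.

Lemma card_bal_ge : (0 < k)%N -> (0 < h)%N ->
  cmult 1 / h%:R ^+ k <= #|bal|%:R / k%:R ^+ (k * h).
Proof.
move=> k0 h0; have K0 : 0 < k%:R :> R by rewrite ltr0n.
rewrite card_bal_cmult // mulfK ?expf_neq0 ?lt0r_neq0 //.
rewrite ler_pdivrMr ?exprn_gt0 ?ltr0n //.
by have := @cmult_mono 1 (h - 1) k0; rewrite subnKC // expr1n mulr1.
Qed.

Lemma exists_uniform_subset (sigma : col) (g : nat) : sigma \in bal -> (g <= h)%N ->
  exists W : {set V}, forall i, #|[set x in W | sigma x == i]%SET| = g.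
Proof.
move=> /balP sb gh.
pose s i := take g (enum [set x | sigma x == i]%SET).
have ss i : size (s i) = g by rewrite size_take -cardE sb; case: ltngtP gh.
exists [set x | x \in s (sigma x)]%SET => i.
rewrite -(ss i) -(card_uniqP _); last by rewrite take_uniq ?enum_uniq.
apply: eq_card => x; rewrite !inE; apply/andP/idP => [[xs /eqP <-] //|xs].
have : x \in enum [set x | sigma x == i]%SET by exact: mem_take xs.
by rewrite mem_enum inE => /eqP e; rewrite e.
Qed.

Lemma ovlT (sigma tau : V -> 'I_k) (W : {set V}) i j :
  ovl R sigma [set: V]%SET tau i j = ovl R sigma W tau i j + ovl R sigma (~: W) tau i j.
Proof.
rewrite /ovl (bigID (mem W)) /=; congr (_ + _); apply: eq_bigl => x;
  by rewrite !inE andbC.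
Qed.

Lemma card_uniform_subset (sigma : col) (W : {set V}) (g : nat) :
  (forall i, #|[set x in W | sigma x == i]%SET| = g) -> #|W| = (k * g)%N.
Proof.
move=> Wg; rewrite -sum1_card (partition_big sigma xpredT) //=.
rewrite (eq_bigr (fun=> g)); first by rewrite sum_nat_const card_ord.
by move=> i _; rewrite -(Wg i) -sum1_card; apply: eq_bigl => x; rewrite !inE.
Qed.

(** Applied to the overlaps of two blocks, it bounds the exponential of a squared sum by a sum of
    two exponentials, each depending on one block only. The dominant block is charged just the
    factor [(1 + z)^2]. *)
Lemma sqr_sum_le_max (D : finType) (s1 s2 : D -> R) (z : R) : 0 < z ->
  \sum_d (s1 d + s2 d) ^+ 2 <= (1 + z) ^+ 2 * \sum_d s1 d ^+ 2 \/
  \sum_d (s1 d + s2 d) ^+ 2 <= (1 + z^-1) ^+ 2 * \sum_d s2 d ^+ 2.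
Proof.
move=> z0.
have hs : \sum_d (s1 d + s2 d) ^+ 2 <=
   (1 + z) * \sum_d s1 d ^+ 2 + (1 + z^-1) * \sum_d s2 d ^+ 2.
  rewrite !mulr_sumr -big_split /=; apply: ler_sum => d _.
  rewrite -subr_ge0.
  have -> : (1 + z) * s1 d ^+ 2 + (1 + z^-1) * s2 d ^+ 2 - (s1 d + s2 d) ^+ 2 =
     (z * s1 d - s2 d) ^+ 2 / z by field; exact: lt0r_neq0.
  by rewrite divr_ge0 ?sqr_ge0 // ltW.
set A := \sum_d s1 d ^+ 2 in hs *; set B := \sum_d s2 d ^+ 2 in hs *.
have zi : z * z^-1 = 1 by rewrite divff // lt0r_neq0.
have zi0 : 0 < z^-1 by rewrite invr_gt0.
have [BA|AB] := leP B (z ^+ 2 * A); [left|right]; apply: le_trans hs _.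
  have : (1 + z^-1) * B <= (1 + z^-1) * (z ^+ 2 * A) by apply: ler_wpM2l => //; lra.
  have -> : (1 + z^-1) * (z ^+ 2 * A) = z ^+ 2 * A + (z * z^-1) * (z * A) by ring.
  rewrite zi; nra.
have : A <= z^-1 ^+ 2 * B.
  rewrite -(ler_pM2l (exprn_gt0 2 z0)) mulrA -exprMn zi expr1n mul1r; exact: ltW.
move=> AB'; have : (1 + z) * A <= (1 + z) * (z^-1 ^+ 2 * B) by apply: ler_wpM2l => //; lra.
have -> : (1 + z) * (z^-1 ^+ 2 * B) = z^-1 ^+ 2 * B + (z * z^-1) * (z^-1 * B) by ring.
rewrite zi; nra.
Qed.

End Balanced.

Lemma divn_bounds (N h : nat) : (2 <= N)%N -> (N <= h)%N ->
  [/\ 0 < h %/ N, 2 * (h %/ N) <= h, h <= 2 * N * (h %/ N), 0 < h & h %/ N < h]%N.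
Proof.
move=> N2 Nh; have N0 : (0 < N)%N by exact: leq_trans N2.
have g0 : (0 < h %/ N)%N by rewrite divn_gt0.
have gh2 : (2 * (h %/ N) <= h)%N.
  by apply: leq_trans (leq_trunc_div h N); rewrite mulnC leq_mul2l N2 orbT.
split => //; try lia.
apply: leq_trans (ltnW (ltn_ceil h N0)) _.
by rewrite mulnAC leq_mul2r; apply/orP; right; lia.
Qed.

Definition sqovl (R : realType) (k : nat) (V : finType) (sigma tau : V -> 'I_k) : R :=
  \sum_i \sum_j ovl R sigma [set: V]%SET tau i j ^+ 2.

(* The entropy inequality is sharp up to the slack [c1 < k * kap], so the
   balance constraint may only cost a constant factor: it is dropped on the two
   blocks W2 (a small fraction of each colour class) and its complement
   separately. *)
Lemma bal_exp_bound (R : realType) (k : nat) (kap c1 : R) :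
  (0 < k)%N -> 0 < kap -> 0 <= c1 -> c1 < k%:R * kap ->
  (forall u : R, 0 <= u <= k%:R ->
     kap / k%:R * (u - 1) ^+ 2 <= u * ln u - u + 1) ->
  exists (C : R) (h0 : nat), forall (h : nat) (V : finType) (sigma : {ffun V -> 'I_k}),
    (h0 <= h)%N -> #|V| = (k * h)%N -> sigma \in bal k h V ->
    avg (bal k h V) (fun tau => expR (c1 / (k * h)%:R * sqovl R sigma tau)) <= C.
Proof.
move=> k0 kap0 c10 c1k H.
have K0 : 0 < k%:R :> R by rewrite ltr0n.
have kk0 : 0 < k%:R * kap by rewrite mulr_gt0.
(* With [q = c1 / (k kap) < 1], the value [z = (1 - q) / 6] keeps [q (1 + z)^2] below the midpoint
   of q and 1. *)
have [z z0 [r1 r11 z1]] : exists2 z : R, 0 < z &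
    exists2 r : R, r < 1 & c1 * (1 + z) ^+ 2 <= r * (k%:R * kap).
  pose r := (1 + c1 / (k%:R * kap)) / 2.
  have q1 : c1 / (k%:R * kap) < 1 by rewrite ltr_pdivrMr // mul1r.
  have q0 : 0 <= c1 / (k%:R * kap) by rewrite divr_ge0 // ltW.
  set q := c1 / _ in q0 q1 r.
  exists ((1 - q) / 6); first by lra.
  exists r; first by rewrite /r; lra.
  have -> : c1 = q * (k%:R * kap) by rewrite /q mulfVK // lt0r_neq0.
  rewrite mulrAC ler_pM2r // /r.
  have : 0 <= (1 - q) ^+ 2 <= 1 - q by apply/andP; split; nra.
  have : 0 <= (1 - q) ^+ 3 by rewrite exprn_ge0 //; lra.
  rewrite !expr2 !exprS expr0; lra.
have zi0 : 0 < z^-1 by rewrite invr_gt0.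
pose A2 := (1 + z^-1) ^+ 2.
have A20 : 0 < A2 by rewrite exprn_gt0 //; lra.
(* The small block carries the large factor [A2]; taking only a fraction 1/N2 of each class brings
   its coefficient down to 1/2. *)
have [N2 hN2] : exists N2 : nat, c1 * A2 <= N2%:R * (k%:R * kap) / 2 /\ (2 <= N2)%N.
  exists (Num.truncn (2 * (c1 * A2 / (k%:R * kap)))).+3; split => //.
  rewrite mulrAC -ler_pdivrMr // ler_pdivlMr // mulrC.
  apply: ltW; apply: lt_le_trans (truncnS_gt _) _; by rewrite ler_nat ltnS !leqW.
case: hN2 => hN2 N22.
pose Cf (r : R) : R := (expR 1 * (2 / (1 - expR (- ((1 - r) / 2))))) ^+ (k * k).
have Cf_mono (r r' : R) : r <= r' -> r' < 1 -> Cf r <= Cf r'.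
  move=> rr r'1.
  have e1 : expR (- ((1 - r') / 2)) < 1 by rewrite expR_lt1; lra.
  have e2 : expR (- ((1 - r) / 2)) <= expR (- ((1 - r') / 2)) by rewrite ler_expR; lra.
  apply: lerXn2r; rewrite ?nnegrE ?mulr_ge0 ?expR_ge0 ?invr_ge0 ?subr_ge0 //; try lra.
  apply: ler_wpM2l; rewrite ?expR_ge0 //; apply: ler_wpM2l => //.
  by rewrite lef_pV2 ?posrE ?subr_gt0; lra.
exists ((2 * N2%:R) ^+ k * Cf r1 + 2 ^+ k * Cf (1 / 2)), N2 => h V sigma h0 cV sb.
pose g := (h %/ N2)%N.
have [g0 gh2 hg h00 gh] := divn_bounds N22 h0.
have H0 : 0 < h%:R :> R by rewrite ltr0n.
have [W2 W2g] := exists_uniform_subset sb (ltnW gh).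
have cW2 : #|W2| = (k * g)%N := card_uniform_subset W2g.
pose W1 := ~: W2.
have cW1 : #|~: W1| = (k * g)%N by rewrite setCK.
have cW1' : #|W1| = (k * (h - g))%N by rewrite cardsCs setCK cV cW2 mulnBr.
pose sq (W : {set V}) (tau : {ffun V -> 'I_k}) : R :=
  \sum_i \sum_j ovl R sigma W tau i j ^+ 2.
have sqW (W : {set V}) (t t' : {ffun V -> 'I_k}) : (forall x, x \in W -> t x = t' x) -> sq W t = sq W t'.
  move=> tt; apply: eq_bigr => i _; apply: eq_bigr => j _; congr (_ ^+ 2).
  by apply: eq_bigr => x /andP[xW _]; rewrite tt.
pose a : R := c1 / (k * h)%:R.
have KH : 0 < (k * h)%:R :> R by rewrite ltr0n muln_gt0 k0.
have a0 : 0 <= a by rewrite divr_ge0.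
have split_exp (tau : {ffun V -> 'I_k}) : expR (a * sqovl R sigma tau) <=
   expR (a * (1 + z) ^+ 2 * sq W1 tau) + expR (a * A2 * sq W2 tau).
  have := @sqr_sum_le_max R _ (fun d : 'I_k * 'I_k => ovl R sigma W1 tau d.1 d.2)
    (fun d => ovl R sigma W2 tau d.1 d.2) z z0.
  rewrite -!(pair_bigA _ (fun i j => ovl R sigma _ tau i j ^+ 2)).
  rewrite -(pair_bigA _ (fun i j => (ovl R sigma W1 tau i j + ovl R sigma W2 tau i j) ^+ 2)) /=.
  have -> : \sum_i \sum_j (ovl R sigma W1 tau i j + ovl R sigma W2 tau i j) ^+ 2 =
      sqovl R sigma tau.
    apply: eq_bigr => i _; apply: eq_bigr => j _; congr (_ ^+ 2).
    by rewrite (ovlT R sigma tau W1) /W1 setCK.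
  rewrite -/(sq W1 tau) -/(sq W2 tau) => -[|] le1.
    apply: (@le_trans _ _ (expR (a * (1 + z) ^+ 2 * sq W1 tau))).
      by rewrite ler_expR -mulrA ler_wpM2l.
    by rewrite lerDl expR_ge0.
  apply: (@le_trans _ _ (expR (a * A2 * sq W2 tau))).
    by rewrite ler_expR -mulrA ler_wpM2l.
  by rewrite lerDr expR_ge0.
rewrite -/a; apply: le_trans (ler_avg (fun t _ => split_exp t)) _.
rewrite avgD; apply: lerD.
- have d1 := @bal_density k h V cV R W1 g (fun t => expR (a * (1 + z) ^+ 2 * sq W1 t)).
  apply: le_trans (d1 _ _ _ _ _) _ => //.
  + by rewrite g0 ltnW.
  + by move=> t t' tt; rewrite (sqW _ _ _ tt).
  apply: ler_pM.
  + by rewrite exprn_ge0 // divr_ge0.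
  + by apply: avg_ge0 => t _; exact: expR_ge0.
  + apply: lerXn2r; rewrite ?nnegrE ?divr_ge0 ?mulr_ge0 //.
    by rewrite ler_pdivrMr ?ltr0n // -!natrM ler_nat.
  have rr : a * (1 + z) ^+ 2 * h%:R / kap <= r1.
    rewrite ler_pdivrMr // /a natrM.
    have -> : c1 / (k%:R * h%:R) * (1 + z) ^+ 2 * h%:R = c1 * (1 + z) ^+ 2 / k%:R.
      by field; rewrite !lt0r_neq0.
    by rewrite ler_pdivrMr // mulrAC -mulrA.
  apply: le_trans (Cf_mono _ _ rr r11).
  apply: iid_exp_sqr => //.
  + by rewrite mulr_ge0 // sqr_ge0.
  + move=> i; have /balP/(_ i) <- := sb.
    by apply/subset_leq_card/subsetP => x; rewrite !inE => /andP[].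
  + by have := le_lt_trans rr r11; rewrite ltr_pdivrMr // mul1r.
- have d2 := @bal_density k h V cV R W2 (h - g) (fun t => expR (a * A2 * sq W2 t)).
  apply: le_trans (d2 _ _ _ _ _) _ => //.
  + by rewrite subn_gt0 gh leq_subr.
  + by move=> t t' tt; rewrite (sqW _ _ _ tt).
  apply: ler_pM.
  + by rewrite exprn_ge0 // divr_ge0.
  + by apply: avg_ge0 => t _; exact: expR_ge0.
  + apply: lerXn2r; rewrite ?nnegrE ?divr_ge0 //.
    rewrite ler_pdivrMr ?ltr0n ?subn_gt0 // -natrM ler_nat mulnBr leq_subRL.
      by rewrite [(2 * h)%N]mul2n -addnn leq_add2r.
    by rewrite leq_mul2l ltnW.
  have rr : a * A2 * g%:R / kap <= 1 / 2.
    rewrite ler_pdivrMr // /a natrM.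
    have gN : g%:R * N2%:R <= h%:R :> R by rewrite -natrM ler_nat leq_trunc_div.
    have -> : c1 / (k%:R * h%:R) * A2 * g%:R = c1 * A2 * g%:R / (k%:R * h%:R) by ring.
    rewrite ler_pdivrMr ?mulr_gt0 //.
    have : c1 * A2 * g%:R <= N2%:R * (k%:R * kap) / 2 * g%:R by exact: ler_wpM2r.
    move/le_trans; apply.
    have -> : N2%:R * (k%:R * kap) / 2 * g%:R = (g%:R * N2%:R) * (k%:R * kap / 2) by ring.
    have -> : 1 / 2 * kap * (k%:R * h%:R) = h%:R * (k%:R * kap / 2) by ring.
    by rewrite ler_wpM2r // divr_ge0 // ltW.
  apply: le_trans (Cf_mono _ _ rr _); last by lra.
  apply: iid_exp_sqr => //.
  + by rewrite mulr_ge0 // ltW.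
  + by move=> i; rewrite W2g.
  + have rr1 : a * A2 * g%:R / kap < 1 by apply: le_lt_trans rr _; lra.
    by move: rr1; rewrite ltr_pdivrMr // mul1r.
Qed.

(** * Swaps and the overlap of two balanced colorings *)

Section Swap.
Variables (R : realType) (k h : nat) (V : finType).
Hypothesis cV : #|V| = (k * h)%N.
Local Notation col := {ffun V -> 'I_k}.
Local Notation n := (k * h)%N.

Definition swap (x y : V) (tau : col) : col := [ffun z => tau (tperm x y z)].

Lemma swapK x y : involutive (swap x y).
Proof. by move=> tau; apply/ffunP => z; rewrite !ffunE tpermK. Qed.

Lemma swap_bal x y tau : (swap x y tau \in bal k h V) = (tau \in bal k h V).
Proof.
rewrite !inE; apply: eq_forallb => j; congr (_ == _).
rewrite -(card_imset _ (@perm_inj _ (tperm x y))); apply: eq_card => z.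
rewrite -{1}[z](tpermK x y) mem_imset ?inE ?ffunE ?tpermK //; exact: perm_inj.
Qed.

Lemma sum_bal (sigma : col) (F : 'I_k -> R) : sigma \in bal k h V ->
  \sum_x F (sigma x) = h%:R * \sum_i F i.
Proof.
move=> /balP sb; rewrite (partition_big sigma xpredT) //= mulr_sumr.
apply: eq_bigr => i _; rewrite (eq_bigr (fun=> F i)); last by move=> x /eqP ->.
rewrite sumr_const mulr_natl -(sb i); congr (_ *+ _).
by apply: eq_card => x; rewrite !inE.
Qed.

Lemma sum_tperm (f g : V -> R) x y :
  \sum_z f z * g (tperm x y z) = \sum_z f z * g z + (f x - f y) * (g y - g x).
Proof.
have [<-|xy] := eqVneq x y.
  by rewrite !subrr mul0r addr0; apply: eq_bigr => z _; rewrite tperm1 perm1.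
rewrite (bigD1 x) //= (bigD1 y) 1?eq_sym //= [in RHS](bigD1 x) //= [in RHS](bigD1 y) 1?eq_sym //=.
rewrite tpermL tpermR (eq_bigr (fun z => f z * g z)); first by ring.
by move=> z /andP[zx zy]; rewrite tpermD // eq_sym.
Qed.

Variable sigma : col.
Hypothesis sb : sigma \in bal k h V.

Local Notation S tau := (ovl R sigma [set: V]%SET tau).
Local Notation Q tau := (sqovl R sigma tau).

Lemma ovl_row (tau : V -> 'I_k) i : (0 < k)%N -> \sum_j S tau i j = 0.
Proof.
move=> k0; rewrite /ovl exchange_big big1 //= => x _.
rewrite sumrB sumr_const card_ord -[_ *+ k]mulr_natr mulVf ?pnatr_eq0 -?lt0n //.
by rewrite (bigD1 (tau x)) //= eqxx big1 ?addr0 ?subrr // => j /negbTE; rewrite eq_sym => ->.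
Qed.

Lemma ovl_col (tau : col) j : (0 < k)%N -> tau \in bal k h V -> \sum_i S tau i j = 0.
Proof.
move=> k0 tb; rewrite /ovl.
transitivity (\sum_x ((tau x == j)%:R - k%:R^-1 : R)).
  rewrite [RHS](partition_big sigma xpredT) //=; apply: eq_bigr => i _.
  by apply: eq_bigl => x; rewrite inE.
rewrite (sum_bal (fun c => (c == j)%:R - k%:R^-1)) // sumrB sumr_const card_ord.
rewrite -[_ *+ k]mulr_natr mulVf ?pnatr_eq0 -?lt0n // (bigD1 j) //= eqxx big1 ?addr0 ?subrr ?mulr0 //.
by move=> i /negbTE ->.
Qed.

(** Since rows of the overlap matrix sum to zero, the quadratic form Q is a sum over vertices of an
    overlap entry at the colors of that vertex. This is the form on which a swap acts. *)
Lemma sqovl_diag (tau : V -> 'I_k) : (0 < k)%N -> Q tau = \sum_x S tau (sigma x) (tau x).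
Proof.
move=> k0; rewrite /sqovl.
under eq_bigr do under eq_bigr do rewrite expr2.
rewrite (sum_ovl sigma [set: V]%SET tau (S tau)).
apply: eq_big => [x|x _]; first by rewrite inE.
by rewrite ovl_row // mulr0 subr0.
Qed.

Definition dlt (tau : col) x y (i j : 'I_k) : R :=
  ((sigma x == i)%:R - (sigma y == i)%:R) * ((tau y == j)%:R - (tau x == j)%:R).

Lemma ovl_swap (tau : col) x y i j : S (swap x y tau) i j = S tau i j + dlt tau x y i j.
Proof.
have e (t : V -> 'I_k) : S t i j = \sum_z (sigma z == i)%:R * ((t z == j)%:R - k%:R^-1).
  rewrite /ovl big_mkcond /=; apply: eq_bigr => z _; rewrite inE /=.
  by case: (sigma z == i); rewrite ?mul1r ?mul0r.
rewrite !e.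
rewrite (eq_bigr (fun z => (sigma z == i)%:R * ((tau (tperm x y z) == j)%:R - k%:R^-1))); last first.
  by move=> z _; rewrite ffunE.
rewrite (sum_tperm (fun z => (sigma z == i)%:R) (fun z => (tau z == j)%:R - k%:R^-1)).
by rewrite /dlt; congr (_ + _ * _); ring.
Qed.

Lemma sum_delta2 (F : 'I_k -> 'I_k -> R) (tau : col) x y :
  \sum_i \sum_j F i j * dlt tau x y i j =
  F (sigma x) (tau y) - F (sigma x) (tau x) - F (sigma y) (tau y) + F (sigma y) (tau x).
Proof.
have one (G : 'I_k -> R) a : \sum_i (a == i)%:R * G i = G a.
  rewrite (bigD1 a) //= eqxx mul1r big1 ?addr0 // => i /negbTE.
  by rewrite eq_sym => ->; rewrite mul0r.
have inner i : \sum_j F i j * dlt tau x y i j =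
   (sigma x == i)%:R * (F i (tau y) - F i (tau x)) - (sigma y == i)%:R * (F i (tau y) - F i (tau x)).
  rewrite -(one (F i) (tau y)) -(one (F i) (tau x)) -sumrB !mulr_sumr -sumrB.
  by apply: eq_bigr => j _; rewrite /dlt; ring.
by under eq_bigr do rewrite inner; rewrite sumrB !(one (fun i => F i (tau y) - F i (tau x))); ring.
Qed.

Definition gain (tau : col) x y : R :=
  S tau (sigma x) (tau y) - S tau (sigma x) (tau x) - S tau (sigma y) (tau y) + S tau (sigma y) (tau x).

Lemma sqovl_swap (tau : col) x y :
  Q (swap x y tau) = Q tau + 2 * gain tau x y + \sum_i \sum_j dlt tau x y i j ^+ 2.
Proof.
rewrite /gain -sum_delta2 mulr_sumr -!big_split /=; apply: eq_bigr => i _.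
rewrite mulr_sumr -!big_split /=; apply: eq_bigr => j _.
by rewrite ovl_swap; ring.
Qed.

Lemma dlt_sqr (tau : col) x y : 0 <= \sum_i \sum_j dlt tau x y i j ^+ 2 <= 4.
Proof.
rewrite sumr_ge0 /=; last by move=> i _; apply: sumr_ge0 => j _; exact: sqr_ge0.
under eq_bigr do under eq_bigr do rewrite expr2.
rewrite sum_delta2 /dlt !eqxx.
by do 4! case: (_ == _); rewrite /=; lra.
Qed.

Lemma dlt_corner (tau : col) x y :
  dlt tau x y (sigma x) (tau y) = (1 - (sigma y == sigma x)%:R) * (1 - (tau x == tau y)%:R).
Proof. by rewrite /dlt !eqxx. Qed.

Lemma sqovl_ge0 (tau : col) : 0 <= Q tau.
Proof. by apply: sumr_ge0 => i _; apply: sumr_ge0 => j _; exact: sqr_ge0. Qed.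

Lemma ovl_le_sqrt (tau : col) i j : `|S tau i j| <= Num.sqrt (Q tau).
Proof.
rewrite -sqrtr_sqr ler_sqrt ?sqovl_ge0 // /sqovl (bigD1 i) //= (bigD1 j) //=.
rewrite -addrA lerDl addr_ge0 // sumr_ge0 // => ? _; rewrite ?sqr_ge0 //.
by rewrite sumr_ge0 // => ? _; rewrite sqr_ge0.
Qed.

Lemma gain_le (tau : col) x y : `|gain tau x y| <= 4 * Num.sqrt (Q tau).
Proof.
have h1 := ovl_le_sqrt tau (sigma x) (tau y); have h2 := ovl_le_sqrt tau (sigma x) (tau x).
have h3 := ovl_le_sqrt tau (sigma y) (tau y); have h4 := ovl_le_sqrt tau (sigma y) (tau x).
rewrite /gain; move: h1 h2 h3 h4; rewrite !ler_norml => /andP[? ?] /andP[? ?] /andP[? ?] /andP[? ?].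
by apply/andP; split; lra.
Qed.

(** The main term of the Stein equation. The corner increment is 1 exactly when x and y differ in
    both colors, so inclusion-exclusion counts pairs; the coincidences in both colors contribute
    Q. *)
Lemma sum_corner (tau : col) : (0 < k)%N -> tau \in bal k h V ->
  \sum_x \sum_y dlt tau x y (sigma x) (tau y) = (n%:R * (1 - k%:R^-1)) ^+ 2 + Q tau.
Proof.
move=> k0 tb; have K0 : k%:R != 0 :> R by rewrite pnatr_eq0 -lt0n.
have one (t : col) x : t \in bal k h V -> \sum_y (t y == t x)%:R = h%:R :> R.
  move=> tb'; rewrite (sum_bal (fun c => (c == t x)%:R)) // (bigD1 (t x)) //= eqxx big1 ?addr0 ?mulr1 //.
  by move=> i /negbTE ->.
have qq : Q tau = \sum_x (\sum_y (sigma y == sigma x)%:R * (tau y == tau x)%:R - h%:R / k%:R).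
  rewrite sqovl_diag //; apply: eq_bigr => x _; rewrite /ovl.
  transitivity (\sum_y ((sigma y == sigma x)%:R * (tau y == tau x)%:R - (sigma y == sigma x)%:R / k%:R : R)).
    rewrite big_mkcond /=; apply: eq_bigr => y _; rewrite inE /=.
    by case: (sigma y == _); rewrite /= ?mul1r ?mul0r ?subr0.
  by rewrite sumrB -mulr_suml one.
have row x : \sum_y dlt tau x y (sigma x) (tau y) =
    n%:R - 2 * h%:R + h%:R / k%:R + (\sum_y (sigma y == sigma x)%:R * (tau y == tau x)%:R - h%:R / k%:R).
  transitivity (\sum_y (1 - (sigma y == sigma x)%:R - (tau y == tau x)%:R +
      (sigma y == sigma x)%:R * (tau y == tau x)%:R : R)).
    by apply: eq_bigr => y _; rewrite dlt_corner [tau x == _]eq_sym; ring.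
  by rewrite big_split /= !sumrB !one // sumr_const cV; ring.
rewrite (eq_bigr _ (fun x _ => row x)) big_split /= -qq sumr_const cV -[_ *+ _]mulr_natr.
by congr (_ + _); rewrite natrM; field.
Qed.

(** Of the four parts of the gain, the first gives [h^2 Q], the two diagonal ones vanish by the zero
    row and column sums, and the last is a quartic form in the overlaps, at most [Q^2] by the
    inequality of means. *)
Lemma sum_gain (tau : col) : (0 < k)%N -> tau \in bal k h V ->
  \sum_x \sum_y gain tau x y * S tau (sigma x) (tau y) <= h%:R ^+ 2 * Q tau + Q tau ^+ 2.
Proof.
move=> k0 tb.
set s := S tau.
have row i : \sum_j s i j = 0 by exact: ovl_row.
have colm j : \sum_i s i j = 0 by exact: ovl_col.
have A1 : \sum_x \sum_y s (sigma x) (tau y) ^+ 2 = h%:R ^+ 2 * Q tau.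
  under eq_bigr do rewrite (sum_bal (fun j => s _ j ^+ 2) tb).
  by rewrite (sum_bal (fun i => h%:R * \sum_j s i j ^+ 2) sb) -mulr_sumr mulrA.
have A2 : \sum_x \sum_y s (sigma x) (tau x) * s (sigma x) (tau y) = 0.
  rewrite big1 // => x _; rewrite -mulr_sumr (sum_bal (fun j => s _ j) tb) row.
  by rewrite !mulr0.
have A3 : \sum_x \sum_y s (sigma y) (tau y) * s (sigma x) (tau y) = 0.
  rewrite exchange_big big1 //= => y _; rewrite -mulr_sumr (sum_bal (fun i => s i _) sb) colm.
  by rewrite !mulr0.
have dg (t : 'I_k -> 'I_k -> R) : (forall i, \sum_j t i j = 0) ->
   \sum_y t (sigma y) (tau y) = \sum_i \sum_j t i j * s i j.
  move=> t0; rewrite (sum_ovl sigma [set: V]%SET tau t).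
  apply: eq_big => [x|x _]; first by rewrite inE.
  by rewrite t0 mulr0 subr0.
have A4 : \sum_x \sum_y s (sigma y) (tau x) * s (sigma x) (tau y) <= Q tau ^+ 2.
  have e x : \sum_y s (sigma y) (tau x) * s (sigma x) (tau y) =
     \sum_i \sum_j s i (tau x) * s (sigma x) j * s i j.
    by rewrite (dg (fun i j => s i (tau x) * s (sigma x) j)) // => i; rewrite -mulr_sumr row mulr0.
  under eq_bigr do rewrite e.
  rewrite (dg (fun a b => \sum_i \sum_j s i b * s a j * s i j)); last first.
    move=> a; rewrite exchange_big big1 //= => i _; rewrite exchange_big big1 //= => j _.
    by rewrite -!mulr_suml row !mul0r.
  apply: (@le_trans _ _ (\sum_a \sum_b \sum_i \sum_j
     ((s a b ^+ 2 * s i j ^+ 2) / 2 + (s a j ^+ 2 * s i b ^+ 2) / 2))).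
    apply: ler_sum => a _; apply: ler_sum => b _; rewrite mulr_suml; apply: ler_sum => i _.
    rewrite mulr_suml; apply: ler_sum => j _.
    have := sqr_ge0 (s a b * s i j - s a j * s i b); nra.
  have QQ : Q tau ^+ 2 = \sum_a \sum_b \sum_i \sum_j s a b ^+ 2 * s i j ^+ 2.
    rewrite expr2 /sqovl mulr_suml; apply: eq_bigr => a _; rewrite mulr_suml; apply: eq_bigr => b _.
    by rewrite mulr_sumr; apply: eq_bigr => i _; rewrite mulr_sumr.
  have QQ' : Q tau ^+ 2 = \sum_a \sum_b \sum_i \sum_j s a j ^+ 2 * s i b ^+ 2.
    rewrite QQ; apply: eq_bigr => a _.
    transitivity (\sum_j \sum_b \sum_i s a j ^+ 2 * s i b ^+ 2).
      by apply: eq_bigr => j _; rewrite exchange_big.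
    rewrite exchange_big /=; apply: eq_bigr => b _; exact: exchange_big.
  under eq_bigr do under eq_bigr do under eq_bigr do rewrite big_split /=.
  under eq_bigr do under eq_bigr do rewrite big_split /=.
  under eq_bigr do rewrite big_split /=.
  rewrite big_split /=.
  have half (F : 'I_k -> 'I_k -> 'I_k -> 'I_k -> R) : \sum_a \sum_b \sum_i \sum_j F a b i j / 2 =
      (\sum_a \sum_b \sum_i \sum_j F a b i j) / 2.
    rewrite mulr_suml; apply: eq_bigr => a _; rewrite mulr_suml; apply: eq_bigr => b _.
    by rewrite mulr_suml; apply: eq_bigr => i _; rewrite mulr_suml.
  by rewrite !half -QQ -QQ'; lra.
have -> : \sum_x \sum_y gain tau x y * s (sigma x) (tau y) =
   \sum_x \sum_y s (sigma x) (tau y) ^+ 2 - \sum_x \sum_y s (sigma x) (tau x) * s (sigma x) (tau y)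
   - \sum_x \sum_y s (sigma y) (tau y) * s (sigma x) (tau y)
   + \sum_x \sum_y s (sigma y) (tau x) * s (sigma x) (tau y).
  rewrite -!sumrB -big_split /=; apply: eq_bigr => x _; rewrite -!sumrB -big_split /=.
  by apply: eq_bigr => y _; rewrite /gain -/s; ring.
by rewrite A1 A2 A3 !subr0 lerD2l.
Qed.

End Swap.

(** * Stein's method for the overlap moment *)

Section Taylor.
Variable R : realType.

Lemma expR_taylor2 (y : R) : expR y - 1 - y <= y ^+ 2 * expR `|y|.
Proof.
have h (z : R) : expR z - 1 <= z * expR z.
  have := expR_ge1Dx (- z); rewrite expRN => h.
  have e0 := expR_gt0 z.
  have : (1 - z) * expR z <= 1 by rewrite -ler_pdivlMr // div1r.
  lra.
have [y0|y0] := leP 0 y.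
  rewrite ger0_norm //; have h1 := h y.
  have : y * (expR y - 1) <= y * (y * expR y) by rewrite ler_wpM2l.
  lra.
rewrite ltr0_norm //.
have h1 := h y; have h2 := expR_ge1Dx y.
have h3 : y * (expR y - 1) <= y ^+ 2 by nra.
have : y ^+ 2 <= y ^+ 2 * expR (- y).
  rewrite ler_peMr ?sqr_ge0 //; have := expR_ge1Dx (- y); lra.
lra.
Qed.

Lemma bernoulli (v : R) (t : nat) : -1 <= v -> 1 + t%:R * v <= (1 + v) ^+ t.
Proof.
move=> v1; elim: t => [|t IH]; first by rewrite mul0r addr0.
rewrite exprS -natr1.
have : (1 + v) * (1 + t%:R * v) <= (1 + v) * (1 + v) ^+ t by apply: ler_wpM2l => //; lra.
apply: le_trans; have : 0 <= t%:R * v ^+ 2 by rewrite mulr_ge0 ?sqr_ge0.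
rewrite expr2; lra.
Qed.

Lemma pow_le_expR (v : R) (t : nat) : -1 <= v -> (1 + v) ^+ t <= expR (t%:R * v).
Proof.
move=> v1; rewrite expRM_natl; apply: lerXn2r; rewrite ?nnegrE ?expR_ge0 //; first by lra.
exact: expR_ge1Dx.
Qed.

Lemma pow_taylor (v : R) (t : nat) : -1 <= v ->
  0 <= (1 + v) ^+ t - 1 - t%:R * v <= (t%:R * v) ^+ 2 * expR `|t%:R * v|.
Proof.
move=> v1; have := bernoulli t v1; have := pow_le_expR t v1; have := expR_taylor2 (t%:R * v).
by move=> h1 h2 h3; apply/andP; split; lra.
Qed.

(** Turns polynomial errors in Q/n into an exponential with arbitrarily small rate eta, which the
    slack in the entropy bound can absorb. *)
Lemma one_sqr_le_expR (eta y : R) : 0 < eta -> 0 <= y ->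
  1 + y ^+ 2 <= (1 + 2 / eta ^+ 2) * expR (eta * y).
Proof.
move=> e0 y0; have e2 : 0 < eta ^+ 2 by rewrite exprn_gt0.
have ey : 0 <= eta * y by rewrite mulr_ge0 // ltW.
have := @expR_ge1Dxn R (eta * y) 1 ey; rewrite (_ : 2`! = 2)%N // => h.
have c0 : 0 <= 2 / eta ^+ 2 by rewrite divr_ge0 // ltW.
have h1 : (1 + 2 / eta ^+ 2) * (1 + (eta * y) ^+ 2 / 2) <= (1 + 2 / eta ^+ 2) * expR (eta * y).
  by apply: ler_wpM2l => //; lra.
apply: le_trans h1.
have -> : (1 + 2 / eta ^+ 2) * (1 + (eta * y) ^+ 2 / 2) =
   1 + 2 / eta ^+ 2 + (eta * y) ^+ 2 / 2 + y ^+ 2 by field; rewrite lt0r_neq0.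
have := sqr_ge0 (eta * y); lra.
Qed.

(* The change of [(1 + Q/s)^t S] under one swap, with [Q' = Q + 2 g + d] and
   [S' = S + e]. *)
Lemma swap_step (s u w g d a e E0 : R) (t : nat) :
  0 < s -> 0 <= u -> 0 <= u + 2 * g + d -> 0 <= w ->
  `|g| <= 4 * w -> 0 <= d <= 4 -> `|a| <= w -> 0 <= e <= 1 ->
  expR (t%:R / s * (8 * w + 4)) <= E0 ->
  (1 + (u + 2 * g + d) / s) ^+ t * (a + e) - (1 + u / s) ^+ t * a <=
  (1 + u / s) ^+ t * (e + 2 * t%:R / (s + u) * (g * a) +
     (t%:R / s * (12 * (w + 1)) + 64 * E0 * (t%:R / s) ^+ 2 * (w + 1) ^+ 3)).
Proof.
move=> s0 u0 u'0 w0; rewrite !ler_norml => /andP[g1 g2] /andP[d0 d4] /andP[a1 a2] /andP[e0 e1] hE.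
have su : 0 < s + u by lra.
set D := 2 * g + d.
have D1 : `|D| <= 8 * w + 4 by rewrite ler_norml /D; apply/andP; split; lra.
pose v := D / (s + u).
have v1 : -1 <= v by rewrite ler_pdivlMr // /D; lra.
have fac : 1 + (u + 2 * g + d) / s = (1 + u / s) * (1 + v).
  by rewrite /v /D; field; rewrite !lt0r_neq0.
rewrite fac exprMn.
have /andP[r0 r1] := pow_taylor t v1.
set rho := (1 + v) ^+ t - 1 - t%:R * v in r0 r1.
have -> : (1 + v) ^+ t = 1 + t%:R * v + rho by rewrite /rho; ring.
set P := (1 + u / s) ^+ t.
have P0 : 0 <= P by rewrite exprn_ge0 // addr_ge0 // divr_ge0 // ltW.
have -> : P * (1 + t%:R * v + rho) * (a + e) - P * a =
   P * (e + t%:R * v * a + t%:R * v * e + rho * (a + e)) by ring.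
apply: ler_wpM2l => //.
pose B := t%:R / s.
have B0 : 0 <= B by rewrite divr_ge0 // ltW.
have tsu : 0 <= t%:R / (s + u) <= B.
  rewrite divr_ge0 ?(ltW su) //= ler_wpM2l // lef_pV2 ?posrE //; lra.
case/andP: tsu => tsu0 tsu1.
have tv : `|t%:R * v| <= B * (8 * w + 4).
  rewrite /v mulrA mulrAC normrM (ger0_norm tsu0).
  by apply: ler_pM => //.
have h1 : t%:R * v * a <= 2 * t%:R / (s + u) * (g * a) + B * (4 * w).
  have -> : t%:R * v * a = 2 * t%:R / (s + u) * (g * a) + t%:R / (s + u) * (d * a).
    by rewrite /v /D; field; rewrite lt0r_neq0.
  rewrite lerD2l; apply: (@le_trans _ _ (t%:R / (s + u) * (4 * w))).
    by apply: ler_wpM2l => //; nra.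
  by apply: ler_wpM2r => //; lra.
have h2 : t%:R * v * e <= B * (8 * w + 4).
  apply: le_trans (ler_norm _) _; rewrite normrM (ger0_norm e0).
  apply: le_trans tv; rewrite ler_piMr //.
have h3 : rho * (a + e) <= 64 * E0 * B ^+ 2 * (w + 1) ^+ 3.
  have hr : rho <= (B * (8 * w + 4)) ^+ 2 * E0.
    apply: le_trans r1 _; apply: ler_pM; rewrite ?sqr_ge0 ?expR_ge0 //.
      by rewrite -real_normK ?num_real //; apply: lerXn2r; rewrite ?nnegrE // mulr_ge0 //; lra.
    by apply: le_trans hE; rewrite ler_expR.
  have E00 : 0 <= E0 by apply: le_trans hE; exact: expR_ge0.
  apply: (@le_trans _ _ (rho * (w + 1))); first by apply: ler_wpM2l => //; lra.
  apply: (@le_trans _ _ ((B * (8 * w + 4)) ^+ 2 * E0 * (w + 1))).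
    by apply: ler_wpM2r => //; lra.
  have -> : 64 * E0 * B ^+ 2 * (w + 1) ^+ 3 = (B * (8 * (w + 1))) ^+ 2 * E0 * (w + 1) by ring.
  apply: ler_wpM2r; first by lra.
  have i1 : 0 <= B * (8 * w + 4) by apply: mulr_ge0 => //; lra.
  have i2 : B * (8 * w + 4) <= B * (8 * (w + 1)) by apply: ler_wpM2l => //; lra.
  apply: ler_wpM2r => //; apply: lerXn2r => //; rewrite nnegrE //.
  exact: le_trans i1 i2.
rewrite -/B; have : B * (12 * (w + 1)) = B * (4 * w) + B * (8 * w + 4) + B * 8 by ring.
have : 0 <= B * 8 by rewrite mulr_ge0.
lra.
Qed.

Lemma quartic_bounds (r : R) : 0 <= r ->
  [/\ r + 1 <= 2 * (1 + r ^+ 4), (r + 1) ^+ 3 <= 8 * (1 + r ^+ 4) & r ^+ 2 <= 1 + r ^+ 4].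
Proof.
move=> r0; have -> : r ^+ 4 = (r ^+ 2) ^+ 2 by ring.
have h1 := sqr_ge0 (r - 1); have h2 := sqr_ge0 (r ^+ 2 - 1); have h5 := sqr_ge0 (r ^+ 2).
have p1 : 0 <= (r - 1) ^+ 2 * (r ^+ 2 + r + 1).
  by rewrite mulr_ge0 //; have := sqr_ge0 r; lra.
have e3 : (r - 1) ^+ 2 * (r ^+ 2 + r + 1) = (r ^+ 2) ^+ 2 - r ^+ 3 - r + 1 by ring.
have e4 : (r + 1) ^+ 3 = r ^+ 3 + 3 * r ^+ 2 + 3 * r + 1 by ring.
have e1 : (r - 1) ^+ 2 = r ^+ 2 - 2 * r + 1 by ring.
have e2 : (r ^+ 2 - 1) ^+ 2 = (r ^+ 2) ^+ 2 - 2 * r ^+ 2 + 1 by ring.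
rewrite e1 in h1; rewrite e2 in h2; rewrite e3 in p1; rewrite e4.
by split; lra.
Qed.

(** In the scale [r = sqrt (Q / n)] every error of the swap expansion, summed over all pairs, is of
    order n^(3/2) times a quartic in r, against a main term of order n^2. *)
Lemma err_poly (T K n u w : R) : 0 <= T -> 0 <= K -> 1 <= n -> 0 <= u -> w = Num.sqrt u ->
  u + 8 * T / n * u ^+ 2 + n ^+ 2 * (4 * T / n * (12 * (w + 1)) +
     K / n ^+ 2 * (w + 1) ^+ 3) <=
  n * Num.sqrt n * ((1 + 104 * T + 8 * K) * (1 + (u / n) ^+ 2)).
Proof.
move=> T0 K0 n1 u0 wE.
have n0 : 0 < n by lra.
set z := Num.sqrt n; have z1 : 1 <= z by rewrite -(sqrtr1 R) /z; exact: ler_wsqrtr.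
have zn : n = z ^+ 2 by rewrite sqr_sqrtr // ltW.
pose r := Num.sqrt (u / n).
have r0 : 0 <= r by rewrite sqrtr_ge0.
have y0 : 0 <= u / n by rewrite divr_ge0 // ltW.
have rr : r ^+ 2 = u / n by rewrite sqr_sqrtr.
have uE : u = n * r ^+ 2 by rewrite rr mulrC mulfVK // lt0r_neq0.
have wz : w = z * r by rewrite wE uE sqrtrM ?(ltW n0) // sqrtr_sqr ger0_norm.
rewrite -rr.
have -> : u + 8 * T / n * u ^+ 2 + n ^+ 2 * (4 * T / n * (12 * (w + 1)) +
     K / n ^+ 2 * (w + 1) ^+ 3) =
   n * (r ^+ 2 + 8 * T * r ^+ 4 + 48 * T * (w + 1)) + K * (w + 1) ^+ 3.
  by rewrite uE; field; rewrite lt0r_neq0.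
have w1 : w + 1 <= z * (r + 1) by rewrite wz mulrDr mulr1; lra.
have w0 : 0 <= w by rewrite wz mulr_ge0 //; lra.
have r4 : 0 <= r ^+ 4 by rewrite exprn_ge0.
have [rle1 rle3 rle2] := quartic_bounds r0.
have w3 : (w + 1) ^+ 3 <= n * z * (8 * (1 + r ^+ 4)).
  apply: (@le_trans _ _ ((z * (r + 1)) ^+ 3)).
    by apply: lerXn2r; rewrite ?nnegrE ?mulr_ge0 //; lra.
  have -> : (z * (r + 1)) ^+ 3 = n * z * (r + 1) ^+ 3 by rewrite zn; ring.
  by apply: ler_wpM2l => //; rewrite mulr_ge0 // ltW //; lra.
have -> : (r ^+ 2) ^+ 2 = r ^+ 4 by ring.
have c1 : K * (w + 1) ^+ 3 <= K * (n * z * (8 * (1 + r ^+ 4))).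
  exact: ler_wpM2l.
have c2 : n * (r ^+ 2 + 8 * T * r ^+ 4 + 48 * T * (w + 1)) <=
   n * (z * ((1 + 104 * T) * (1 + r ^+ 4))).
  apply: ler_wpM2l; first by lra.
  have k1 : 48 * T * (w + 1) <= 48 * T * (z * (2 * (1 + r ^+ 4))).
    apply: ler_wpM2l; first by lra.
    by apply: le_trans w1 _; apply: ler_wpM2l => //; lra.
  have k2 : r ^+ 2 + 8 * T * r ^+ 4 <= z * ((1 + 8 * T) * (1 + r ^+ 4)).
    have : r ^+ 2 + 8 * T * r ^+ 4 <= (1 + 8 * T) * (1 + r ^+ 4).
      have : 0 <= T * 8 * 1 by lra.
      rewrite mulrDl mul1r mulrDr mulr1; lra.
    move/le_trans; apply; rewrite ler_peMl // mulr_ge0 //; lra.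
  lra.
lra.
Qed.

End Taylor.

Section Stein.
Variables (R : realType) (k h : nat) (V : finType).
Hypothesis cV : #|V| = (k * h)%N.
Local Notation col := {ffun V -> 'I_k}.
Local Notation n := (k * h)%N.
Variable sigma : col.
Hypothesis sb : sigma \in bal k h V.
Local Notation S tau := (ovl R sigma [set: V]%SET tau).
Local Notation Q tau := (sqovl R sigma tau).

Lemma avg_swap x y (F : col -> R) :
  avg (bal k h V) (fun tau => F (swap x y tau)) = avg (bal k h V) F.
Proof.
rewrite /avg; congr (_ / _).
rewrite [RHS](reindex_inj (inv_inj (@swapK k V x y))) /=.
by apply: eq_bigl => tau; rewrite swap_bal.
Qed.

(** Swapping x and y preserves the balanced law and puts the color [tau y] at x. The subtracted term
    may be inserted for free: as y varies, [tau y] takes every color h times and the rows of S sum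
    to zero. *)
Lemma stein_identity (G : col -> R) : (0 < k)%N ->
  n%:R * avg (bal k h V) (fun tau => G tau * Q tau) =
  avg (bal k h V) (fun tau => \sum_x \sum_y
    (G (swap x y tau) * S (swap x y tau) (sigma x) (tau y) - G tau * S tau (sigma x) (tau y))).
Proof.
move=> k0.
have z tau : tau \in bal k h V -> \sum_x \sum_y G tau * S tau (sigma x) (tau y) = 0.
  move=> tb; rewrite big1 // => x _; rewrite -mulr_sumr.
  by rewrite (sum_bal (fun j => S tau _ j) tb) ovl_row // !mulr0.
transitivity (\sum_x \sum_(y : V) avg (bal k h V) (fun tau => G tau * S tau (sigma x) (tau x))).
  rewrite exchange_big /=.
  rewrite (eq_bigr (fun=> avg (bal k h V) (fun tau => G tau * Q tau))); last first.
    move=> y _; rewrite -avg_sum; apply: eq_avg => tau _.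
    by rewrite sqovl_diag // mulr_sumr.
  by rewrite sumr_const cV mulr_natl.
transitivity (avg (bal k h V) (fun tau => \sum_x \sum_y
   G (swap x y tau) * S (swap x y tau) (sigma x) (tau y))).
  rewrite avg_sum; apply: eq_bigr => x _; rewrite avg_sum; apply: eq_bigr => y _.
  rewrite -(avg_swap x y); apply: eq_avg => tau _.
  by rewrite {4}/swap ffunE tpermL.
apply: eq_avg => tau tb; under [RHS]eq_bigr do rewrite sumrB.
by rewrite sumrB (z tau tb) subr0.
Qed.

(** The number of ordered pairs bichromatic under both colorings is [sn + Q]. Hence [phi t] compares
    the joint law of t edges with the product of the two single-coloring laws, up to a factor
    [(1 - 1/n)^t]. *)
Definition sn : R := (n%:R * (1 - k%:R^-1)) ^+ 2.
Definition phi (t : nat) (tau : col) : R := (1 + Q tau / sn) ^+ t.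

Lemma sqrt_sqovl_le (tau : col) : (0 < k)%N -> Num.sqrt (Q tau) <= k%:R * n%:R.
Proof.
move=> k0.
rewrite -[X in _ <= X]ger0_norm ?mulr_ge0 // -sqrtr_sqr; apply: ler_wsqrtr.
apply: (@le_trans _ _ (\sum_(i < k) \sum_(j < k) (n%:R : R) ^+ 2)).
  apply: ler_sum => i _; apply: ler_sum => j _.
  rewrite -real_normK ?num_real //; apply: lerXn2r; rewrite ?nnegrE //.
  by rewrite -cV norm_ovl_le.
rewrite !sumr_const !card_ord -mulr_natl -[_ *+ k]mulr_natl exprMn; lra.
Qed.

Lemma sn_ge : (1 < k)%N -> n%:R ^+ 2 / 4 <= sn.
Proof.
move=> k2; rewrite /sn exprMn.
have K : 2 <= k%:R :> R by rewrite ler_nat.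
have Ki : k%:R^-1 <= 2^-1 :> R by rewrite lef_pV2 ?posrE //; lra.
have Ki0 : 0 <= k%:R^-1 :> R by rewrite invr_ge0.
apply: ler_wpM2l; first by rewrite sqr_ge0.
have : 1 / 2 <= 1 - k%:R^-1 :> R by lra.
nra.
Qed.

Definition steinC (T eta : R) : R :=
  (1 + 104 * T + 8 * (64 * expR (4 * T * (8 * k%:R + 4)) * (4 * T) ^+ 2)) *
  (1 + 2 / eta ^+ 2).

(** Summing [swap_step] over all pairs: corner increments give [sn], gains give the feedback term in
    [h^2 Q], and what remains is of order n^(3/2) times a slowly growing exponential of Q/n. *)
Lemma stein_pointwise (T eta : R) (t : nat) (tau : col) :
  (1 < k)%N -> (0 < h)%N -> 0 <= T -> 0 < eta -> t%:R <= T * n%:R -> tau \in bal k h V ->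
  \sum_x \sum_y (phi t (swap x y tau) * S (swap x y tau) (sigma x) (tau y)
      - phi t tau * S tau (sigma x) (tau y)) <=
  phi t tau * (sn + 2 * t%:R / sn * (h%:R ^+ 2 * Q tau) +
    steinC T eta * (n%:R * Num.sqrt n%:R) * expR (eta * (Q tau / n%:R))).
Proof.
move=> k2 h0 T0 eta0 tT tb; rewrite /steinC.
pose E0 := expR (4 * T * (8 * k%:R + 4)).
pose C := (1 + 104 * T + 8 * (64 * E0 * (4 * T) ^+ 2)) * (1 + 2 / eta ^+ 2).
rewrite -/E0 -/C.
have k0 : (0 < k)%N by exact: ltnW.
have n0 : 0 < n%:R :> R by rewrite ltr0n muln_gt0 k0.
have n1 : 1 <= n%:R :> R by rewrite ler1n muln_gt0 k0.
have KR : k%:R != 0 :> R by rewrite pnatr_eq0 -lt0n.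
have HR : h%:R != 0 :> R by rewrite pnatr_eq0 -lt0n.
have s4 := sn_ge k2.
have s0 : 0 < sn by apply: lt_le_trans s4; rewrite divr_gt0 // exprn_gt0.
set u := Q tau; have u0 : 0 <= u by exact: sqovl_ge0.
set w := Num.sqrt u; have w0 : 0 <= w by rewrite sqrtr_ge0.
have wkn : w <= k%:R * n%:R by exact: sqrt_sqovl_le.
have B0 : 0 <= t%:R / sn by rewrite divr_ge0 // ltW.
have B1 : t%:R / sn <= 4 * T / n%:R.
  rewrite ler_pdivrMr //; apply: le_trans tT _.
  have -> : T * n%:R = 4 * T / n%:R * (n%:R ^+ 2 / 4) by field; rewrite KR HR.
  by apply: ler_wpM2l => //; rewrite divr_ge0 ?mulr_ge0 // ltW.
have hE : expR (t%:R / sn * (8 * w + 4)) <= E0.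
  rewrite ler_expR; apply: (@le_trans _ _ (4 * T / n%:R * (8 * (k%:R * n%:R) + 4 * n%:R))).
    apply: ler_pM => //; lra.
  by apply: ler_of_eq; field; rewrite KR HR.
have E00 : 0 <= E0 by exact: expR_ge0.
set P := phi t tau.
have P0 : 0 <= P by rewrite exprn_ge0 // addr_ge0 // divr_ge0 // ltW.
pose Err := t%:R / sn * (12 * (w + 1)) + 64 * E0 * (t%:R / sn) ^+ 2 * (w + 1) ^+ 3.
have step x y : phi t (swap x y tau) * S (swap x y tau) (sigma x) (tau y)
      - P * S tau (sigma x) (tau y) <=
   P * (dlt R sigma tau x y (sigma x) (tau y) +
     2 * t%:R / (sn + u) * (gain R sigma tau x y * S tau (sigma x) (tau y)) + Err).
  rewrite /phi sqovl_swap ovl_swap; apply: swap_step => //.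
  - by rewrite -/u -sqovl_swap; exact: sqovl_ge0.
  - exact: gain_le.
  - exact: dlt_sqr.
  - exact: ovl_le_sqrt.
  - by rewrite dlt_corner; do 2! case: (_ == _); rewrite /=; lra.
apply: le_trans (ler_sum _ (fun x _ => ler_sum _ (fun y _ => step x y))) _.
have -> : \sum_x \sum_y P * (dlt R sigma tau x y (sigma x) (tau y) +
     2 * t%:R / (sn + u) * (gain R sigma tau x y * S tau (sigma x) (tau y)) + Err) =
  P * (\sum_x \sum_y dlt R sigma tau x y (sigma x) (tau y) +
     2 * t%:R / (sn + u) * \sum_x \sum_y gain R sigma tau x y * S tau (sigma x) (tau y)
     + n%:R ^+ 2 * Err).
  under eq_bigr do rewrite -mulr_sumr.
  rewrite -mulr_sumr; congr (_ * _).
  have -> : n%:R ^+ 2 * Err = \sum_(x : V) \sum_(y : V) Err.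
    by rewrite !sumr_const cV -mulrnA -[RHS]mulr_natl (natrM _ n n) expr2.
  rewrite mulr_sumr -!big_split /=; apply: eq_bigr => x _.
  by rewrite mulr_sumr -!big_split.
apply: ler_wpM2l => //.
rewrite (sum_corner R cV sb k0 tb) -/sn -/u.
have hg := sum_gain R sb k0 tb.
rewrite -/u in hg.
have su : 0 < sn + u by lra.
have hh0 : 0 <= h%:R ^+ 2 * u + u ^+ 2 by rewrite addr_ge0 ?mulr_ge0 ?sqr_ge0.
have g1 : 2 * t%:R / (sn + u) * \sum_x \sum_y gain R sigma tau x y * S tau (sigma x) (tau y) <=
   2 * t%:R / sn * (h%:R ^+ 2 * u + u ^+ 2).
  apply: (@le_trans _ _ (2 * t%:R / (sn + u) * (h%:R ^+ 2 * u + u ^+ 2))).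
    by apply: ler_wpM2l => //; rewrite divr_ge0 ?mulr_ge0 // ltW.
  apply: ler_wpM2r => //; apply: ler_wpM2l; first by rewrite mulr_ge0.
  by rewrite lef_pV2 ?posrE //; lra.
have g2 : Err <= 4 * T / n%:R * (12 * (w + 1)) + 64 * E0 * (4 * T / n%:R) ^+ 2 * (w + 1) ^+ 3.
  apply: lerD; first by apply: ler_wpM2r => //; lra.
  apply: ler_wpM2r; first by rewrite exprn_ge0 //; lra.
  apply: ler_wpM2l; first by rewrite mulr_ge0.
  by apply: lerXn2r; rewrite ?nnegrE //; exact: le_trans B1.
have g3 : 2 * t%:R / sn * u ^+ 2 <= 8 * T / n%:R * u ^+ 2.
  apply: ler_wpM2r; first by rewrite sqr_ge0.
  have -> : 2 * t%:R / sn = 2 * (t%:R / sn) by rewrite mulrA.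
  have -> : 8 * T / n%:R = 2 * (4 * T / n%:R) by ring.
  by apply: ler_wpM2l.
have K0 : 0 <= 64 * E0 * (4 * T) ^+ 2 by rewrite mulr_ge0 ?sqr_ge0 // mulr_ge0.
have ep := @err_poly R T _ n%:R u w T0 K0 n1 u0 erefl.
move: g2; rewrite (_ : 64 * E0 * (4 * T / n%:R) ^+ 2 = 64 * E0 * (4 * T) ^+ 2 / n%:R ^+ 2); last first.
  by rewrite expr_div_n mulrA.
move: (64 * E0 * (4 * T) ^+ 2) K0 @C ep => K K0 C ep g2.
have y0 : 0 <= u / n%:R by rewrite divr_ge0.
have os := @one_sqr_le_expR R eta (u / n%:R) eta0 y0.
have g4 : n%:R * Num.sqrt n%:R * ((1 + 104 * T + 8 * K) * (1 + (u / n%:R) ^+ 2)) <=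
   C * (n%:R * Num.sqrt n%:R) * expR (eta * (u / n%:R)).
  have -> : C * (n%:R * Num.sqrt n%:R) * expR (eta * (u / n%:R)) =
    n%:R * Num.sqrt n%:R * ((1 + 104 * T + 8 * K) * ((1 + 2 / eta ^+ 2) *
      expR (eta * (u / n%:R)))) by rewrite /C; ring.
  apply: ler_wpM2l; first by rewrite mulr_ge0 // sqrtr_ge0.
  by apply: ler_wpM2l => //; rewrite !addr_ge0 ?mulr_ge0 ?sqr_ge0.
have g5 : n%:R ^+ 2 * Err <= n%:R ^+ 2 * (4 * T / n%:R * (12 * (w + 1)) + K / n%:R ^+ 2 * (w + 1) ^+ 3).
  by apply: ler_wpM2l => //; rewrite sqr_ge0.
rewrite mulrDr in g1.
move: g1 g3 ep g4 g5; set a1 := \sum_x _; set a2 := 2 * _ / sn * (_ * u).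
set a3 := 2 * _ / sn * u ^+ 2; set a4 := n%:R ^+ 2 * Err; set a5 := n%:R ^+ 2 * (_ + _).
set a6 := C * _ * _; set a7 := n%:R * _ * _; set a8 := 8 * T / n%:R * u ^+ 2.
lra.
Qed.

Lemma phi_ge1 t tau : (1 < k)%N -> (0 < h)%N -> 1 <= phi t tau.
Proof.
move=> k2 h0; rewrite /phi exprn_ege1 // lerDl divr_ge0 ?sqovl_ge0 //.
exact: sqr_ge0.
Qed.

Lemma phi_le_expR (T eta : R) t tau : (1 < k)%N -> (0 < h)%N -> t%:R <= T * n%:R ->
  phi t tau * expR (eta * (Q tau / n%:R)) <=
  expR ((T / (1 - k%:R^-1) ^+ 2 + eta) / n%:R * Q tau).
Proof.
move=> k2 h0 tT.
have k0 : (0 < k)%N by exact: ltnW.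
have n0 : 0 < n%:R :> R by rewrite ltr0n muln_gt0 k0.
have s4 := sn_ge k2.
have s0 : 0 < sn by apply: lt_le_trans s4; rewrite divr_gt0 // exprn_gt0.
have Q0 := sqovl_ge0 R sigma tau.
have q0 : 0 < 1 - k%:R^-1 :> R by rewrite subr_gt0 invf_lt1 ?ltr1n // ltr0n.
have v1 : -1 <= Q tau / sn by apply: (@le_trans _ _ 0) => //; rewrite divr_ge0 // ltW.
apply: (@le_trans _ _ (expR (t%:R * (Q tau / sn)) * expR (eta * (Q tau / n%:R)))).
  by apply: ler_wpM2r; [exact: expR_ge0|exact: pow_le_expR].
rewrite -expRD ler_expR.
have -> : (T / (1 - k%:R^-1) ^+ 2 + eta) / n%:R * Q tau =
   (T * n%:R) * (Q tau / sn) + eta * (Q tau / n%:R).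
  rewrite /sn exprMn; move: (n%:R : R) (1 - k%:R^-1 : R) n0 q0 => N q n0 q0.
  by field; rewrite !lt0r_neq0.
by rewrite lerD2r ler_wpM2r // divr_ge0 // ltW.
Qed.

(** The feedback coefficient: the gain term of the Stein equation is [(2 t / sn) h^2 Q], which
    equals [n * xt t] times Q. *)
Definition xt (t : nat) : R := 2 * t%:R / (n%:R * (k%:R - 1) ^+ 2).

Lemma stein_moment (T eta C1 : R) t :
  (1 < k)%N -> (0 < h)%N -> 0 <= T -> 0 < eta -> t%:R <= T * n%:R ->
  avg (bal k h V) (fun tau => expR ((T / (1 - k%:R^-1) ^+ 2 + eta) / n%:R * Q tau)) <= C1 ->
  avg (bal k h V) (fun tau => phi t tau * Q tau) * (1 - xt t) <=
  sn / n%:R * avg (bal k h V) (phi t) + steinC T eta * C1 * Num.sqrt n%:R.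
Proof.
move=> k2 h0 T0 eta0 tT hC1.
have k0 : (0 < k)%N by exact: ltnW.
have n0 : 0 < n%:R :> R by rewrite ltr0n muln_gt0 k0.
have s4 := sn_ge k2.
have s0 : 0 < sn by apply: lt_le_trans s4; rewrite divr_gt0 // exprn_gt0.
have id := stein_identity (phi t) k0.
have pw : n%:R * avg (bal k h V) (fun tau => phi t tau * Q tau) <=
  avg (bal k h V) (fun tau => phi t tau * (sn + 2 * t%:R / sn * (h%:R ^+ 2 * Q tau) +
    steinC T eta * (n%:R * Num.sqrt n%:R) * expR (eta * (Q tau / n%:R)))).
  by rewrite id; apply: ler_avg => tau tb; exact: stein_pointwise.
have sC0 : 0 <= steinC T eta.
  rewrite /steinC; apply: mulr_ge0.
    by rewrite !addr_ge0 ?mulr_ge0 ?sqr_ge0 ?expR_ge0.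
  by rewrite addr_ge0 ?divr_ge0 ?sqr_ge0.
have sCn : 0 <= steinC T eta * (n%:R * Num.sqrt n%:R) := mulr_ge0 sC0 (mulr_ge0 (ler0n _ _) (sqrtr_ge0 _)).
have pw2 : n%:R * avg (bal k h V) (fun tau => phi t tau * Q tau) <=
  sn * avg (bal k h V) (phi t) + 2 * t%:R / sn * h%:R ^+ 2 * avg (bal k h V) (fun tau => phi t tau * Q tau)
  + steinC T eta * (n%:R * Num.sqrt n%:R) * C1.
  apply: le_trans pw _.
  rewrite -!avgZ.
  apply: (@le_trans _ _ (avg (bal k h V) (fun x => sn * phi t x + 2 * t%:R / sn * h%:R ^+ 2 * (phi t x * Q x)
     + steinC T eta * (n%:R * Num.sqrt n%:R) * (expR ((T / (1 - k%:R^-1) ^+ 2 + eta) / n%:R * Q x))))).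
    apply: ler_avg => tau _.
    rewrite mulrDr mulrDr; apply: lerD; first by apply: ler_of_eq; ring.
    rewrite mulrCA; apply: ler_wpM2l; first exact: sCn.
    exact: phi_le_expR.
  by rewrite !avgD lerD2l avgZ ler_wpM2l.
have hx : 2 * t%:R / sn * h%:R ^+ 2 = n%:R * xt t.
  have K1 : 1 < k%:R :> R by rewrite ltr1n.
  have H0 : 0 < h%:R :> R by rewrite ltr0n.
  rewrite /sn /xt natrM.
  by field; rewrite !lt0r_neq0 //; lra.
rewrite hx in pw2.
rewrite -(ler_pM2l n0) [X in _ <= X]mulrDr.
have -> : n%:R * (sn / n%:R * avg (bal k h V) (phi t)) = sn * avg (bal k h V) (phi t).
  by rewrite mulrA [n%:R * _]mulrC mulfVK // lt0r_neq0.
move: pw2; set A := avg _ (fun tau => _); set B := sn * _.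
have -> : n%:R * (steinC T eta * C1 * Num.sqrt n%:R) = steinC T eta * (n%:R * Num.sqrt n%:R) * C1 by ring.
set Z := steinC _ _ * _ * _.
have -> : n%:R * (A * (1 - xt t)) = n%:R * A - n%:R * xt t * A by ring.
lra.
Qed.

Lemma avg_phi_ge1 t : (1 < k)%N -> (0 < h)%N -> 1 <= avg (bal k h V) (phi t).
Proof.
move=> k2 h0.
have b0 : (0 < #|bal k h V|)%N by apply/card_gt0P; exists sigma.
rewrite -{1}(avg_cst (1 : R) b0); apply: ler_avg => tau _; exact: phi_ge1.
Qed.

(** Adding one edge multiplies by [1 + Q / sn], and [stein_moment] evaluates the mean of Q under the
    weight [phi t] as about [sn / (n (1 - xt t))]. Iterating from t = 0 to m gives the exponent as a
    sum over edges. *)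
Lemma overlap_moment (T eta C1 : R) (m : nat) :
  (1 < k)%N -> (0 < h)%N -> 0 <= T -> 0 < eta -> m%:R <= T * n%:R -> 0 <= C1 ->
  2 * T / (k%:R - 1) ^+ 2 <= 1 / 2 ->
  avg (bal k h V) (fun tau => expR ((T / (1 - k%:R^-1) ^+ 2 + eta) / n%:R * Q tau)) <= C1 ->
  avg (bal k h V) (phi m) <=
  expR (\sum_(t < m) (n%:R * (1 - xt t))^-1 + 8 * steinC T eta * C1 * T / Num.sqrt n%:R).
Proof.
move=> k2 h0 T0 eta0 mT C10 T2 hC1.
have k0 : (0 < k)%N by exact: ltnW.
have K1 : 1 < k%:R :> R by rewrite ltr1n.
have n0 : 0 < n%:R :> R by rewrite ltr0n muln_gt0 k0.
have s4 := sn_ge k2.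
have s0 : 0 < sn by apply: lt_le_trans s4; rewrite divr_gt0 // exprn_gt0.
have sq0 : 0 < Num.sqrt n%:R :> R by rewrite sqrtr_gt0.
have sqn : Num.sqrt n%:R ^+ 2 = n%:R :> R by rewrite sqr_sqrtr // ltW.
have sC0 : 0 <= steinC T eta.
  rewrite /steinC; apply: mulr_ge0.
    by rewrite !addr_ge0 ?mulr_ge0 ?sqr_ge0 ?expR_ge0.
  by rewrite addr_ge0 ?divr_ge0 ?sqr_ge0.
(* The error per edge is of order n^(-3/2), so over m = O(n) edges it sums to O(n^(-1/2)). *)
pose err := 8 * steinC T eta * C1 / (n%:R * Num.sqrt n%:R).
have err0 : 0 <= err := divr_ge0 (mulr_ge0 (mulr_ge0 (ler0n _ _) sC0) C10) (ltW (mulr_gt0 n0 sq0)).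
have x12 t : t%:R <= T * n%:R -> xt t <= 1 / 2.
  move=> tT; apply: le_trans T2; rewrite /xt.
  have kk : 0 < (k%:R - 1) ^+ 2 :> R by rewrite exprn_gt0 // subr_gt0.
  rewrite invfM mulrA; apply: ler_wpM2r; first by rewrite invr_ge0 ltW.
  by rewrite ler_pdivrMr // -mulrA ler_pM2l.
have rec t : t%:R <= T * n%:R -> avg (bal k h V) (phi t.+1) <=
    avg (bal k h V) (phi t) * expR ((n%:R * (1 - xt t))^-1 + err).
  move=> tT; have x1 := x12 t tT.
  have hst := stein_moment k2 h0 T0 eta0 tT hC1.
  have -> : avg (bal k h V) (phi t.+1) =
     avg (bal k h V) (phi t) + avg (bal k h V) (fun tau => phi t tau * Q tau) / sn.
    rewrite -avgZr -avgD; apply: eq_avg => tau _.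
    by rewrite {1}/phi exprSr -/(phi t tau); ring.
  set A := avg _ (fun tau => _) in hst *; set B := avg _ (phi t) in hst *.
  have B1 : 1 <= B by exact: avg_phi_ge1.
  have x0 : 0 < 1 - xt t by lra.
  have hA : A <= (sn / n%:R * B + steinC T eta * C1 * Num.sqrt n%:R) / (1 - xt t).
    by rewrite ler_pdivlMr.
  have hA2 : A / sn <= B * ((n%:R * (1 - xt t))^-1 + err).
    rewrite ler_pdivrMr //; apply: le_trans hA _.
    have -> : (sn / n%:R * B + steinC T eta * C1 * Num.sqrt n%:R) / (1 - xt t) =
      B * (n%:R * (1 - xt t))^-1 * sn + steinC T eta * C1 * Num.sqrt n%:R / (1 - xt t).
      move: (n%:R : R) (Num.sqrt _) (1 - xt t) n0 x0 => N z y n0 x0.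
      by field; rewrite !lt0r_neq0.
    have -> : B * ((n%:R * (1 - xt t))^-1 + err) * sn = B * (n%:R * (1 - xt t))^-1 * sn + B * (err * sn) by ring.
    rewrite lerD2l.
    have e1 : steinC T eta * C1 * Num.sqrt n%:R / (1 - xt t) <= steinC T eta * C1 * Num.sqrt n%:R * 2.
      apply: ler_wpM2l; first exact: mulr_ge0 (mulr_ge0 sC0 C10) (ltW sq0).
      by rewrite -[2]invrK lef_pV2 ?posrE //; lra.
    have e2 : steinC T eta * C1 * Num.sqrt n%:R * 2 <= err * sn.
      have : err * (n%:R ^+ 2 / 4) <= err * sn by apply: ler_wpM2l.
      apply: le_trans; rewrite /err.
      apply: ler_of_eq.
      move: (Num.sqrt _) sq0 sqn => z sq0 sqn.
      by rewrite -sqn; field; rewrite lt0r_neq0.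
    apply: le_trans e1 _; apply: le_trans e2 _.
    by rewrite ler_peMl //; exact: mulr_ge0 err0 (ltW s0).
  apply: (@le_trans _ _ (B * (1 + ((n%:R * (1 - xt t))^-1 + err)))).
    by rewrite mulrDr mulr1 lerD2l.
  by apply: ler_wpM2l; [lra|exact: expR_ge1Dx].
have main t : (t <= m)%N -> avg (bal k h V) (phi t) <=
   expR (\sum_(i < t) (n%:R * (1 - xt i))^-1 + t%:R * err).
  elim: t => [|t IH] tm.
    rewrite big_ord0 mul0r addr0 expR0.
    have b0 : (0 < #|bal k h V|)%N by apply/card_gt0P; exists sigma.
    by rewrite /phi; under eq_avg do rewrite expr0; rewrite avg_cst.
  have tT : t%:R <= T * n%:R by apply: le_trans mT; rewrite ler_nat ltnW.
  apply: le_trans (rec t tT) _.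
  rewrite big_ord_recr /= -natr1.
  have -> : \sum_(i < t) (n%:R * (1 - xt i))^-1 + (n%:R * (1 - xt t))^-1 + (t%:R + 1) * err =
    (\sum_(i < t) (n%:R * (1 - xt i))^-1 + t%:R * err) + ((n%:R * (1 - xt t))^-1 + err) by ring.
  by rewrite [in X in _ <= X]expRD; apply: ler_wpM2r; [exact: expR_ge0|exact: IH (ltnW tm)].
apply: le_trans (main m (leqnn m)) _; rewrite ler_expR lerD2l.
apply: (@le_trans _ _ (T * n%:R * err)); first exact: ler_wpM2r.
apply: ler_of_eq; rewrite /err.
move: (n%:R : R) n0 sq0 => N n0 sq0; by field; rewrite !lt0r_neq0.
Qed.

End Stein.

(** * Product measures *)

Lemma sumr_cst (R : realType) (I : finType) (P : pred I) (a : R) :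
  \sum_(i | P i) a = #|P|%:R * a.
Proof. by rewrite sumr_const mulr_natl. Qed.

Section ProductMeasure.
Variables (R : realType) (E : finType) (m : nat).
Local Notation Om := {ffun 'I_m -> E}.
Implicit Types (w : E -> R) (F G : Om -> R) (U : {set 'I_m}).

Definition pw w F : R := \sum_(om : Om) F om * \prod_i w (om i).

Definition depends (T : Type) U (F : Om -> T) :=
  forall om om' : Om, (forall i, i \in U -> om i = om' i) -> F om = F om'.

Lemma pw_cst w a : \sum_e w e = 1 -> pw w (fun=> a) = a.
Proof.
move=> w1; rewrite /pw -mulr_sumr -(bigA_distr_bigA (fun _ e => w e)) /=.
by rewrite big1 ?mulr1 // => i _; rewrite w1.
Qed.

Lemma eq_pw w F G : F =1 G -> pw w F = pw w G.
Proof. by move=> FG; apply: eq_bigr => om _; rewrite FG. Qed.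

Lemma pwD w F G : pw w (fun om => F om + G om) = pw w F + pw w G.
Proof. by rewrite /pw -big_split; apply: eq_bigr => om _; rewrite mulrDl. Qed.

Lemma pwB w F G : pw w (fun om => F om - G om) = pw w F - pw w G.
Proof. by rewrite /pw -sumrB; apply: eq_bigr => om _; rewrite mulrBl. Qed.

Lemma pwZ w a F : pw w (fun om => a * F om) = a * pw w F.
Proof. by rewrite /pw mulr_sumr; apply: eq_bigr => om _; rewrite mulrA. Qed.

Lemma pw_sum w (I : finType) (P : pred I) (F : I -> Om -> R) :
  pw w (fun om => \sum_(i | P i) F i om) = \sum_(i | P i) pw w (F i).
Proof.
by rewrite /pw exchange_big /=; apply: eq_bigr => om _; rewrite mulr_suml.
Qed.

Section Positive.
Variable w : E -> R.
Hypothesis w0 : forall e, 0 <= w e.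

Lemma ler_pw F G : (forall om, F om <= G om) -> pw w F <= pw w G.
Proof.
by move=> FG; apply: ler_sum => om _; rewrite ler_wpM2r // prodr_ge0.
Qed.

Lemma pw_ge0 F : (forall om, 0 <= F om) -> 0 <= pw w F.
Proof. by move=> F0; apply: sumr_ge0 => om _; rewrite mulr_ge0 // prodr_ge0. Qed.

Lemma norm_pw_le F G : (forall om, `|F om| <= G om) -> `|pw w F| <= pw w G.
Proof.
move=> FG; apply: le_trans (ler_norm_sum _ _ _) _; apply: ler_sum => om _.
have W0 : 0 <= \prod_i w (om i) by exact: prodr_ge0.
by rewrite normrM (ger0_norm W0) ler_wpM2r.
Qed.

Lemma pw_cylinder U (P : 'I_m -> pred E) : \sum_e w e = 1 ->
  pw w (fun om => ([forall i in U, P i (om i)])%:R) = \prod_(i in U) \sum_(e | P i e) w e.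
Proof.
move=> w1.
transitivity (\prod_i \sum_e ((i \in U) ==> P i e)%:R * w e).
  rewrite (bigA_distr_bigA (fun i e => ((i \in U) ==> P i e)%:R * w e)) /=.
  apply: eq_bigr => om _; rewrite big_split /=; congr (_ * _).
  case: forall_inP => [H|H].
    by rewrite big1 // => i _; case: (boolP (i \in U)) => //= iU; rewrite H.
  have /existsP[i] : [exists i, ~~ ((i \in U) ==> P i (om i))].
    rewrite -negb_forall; apply/negP => /forallP H'; apply: H => i iU.
    by have := H' i; rewrite iU.
  by move=> /negbTE iP; rewrite (bigD1 i) //= iP mul0r.
rewrite [RHS]big_mkcond /=; apply: eq_bigr => i _; case: (i \in U) => /=.
  by rewrite [RHS]big_mkcond; apply: eq_bigr => e _; case: (P i e); rewrite ?mul1r ?mul0r.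
by under eq_bigr do rewrite mul1r.
Qed.

Definition merge U (om om' : Om) : Om := [ffun i => if i \in U then om i else om' i].

(** Exchanging the coordinates in U between two independent samples is a weight-preserving
    involution that turns [F * G] on one sample into F on one and G on the other. *)
Lemma pw_indep U F G : \sum_e w e = 1 -> depends U F -> depends (~: U) G ->
  pw w (fun om => F om * G om) = pw w F * pw w G.
Proof.
move=> w1 dF dG.
pose W (om : Om) := \prod_i w (om i).
have -> : pw w F * pw w G = \sum_om \sum_om' (F om * G om') * (W om * W om').
  rewrite /pw mulr_suml; apply: eq_bigr => om _; rewrite mulr_sumr.
  by apply: eq_bigr => om' _; rewrite -/(W om) -/(W om'); ring.
rewrite pair_bigA /=.
pose sw (p : Om * Om) := (merge U p.1 p.2, merge U p.2 p.1).
have swK : involutive sw.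
  by move=> [a b]; congr (_, _); apply/ffunP => i; rewrite !ffunE; case: (i \in U).
have W1 : \sum_om' W om' = 1.
  by have := pw_cst 1 w1; rewrite /pw -mulr_sumr mul1r.
have -> : pw w (fun om => F om * G om) = \sum_om \sum_om' (F om * G om) * (W om * W om').
  apply: eq_bigr => om _; rewrite -mulr_sumr -mulr_sumr.
  by rewrite W1 mulr1.
rewrite pair_bigA /= [LHS](reindex_inj (inv_inj swK)) /=.
apply: eq_bigr => -[a b] _ /=; congr (_ * _ * _).
- by apply: dF => i iU; rewrite ffunE iU.
- by apply: dG => i; rewrite inE ffunE => /negbTE ->.
rewrite -!big_split /=; apply: eq_bigr => i _; rewrite !ffunE.
by case: (i \in U) => //; rewrite mulrC.
Qed.

End Positive.
End ProductMeasure.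

(** * Stein-Chen recursion for counts of local events *)

Section SteinChen.
Variables (R : realType) (E : finType) (m : nat) (w : E -> R).
Hypothesis w0 : forall e, 0 <= w e.
Hypothesis w1 : \sum_e w e = 1.
Local Notation Om := {ffun 'I_m -> E}.
Variables (I A : finType) (ty : I -> A) (ev : I -> Om -> bool) (sp : I -> {set 'I_m}).
Hypothesis ev_dep : forall i, depends (sp i) (ev i).

Definition nev (a : A) (om : Om) : nat := \sum_(i | ty i == a) ev i om.
Definition nev_at (c : {ffun A -> nat}) (om : Om) : bool := [forall a, nev a om == c a].
Definition pat (c : {ffun A -> nat}) : R := pw w (fun om => (nev_at c om)%:R).
Definition pev (i : I) : R := pw w (fun om => (ev i om)%:R).
Definition lam (a : A) : R := \sum_(i | ty i == a) pev i.
Definition touches (i j : I) : bool := ~~ [disjoint sp i & sp j].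
(** With [dep2], the two classical Stein-Chen error terms: products of probabilities and joint
    probabilities over pairs of events that share a coordinate. *)
Definition dep1 : R := \sum_i \sum_(j | touches i j) pev i * pev j.
Definition dep2 : R :=
  \sum_i \sum_(j | (j != i) && touches i j) pw w (fun om => (ev i om && ev j om)%:R).
Definition decr (c : {ffun A -> nat}) (a : A) : {ffun A -> nat} :=
  [ffun b => (c b - (b == a))%N].

Let nev' (i : I) (a : A) (om : Om) : nat := \sum_(j | (ty j == a) && ~~ touches i j) ev j om.
Let nev_at' (i : I) (c : {ffun A -> nat}) (om : Om) : bool := [forall a, nev' i a om == c a].

Lemma nev_split i a om : nev a om = (nev' i a om + \sum_(j | (ty j == a) && touches i j) ev j om)%N.
Proof. by rewrite /nev (bigID (touches i)) /= addnC. Qed.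

Lemma nev_at'_dep i c : depends (~: sp i) (nev_at' i c).
Proof.
move=> om om' H; apply: eq_forallb => a; congr (_ == _).
apply: eq_bigr => j /andP[_ ij]; congr nat_of_bool; apply: ev_dep => x xj.
apply: H; rewrite inE; apply/negP => xi; case/negP: ij.
by apply/pred0Pn; exists x; rewrite /= xi xj.
Qed.

Lemma pev_ge0 i : 0 <= pev i. Proof. by apply: pw_ge0 => // om; rewrite ler0n. Qed.

Lemma bool_diff_le (b1 b2 : bool) (x : nat) : (b1 != b2 -> 0 < x)%N ->
  `|b1%:R - b2%:R : R| <= x%:R.
Proof.
case: b1; case: b2 => /= H; rewrite ?subrr ?normr0 ?ler0n //.
  by rewrite subr0 normr1 ler1n H.
by rewrite sub0r normrN normr1 ler1n H.
Qed.

(** Without the error this recursion characterises a product of Poisson laws. On [ev i], ignoring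
    the other events that touch i is wrong only if one of them occurs ([dep2]); the remaining counts
    are independent of [ev i]; restoring the ignored events costs [dep1]. *)
Lemma stein_chen (c : {ffun A -> nat}) a : (0 < c a)%N ->
  (forall i, sp i != set0) ->
  `|(c a)%:R * pat c - lam a * pat (decr c a)| <= dep1 + dep2.
Proof.
move=> ca spn.
have mself i : touches i i by rewrite /touches -setI_eq0 setIid.
have -> : (c a)%:R * pat c = \sum_(i | ty i == a) pw w (fun om => (ev i om && nev_at c om)%:R).
  rewrite -pwZ -pw_sum; apply: eq_pw => om.
  have [/forallP/(_ a)/eqP <-|_] := boolP (nev_at c om).
    by rewrite mulr1 /nev natr_sum; apply: eq_bigr => i _; rewrite andbT.
  by rewrite mulr0 big1 // => i _; rewrite andbF.
rewrite /lam mulr_suml -sumrB.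
apply: (@le_trans _ _ (\sum_(i | ty i == a)
   (\sum_(j | touches i j) pev i * pev j +
    \sum_(j | (j != i) && touches i j) pw w (fun om => (ev i om && ev j om)%:R)))); last first.
  rewrite /dep1 /dep2 -big_split /= [X in _ <= X](bigID (fun i => ty i == a)) /= lerDl.
  apply: sumr_ge0 => i _; apply: addr_ge0; apply: sumr_ge0 => j _.
    by rewrite mulr_ge0 ?pev_ge0.
  by apply: pw_ge0 => // om; rewrite ler0n.
apply: le_trans (ler_norm_sum _ _ _) _; apply: ler_sum => i /eqP tyi.
set c' := decr c a.
have e1 : `|pw w (fun om => (ev i om && nev_at c om)%:R) - pw w (fun om => (ev i om)%:R * (nev_at' i c' om)%:R)|
   <= \sum_(j | (j != i) && touches i j) pw w (fun om => (ev i om && ev j om)%:R).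
  rewrite -pwB -pw_sum; apply: norm_pw_le => // om.
  rewrite -natrM -natr_sum mulnb; apply: bool_diff_le.
  case: (boolP (ev i om)) => //= evi.
  rewrite lt0n; apply: contraNneq => sum0.
  have z j : (j != i) && touches i j -> ev j om = false.
    move=> jP; apply/eqP; rewrite -[_ == _]negbK eqbF_neg negbK; apply/negP => evj.
    by move: sum0; rewrite (bigD1 j) //= evj.
  apply/eqP/eq_forallb => b; rewrite (nev_split i) ffunE.
  have -> : (\sum_(j | (ty j == b) && touches i j) ev j om = (b == a))%N.
    have [ba|ba] := eqVneq b a.
      rewrite ba (bigD1 i) /= ?tyi ?eqxx ?mself // evi big1 // => j /andP[/andP[_ mij] ji].
      by rewrite z // ji mij.
    rewrite big1 // => j /andP[/eqP tj mij]; rewrite z // mij andbT.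
    by apply: contra_neq ba => ji; rewrite -tj ji tyi.
  have [->|ba] := eqVneq b a; last by rewrite addn0 subn0.
  by rewrite addn1 subn1 -{1}(prednK ca) eqSS.
have e2 : pw w (fun om => (ev i om)%:R * (nev_at' i c' om)%:R) =
   pev i * pw w (fun om => (nev_at' i c' om)%:R).
  apply: (pw_indep w1 (U := sp i)).
    by move=> om om' H; rewrite (ev_dep H).
  by move=> om om' H; rewrite (@nev_at'_dep i c' _ _ H).
have e3 : `|pw w (fun om => (nev_at' i c' om)%:R) - pat c'| <= \sum_(j | touches i j) pev j.
  rewrite /pat -pwB -pw_sum; apply: norm_pw_le => // om.
  rewrite -natr_sum; apply: bool_diff_le.
  rewrite lt0n; apply: contraNneq => sum0.
  have z j : touches i j -> ev j om = false.
    move=> jP; apply/eqP; rewrite -[_ == _]negbK eqbF_neg negbK; apply/negP => evj.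
    by move: sum0; rewrite (bigD1 j) //= evj.
  apply/eqP/eq_forallb => b; rewrite (nev_split i) [X in (_ + X)%N]big1 ?addn0 //.
  by move=> j /andP[_ mij]; rewrite z.
rewrite [X in _ <= X]addrC.
apply: le_trans (ler_distD (pw w (fun om => (ev i om)%:R * (nev_at' i c' om)%:R)) _ _) _.
apply: lerD => //; rewrite e2 -mulrBr normrM (ger0_norm (pev_ge0 i)) -mulr_sumr.
by apply: ler_wpM2l => //; exact: pev_ge0.
Qed.

Lemma pw_nev a : pw w (fun om => (nev a om)%:R) = lam a.
Proof. by rewrite /lam -pw_sum; apply: eq_pw => om; rewrite natr_sum. Qed.

End SteinChen.

(** * Cycles in a random sequence of edges *)

Section Cycles.
Variables (V : finType) (m : nat).
Local Notation Om := {ffun 'I_m -> V * V}.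

Definition ends (e : V * V) : {set V} := [set e.1; e.2]%SET.
Definition verts (U : {set 'I_m}) (om : Om) : {set V} := \bigcup_(i in U) ends (om i).

(** Lengths are [a.+2], so a repeated edge counts as a cycle of length 2. Freezing the orientation
    of edge 0 fixes the direction in which the cycle is traversed. *)
Definition cyc_at a (al : {ffun 'I_a.+2 -> 'I_m}) (v : {ffun 'I_a.+2 -> V}) (om : Om) : bool :=
  [forall j, (om (al j) == (v j, v (ordS j))) ||
             ((j != ord0) && (om (al j) == (v (ordS j), v j)))].

(* An index tuple is a cycle if the chosen edges close up along distinct
   vertices. Rooting the tuple at its largest index, whose edge is traversed in
   its own direction, makes it count every cycle exactly once. *)
Definition cyc a (al : {ffun 'I_a.+2 -> 'I_m}) (om : Om) : bool :=
  [&& injectiveb al, [forall j, (al j <= al ord0)%N] &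
      [exists v : {ffun 'I_a.+2 -> V}, injectiveb v && cyc_at al v om]].

Definition csupp a (al : {ffun 'I_a.+2 -> 'I_m}) : {set 'I_m} := al @: [set: 'I_a.+2]%SET.

Lemma csupp_card a (al : {ffun 'I_a.+2 -> 'I_m}) : injective al -> #|csupp al| = a.+2.
Proof. by move=> ial; rewrite card_imset // cardsT card_ord. Qed.

Lemma mem_csupp a (al : {ffun 'I_a.+2 -> 'I_m}) j : al j \in csupp al.
Proof. by apply: imset_f; rewrite inE. Qed.

Lemma csuppP a (al : {ffun 'I_a.+2 -> 'I_m}) x :
  reflect (exists j, x = al j) (x \in csupp al).
Proof.
apply: (iffP imsetP) => [[j _ ->]|[j ->]]; exists j => //; by rewrite inE.
Qed.

Lemma cyc_at_ends a (al : {ffun 'I_a.+2 -> 'I_m}) v om j : cyc_at al v om ->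
  ends (om (al j)) = [set v j; v (ordS j)]%SET.
Proof.
move=> /forallP/(_ j)/orP[/eqP ->|/andP[_ /eqP ->]] //.
by rewrite /ends /= setUC.
Qed.

Lemma cyc_dep a (al : {ffun 'I_a.+2 -> 'I_m}) : depends (csupp al) (cyc al).
Proof.
move=> om om' H; rewrite /cyc; congr [&& _, _ & _].
apply: eq_existsb => v; congr (_ && _); apply: eq_forallb => j.
by rewrite H // mem_csupp.
Qed.

Lemma iter_ordS_val n (j : 'I_n.+1) t : val (iter t (@ordS n.+1) j) = ((j + t) %% n.+1)%N.
Proof.
elim: t => [|t IH]; first by rewrite addn0 modn_small.
by rewrite iterS /= IH -addn1 modnDml addn1 addnS.
Qed.

Lemma ordS_closed n (P : pred 'I_n.+1) j0 :
  (forall j, P j -> P (ordS j)) -> P j0 -> forall j, P j.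
Proof.
move=> H P0 j.
have -> : j = iter (n.+1 - j0 + j)%N (@ordS n.+1) j0.
  apply: val_inj; rewrite iter_ordS_val addnA subnKC; last exact/ltnW/ltn_ord.
  by rewrite modnDl modn_small.
by elim: (_ + _)%N => // t IH; rewrite iterS; exact: H.
Qed.

Lemma verts_cyc a (al : {ffun 'I_a.+2 -> 'I_m}) v om : cyc_at al v om ->
  verts (csupp al) om = v @: [set: 'I_a.+2]%SET.
Proof.
move=> H; apply/setP => x; apply/bigcupP/imsetP => [[i /csuppP[j ->]]|[j _ ->]].
  by rewrite (cyc_at_ends j H) !inE => /orP[] /eqP ->; [exists j|exists (ordS j)]; rewrite ?inE.
by exists (al j); rewrite ?mem_csupp // (cyc_at_ends j H) !inE eqxx.
Qed.

Lemma vertsU U U' om : verts (U :|: U') om = verts U om :|: verts U' om.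
Proof. by rewrite /verts bigcup_setU. Qed.

(** Two cycles that meet without nesting have more edges than vertices: each new vertex of the
    second cycle is charged to the edge starting there, which is new. The first new edge after a
    common stretch starts at an old vertex and is charged by none. *)
Lemma cyc_overlap_aux a b (al : {ffun 'I_a.+2 -> 'I_m}) (be : {ffun 'I_b.+2 -> 'I_m})
    (v : {ffun 'I_a.+2 -> V}) (u : {ffun 'I_b.+2 -> V}) (om : Om) :
  injective al -> injective be -> injective v -> injective u ->
  cyc_at al v om -> cyc_at be u om ->
  ~~ [disjoint csupp al & csupp be] -> ~~ (csupp be \subset csupp al) ->
  (#|verts (csupp al :|: csupp be) om| < #|csupp al :|: csupp be|)%N.
Proof.
move=> ial ibe iv iu cal cbe meet nsub.
set Sa := csupp al; set Sb := csupp be.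
pose Va := verts Sa om.
have cVa : #|Va| = #|Sa| by rewrite /Va /Sa (verts_cyc cal) !card_imset // cardsT.
pose N := [set j | u j \notin Va]%SET.
have edgeV j : be j \in Sa -> (u j \in Va) && (u (ordS j) \in Va).
  move=> bS; have sub : ends (om (be j)) \subset Va.
    by rewrite /Va /verts; apply: (finset.bigcup_sup (be j)).
  by move: sub; rewrite (cyc_at_ends j cbe) => /subsetP s; rewrite !s // !inE eqxx ?orbT.
have [j [bj bSj]] : exists j, be j \in Sa /\ be (ordS j) \notin Sa.
  apply/not_existsP => H.
  have [x] := pred0Pn meet; rewrite /= => /andP[xa /csuppP[j0 xj0]].
  case/negP: nsub; apply/subsetP => y /csuppP[j ->].
  apply: (@ordS_closed _ (fun j => be j \in Sa) j0) => [i iS|]; last by rewrite -xj0.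
  by apply/negPn/negP => niS; apply: (H i).
have Nsub : be @: N \subset (Sb :\: Sa) :\ be (ordS j).
  apply/subsetP => y /imsetP[i]; rewrite inE => iN ->; rewrite !inE mem_csupp andbT.
  apply/andP; split.
    apply: contraNneq iN => /ibe ->; by have /andP[] := edgeV _ bj.
  by apply: contraNN iN => /edgeV /andP[].
have cN : (#|N| < #|Sb :\: Sa|)%N.
  rewrite -(card_imset N ibe); apply: leq_ltn_trans (subset_leq_card Nsub) _.
  by rewrite [X in (_ < X)%N](cardsD1 (be (ordS j))) !inE bSj mem_csupp.
have -> : verts (Sa :|: Sb) om = Va :|: (u @: N).
  rewrite vertsU -/Va; apply/setP => x; rewrite !inE /Sb (verts_cyc cbe).
  case xV: (x \in Va) => //=.
  apply/imsetP/imsetP => [[i _ xi]|[i _ xi]]; exists i; rewrite ?inE //.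
  by rewrite -xi xV.
apply: leq_ltn_trans (leq_card_setU _ _) _.
rewrite (card_imset N iu) cVa.
have -> : #|Sa :|: Sb| = (#|Sa| + #|Sb :\: Sa|)%N.
  rewrite -(cardsID Sa (Sa :|: Sb)); congr (_ + _)%N; apply: eq_card => x;
    by rewrite !inE; case: (x \in Sa); rewrite ?andbT ?andbF.
by rewrite ltn_add2l.
Qed.

(** The root is the largest index, and its oriented edge gives the first two vertices. From there
    each next edge is the one in the support that continues from the current vertex, so the two
    descriptions agree step by step. *)
Lemma cyc_same_supp a (al be : {ffun 'I_a.+2 -> 'I_m}) (v u : {ffun 'I_a.+2 -> V}) (om : Om) :
  injective al -> injective be -> injective v -> injective u ->
  (forall j, (al j <= al ord0)%N) -> (forall j, (be j <= be ord0)%N) ->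
  cyc_at al v om -> cyc_at be u om -> csupp al = csupp be -> al = be /\ v = u.
Proof.
move=> ial ibe iv iu mal mbe cal cbe S.
have r0 : al ord0 = be ord0.
  apply/val_inj/eqP; rewrite eqn_leq; apply/andP; split.
    by have /csuppP[j ->] : al ord0 \in csupp be; [rewrite -S mem_csupp|exact: mbe].
  by have /csuppP[i ->] : be ord0 \in csupp al; [rewrite S mem_csupp|exact: mal].
have [v0 v1] : v ord0 = u ord0 /\ v (ordS ord0) = u (ordS ord0).
  have /forallP/(_ ord0) := cal; have /forallP/(_ ord0) := cbe.
  by rewrite eqxx !orbF r0 => /eqP -> /eqP[-> ->].
have main t (ht : (t < a.+2)%N) : [/\ al (Ordinal ht) = be (Ordinal ht),
    v (Ordinal ht) = u (Ordinal ht) & v (ordS (Ordinal ht)) = u (ordS (Ordinal ht))].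
  elim: t ht => [|t IH] ht.
    by have -> : Ordinal ht = ord0 by apply: val_inj.
  have ht' : (t < a.+2)%N := ltnW ht.
  have [IH1 IH2 IH3] := IH ht'.
  have sj : ordS (Ordinal ht') = Ordinal ht by apply: val_inj; rewrite /= modn_small.
  rewrite sj in IH3; set j := Ordinal ht in sj IH3 *; set i := Ordinal ht' in IH1 IH2 sj.
  have ij : i != j by rewrite -val_eqE /= neq_ltn ltnSn.
  have bj : al j = be j.
    have /csuppP[x bx] : be j \in csupp al by rewrite S mem_csupp.
    have : u j \in ends (om (be j)) by rewrite (cyc_at_ends j cbe) !inE eqxx.
    rewrite bx (cyc_at_ends x cal) !inE -IH3 => /orP[/eqP/iv ->//|/eqP/iv].
    rewrite -sj => /(@ordS_inj _) ix.
    by move: ij; rewrite -(inj_eq ibe) bx -IH1 -ix eqxx.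
  split => //.
  have := cyc_at_ends j cal; rewrite bj (cyc_at_ends j cbe) IH3 => /setP/(_ (v (ordS j))).
  rewrite !inE eqxx orbT => /orP[/eqP|/eqP //].
  rewrite -IH3 => /iv /(congr1 val) /= e; exfalso; move: e.
  case: (ltnP t.+2 a.+2) => h; first by rewrite modn_small // => /eqP; rewrite eqn_leq ltnn.
  have -> : t.+2 = a.+2 by apply/eqP; rewrite eqn_leq h andbT.
  by rewrite modnn.
by split; apply/ffunP => -[t ht]; have [] := main t ht.
Qed.

Lemma cyc_overlap a b (al : {ffun 'I_a.+2 -> 'I_m}) (be : {ffun 'I_b.+2 -> 'I_m}) om :
  cyc al om -> cyc be om -> ~~ [disjoint csupp al & csupp be] ->
  Tagged (fun a => {ffun 'I_a.+2 -> 'I_m}) al != Tagged (fun a => {ffun 'I_a.+2 -> 'I_m}) be ->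
  (#|verts (csupp al :|: csupp be) om| < #|csupp al :|: csupp be|)%N.
Proof.
move=> /and3P[/injectiveP ial /forallP mal /existsP[v /andP[/injectiveP iv cal]]].
move=> /and3P[/injectiveP ibe /forallP mbe /existsP[u /andP[/injectiveP iu cbe]]] meet ne.
have [sub|nsub] := boolP (csupp be \subset csupp al); last first.
  exact: (cyc_overlap_aux ial ibe iv iu cal cbe meet nsub).
have [sub'|nsub] := boolP (csupp al \subset csupp be); last first.
  rewrite setUC; apply: (cyc_overlap_aux ibe ial iu iv cbe cal) nsub.
  by rewrite disjoint_sym.
have S : csupp al = csupp be by apply/eqP; rewrite eqEsubset sub sub'.
have ab : a = b.
  by have := csupp_card ial; rewrite S csupp_card // => -[].
subst b; case/negP: ne; apply/eqP; congr (Tagged _ _).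
by have [] := cyc_same_supp ial ibe iv iu mal mbe cal cbe S.
Qed.

End Cycles.

(** * Rarity of overlapping cycles *)

Section CycleBounds.
Variables (R : realType) (V : finType) (m : nat) (w : V * V -> R) (W T : R) (La : nat).
Hypothesis w0 : forall e, 0 <= w e.
Hypothesis w1 : \sum_e w e = 1.
Local Notation n := (#|V|%:R : R).
Hypothesis n0 : (0 < #|V|)%N.
Hypothesis wW : forall e, w e <= W / n ^+ 2.
Hypothesis W1 : 1 <= W.
Hypothesis mT : m%:R <= T * n.
Local Notation Om := {ffun 'I_m -> V * V}.

Let N0 : 0 < n. Proof. by rewrite ltr0n. Qed.

Lemma T_ge0 : 0 <= T.
Proof. by rewrite -(pmulr_lge0 _ N0) (le_trans _ mT). Qed.

(** A union bound over the v-tuples that may contain all endpoints: given the tuple, each edge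
    indexed by U has at most v^2 values, each of mass at most [W / n ^+ 2]. *)
Lemma few_vertices (P : pred Om) (U : {set 'I_m}) (v : nat) :
  (0 < v)%N -> (forall om, P om -> #|verts U om| <= v)%N ->
  pw w (fun om => (P om)%:R) <= n ^+ v * (v%:R ^+ 2 * (W / n ^+ 2)) ^+ #|U|.
Proof.
move=> v0 PU.
have [x0 _] : exists x0 : V, true by have /card_gt0P[x _] := n0; exists x.
pose Q (g : {ffun 'I_v -> V}) (e : V * V) := (e.1 \in codom g) && (e.2 \in codom g).
apply: (@le_trans _ _ (\sum_(g : {ffun 'I_v -> V}) pw w (fun om => ([forall i in U, Q g (om i)])%:R))).
  rewrite -pw_sum; apply: ler_pw => // om; case Pom: (P om); last first.
    by rewrite sumr_ge0 // => g _; rewrite ler0n.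
  pose g := [ffun j : 'I_v => nth x0 (enum (verts U om)) j].
  rewrite (bigD1 g) //= (_ : [forall i in U, Q g (om i)]); last first.
    have gc x : x \in verts U om -> x \in codom g.
      move=> xv; have xi : (index x (enum (verts U om)) < v)%N.
        by apply: leq_trans (PU _ Pom); rewrite cardE index_mem mem_enum.
      apply/codomP; exists (Ordinal xi); rewrite ffunE nth_index //.
      by rewrite mem_enum.
    apply/forall_inP => i iU; have sub : ends (om i) \subset verts U om by exact: (finset.bigcup_sup i).
    by rewrite /Q !gc // (subsetP sub) // !inE eqxx ?orbT.
  by rewrite lerDl sumr_ge0 // => ? _; rewrite ler0n.
apply: (@le_trans _ _ (\sum_(g : {ffun 'I_v -> V}) (v%:R ^+ 2 * (W / n ^+ 2)) ^+ #|U|)); last first.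
  by rewrite sumr_cst card_ffun card_ord natrX.
apply: ler_sum => g _; rewrite (@pw_cylinder _ _ m w U (fun=> Q g) w1) -prodr_const; apply: ler_prod => i _.
rewrite sumr_ge0 //=.
have W0 : 0 <= W / n ^+ 2 by rewrite divr_ge0 ?sqr_ge0 // (le_trans ler01).
apply: (@le_trans _ _ (\sum_(e | Q g e) W / n ^+ 2)); first by apply: ler_sum.
rewrite sumr_cst ler_wpM2r // -natrX ler_nat.
have -> : #|[pred e | Q g e]| = (#|codom g| * #|codom g|)%N by rewrite -cardX; apply: eq_card => -[x y].
have cg : (#|codom g| <= v)%N by rewrite (leq_trans (card_size _)) // size_codom card_ord.
by rewrite expnS expn1 leq_mul.
Qed.

Definition rep := {a : 'I_La & {ffun 'I_a.+2 -> 'I_m}}.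
Definition rty (r : rep) : 'I_La := tag r.
Definition rcyc (r : rep) (om : Om) : bool := cyc (tagged r) om.
Definition rsp (r : rep) : {set 'I_m} := csupp (tagged r).

Lemma rsp_neq0 r : rsp r != set0.
Proof. by apply/set0Pn; exists (tagged r ord0); exact: mem_csupp. Qed.

Lemma rcyc_dep r : depends (rsp r) (rcyc r). Proof. exact: cyc_dep. Qed.

Definition Kc : R := ((2 * La.+2)%:R ^+ 2 * W) ^+ (2 * La.+2).

Lemma Kc_ge1 : 1 <= (2 * La.+2)%:R ^+ 2 * W.
Proof.
have h : 1 <= (2 * La.+2)%:R ^+ 2 :> R by rewrite exprn_ege1 // ler1n.
by apply: le_trans h _; rewrite ler_peMr // exprn_ge0.
Qed.

Lemma Kc_bound (v u : nat) : (v <= 2 * La.+2)%N -> (u <= 2 * La.+2)%N ->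
  (v%:R ^+ 2 * W) ^+ u <= Kc.
Proof.
move=> vL uL; have W0 : 0 <= W := le_trans ler01 W1.
apply: (@le_trans _ _ (((2 * La.+2)%:R ^+ 2 * W) ^+ u)).
  apply: lerXn2r; rewrite ?nnegrE ?mulr_ge0 ?exprn_ge0 //.
  by apply: ler_wpM2r => //; apply: lerXn2r; rewrite ?nnegrE // ler_nat.
by rewrite ler_weXn2l // Kc_ge1.
Qed.

Lemma few_vertices_n (P : pred Om) (U : {set 'I_m}) (v : nat) :
  (0 < v)%N -> (v <= 2 * La.+2)%N -> (#|U| <= 2 * La.+2)%N -> (v <= #|U|)%N ->
  (forall om, P om -> #|verts U om| <= v)%N ->
  pw w (fun om => (P om)%:R) <= Kc / n ^+ (2 * #|U| - v).
Proof.
move=> v0 vL uL vU PU; apply: le_trans (few_vertices v0 PU) _.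
have -> : n ^+ v * (v%:R ^+ 2 * (W / n ^+ 2)) ^+ #|U| = (v%:R ^+ 2 * W) ^+ #|U| / n ^+ (2 * #|U| - v).
  have -> : (v%:R ^+ 2 * (W / n ^+ 2)) ^+ #|U| = (v%:R ^+ 2 * W) ^+ #|U| / n ^+ (2 * #|U|).
    by rewrite mulrA expr_div_n exprM.
  have [d ->] : exists d, (2 * #|U| = d + v)%N.
    by exists (2 * #|U| - v)%N; rewrite subnK // (leq_trans vU) // leq_pmull.
  rewrite addnK exprD; move: N0; set N : R := #|V|%:R => N00.
  by field; rewrite !expf_neq0 ?lt0r_neq0.
by apply: ler_wpM2r; [rewrite invr_ge0 exprn_ge0|exact: Kc_bound].
Qed.

Local Notation pv := (pev w rcyc).

Definition injr (r : rep) := injectiveb (tagged r).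

Lemma rsp_card r : injr r -> #|rsp r| = (rty r).+2.
Proof. by move=> /injectiveP; exact: csupp_card. Qed.

Lemma rsp_card_le r : injr r -> (#|rsp r| <= La.+2)%N.
Proof. by move=> ir; rewrite rsp_card // !ltnS ltnW. Qed.

Lemma pev_rep r : injr r -> pv r <= Kc / n ^+ #|rsp r|.
Proof.
move=> ir; have c := rsp_card ir; have cl := rsp_card_le ir.
have h : (#|rsp r| <= 2 * La.+2)%N by apply: leq_trans cl _; rewrite leq_pmull.
have -> : #|rsp r| = (2 * #|rsp r| - #|rsp r|)%N by rewrite mul2n -addnn addnK.
apply: few_vertices_n => //; first by rewrite c.
move=> om /and3P[_ _ /existsP[v /andP[/injectiveP iv cv]]].
by rewrite /rsp (verts_cyc cv) c card_imset // cardsT card_ord.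
Qed.

Lemma rcyc_inj r om : rcyc r om -> injr r. Proof. by move=> /and3P[]. Qed.

Lemma pev_rep0 r : ~~ injr r -> pv r = 0.
Proof.
move=> nr; rewrite /pev -[RHS](@pw_cst _ _ m w 0 w1); apply: eq_pw => om.
by case e: (rcyc r om) => //; case/negP: nr; exact: rcyc_inj e.
Qed.

Lemma rep_untag (r s : rep) :
  Tagged (fun a : nat => {ffun 'I_a.+2 -> 'I_m}) (tagged r) =
  Tagged (fun a : nat => {ffun 'I_a.+2 -> 'I_m}) (tagged s) -> r = s.
Proof.
case: r s => [[a ha] al] [[b hb] be] /= e.
have ab : a = b by have := congr1 tag e.
subst b; rewrite (bool_irrelevance hb ha); congr (existT _ _ _).
exact: eq_from_Tagged e.
Qed.

Let uni (r s : rep) := #|rsp r :|: rsp s|.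

(** In both cases one power of 1/n is gained over the size of the union: for the product because the
    supports intersect, for the joint event because [cyc_overlap] leaves one vertex fewer than
    edges. *)
Lemma pair_bound r s : injr r -> injr s -> touches rsp r s ->
  pv r * pv s <= Kc ^+ 2 / n ^+ (uni r s).+1 /\
  (s != r -> pw w (fun om => (rcyc r om && rcyc s om)%:R) <= Kc ^+ 2 / n ^+ (uni r s).+1).
Proof.
move=> ir is_ mt.
have n1 : 1 <= n by rewrite ler1n.
have K1 : 1 <= Kc by rewrite exprn_ege1 // Kc_ge1.
have K0 : 0 <= Kc by lra.
have cr := rsp_card_le ir; have cs := rsp_card_le is_.
have uL : (uni r s <= 2 * La.+2)%N.
  by apply: leq_trans (leq_card_setU _ _) _; rewrite mul2n -addnn leq_add.
split=> [|sr].
  have u1 : ((uni r s).+1 <= #|rsp r| + #|rsp s|)%N.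
    rewrite /uni -cardsUI addnC -[X in (X <= _)%N]add1n leq_add2r card_gt0.
    by rewrite setI_eq0.
  apply: (@le_trans _ _ ((Kc / n ^+ #|rsp r|) * (Kc / n ^+ #|rsp s|))).
    by apply: ler_pM; rewrite ?pev_ge0 ?pev_rep.
  have -> : (Kc / n ^+ #|rsp r|) * (Kc / n ^+ #|rsp s|) = Kc ^+ 2 / n ^+ (#|rsp r| + #|rsp s|).
    by rewrite exprD expr2 invfM; ring.
  apply: ler_wpM2l; first exact: sqr_ge0.
  by rewrite lef_pV2 ?posrE ?exprn_gt0 // ler_weXn2l.
have u2 : (1 < uni r s)%N.
  apply: (@leq_trans #|rsp r|); last by rewrite subset_leq_card // subsetUl.
  by rewrite rsp_card.
apply: (@le_trans _ _ (Kc / n ^+ (2 * uni r s - (uni r s).-1))).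
  apply: few_vertices_n => //; first by rewrite -ltnS prednK // ltnW.
  - by rewrite (leq_trans (leq_pred _)).
  - by rewrite leq_pred.
  move=> om /andP[er es]; rewrite -ltnS prednK; last exact: ltnW.
  apply: cyc_overlap => //; apply: contraNN sr => /eqP e.
  apply/eqP; symmetry; exact: rep_untag e.
have -> : (2 * uni r s - (uni r s).-1)%N = (uni r s).+1.
  by move: (uni r s) u2 => u u2; clear -u2; lia.
apply: ler_wpM2r; first by rewrite invr_ge0 exprn_ge0.
by rewrite expr2 ler_peMr.
Qed.

Lemma base_ge1 : 1 <= La.+2%:R + T.
Proof. by rewrite ler_wpDr ?T_ge0 // ler1n. Qed.

(** The weight factors over the entries of the index tuple: an entry lies in the support of r, with
    at most [La.+2] choices, or outside, with m choices of weight 1/n and total at most T. *)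
Lemma sum_rep_unions (r : rep) (b : 'I_La) : injr r ->
  \sum_(be : {ffun 'I_b.+2 -> 'I_m} | injectiveb be) (n ^+ #|csupp be :\: rsp r|)^-1 <=
  (La.+2%:R + T) ^+ b.+2.
Proof.
move=> ir.
pose F (x : 'I_m) : R := if x \in rsp r then 1 else n^-1.
have F0 x : 0 <= F x by rewrite /F; case: ifP => // _; rewrite invr_ge0.
apply: (@le_trans _ _ (\sum_(be : {ffun 'I_b.+2 -> 'I_m}) \prod_j F (be j))).
  rewrite big_mkcond /=; apply: ler_sum => be _; case: injectiveP => [ibe|_]; last exact: prodr_ge0.
  have -> : \prod_(j < b.+2) F (be j) = \prod_(x in csupp be) F x.
    rewrite /csupp big_imset /=; last by move=> ? ? _ _; exact: ibe.
    by apply: eq_bigl => j; rewrite inE.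
  rewrite (bigID (mem (rsp r))) /= big1 ?mul1r; last by move=> x /andP[_ xr]; rewrite /F xr.
  rewrite (eq_bigr (fun=> n^-1)); last by move=> x /andP[_ /negbTE xr]; rewrite /F xr.
  rewrite (eq_bigl (mem (csupp be :\: rsp r))); last by move=> x; rewrite !inE andbC.
  by rewrite prodr_const exprVn.
rewrite -(bigA_distr_bigA (fun _ x => F x)) /= prodr_const card_ord.
apply: lerXn2r; rewrite ?nnegrE ?sumr_ge0 ?(le_trans ler01 base_ge1) //.
rewrite (bigID (mem (rsp r))) /=; apply: lerD.
  rewrite (eq_bigr (fun=> 1)); last by move=> x xr; rewrite /F xr.
  by rewrite sumr_const ler_nat rsp_card_le.
rewrite (eq_bigr (fun=> n^-1)); last by move=> x /negbTE xr; rewrite /F xr.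
rewrite sumr_cst ler_pdivrMr //; apply: le_trans mT.
by rewrite ler_nat (leq_trans (max_card _)) // card_ord.
Qed.

Definition Cr : R := La%:R * (La.+2%:R + T) ^+ La.+2.

Lemma sum_base_le (x : 'I_La -> R) :
  (forall b, x b <= (La.+2%:R + T) ^+ b.+2) -> \sum_b x b <= Cr.
Proof.
move=> xb; apply: (@le_trans _ _ (\sum_(b < La) (La.+2%:R + T) ^+ La.+2)).
  apply: ler_sum => b _; apply: le_trans (xb b) _.
  by rewrite ler_weXn2l ?base_ge1 // !ltnS ltnW.
by rewrite sumr_cst card_ord.
Qed.

Lemma sum_rep_touch (r : rep) : injr r ->
  \sum_(s : rep | injr s) (n ^+ #|rsp s :\: rsp r|)^-1 <= Cr.
Proof.
move=> ir.
rewrite -(sig_big_dep (fun=> true) (fun (b : 'I_La) (be : {ffun 'I_b.+2 -> 'I_m}) => injectiveb be)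
  (fun (b : 'I_La) (be : {ffun 'I_b.+2 -> 'I_m}) => (n ^+ #|csupp be :\: rsp r|)^-1)) /=.
by apply: sum_base_le => b; exact: sum_rep_unions.
Qed.

Lemma sum_inj_le (b : 'I_La) :
  \sum_(be : {ffun 'I_b.+2 -> 'I_m} | injectiveb be) (n ^+ b.+2)^-1 <= T ^+ b.+2.
Proof.
rewrite sumr_cst.
apply: (@le_trans _ _ (m%:R ^+ b.+2 * (n ^+ b.+2)^-1)).
  apply: ler_wpM2r; first by rewrite invr_ge0 exprn_ge0.
  by rewrite -natrX ler_nat (leq_trans (max_card _)) // card_ffun !card_ord.
rewrite ler_pdivrMr ?exprn_gt0 // -exprMn.
by apply: lerXn2r; rewrite ?nnegrE ?mulr_ge0 ?T_ge0.
Qed.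

Lemma T_pow_le b : T ^+ b <= (La.+2%:R + T) ^+ b.
Proof.
by apply: lerXn2r; rewrite ?nnegrE ?T_ge0 ?(le_trans ler01 base_ge1) // lerDr.
Qed.

Lemma sum_rep_size : \sum_(r : rep | injr r) (n ^+ #|rsp r|)^-1 <= Cr.
Proof.
rewrite (eq_bigr (fun r : rep => (n ^+ (tag r).+2)^-1)); last first.
  by move=> r ir; rewrite rsp_card.
rewrite -(sig_big_dep (fun=> true) (fun (b : 'I_La) (be : {ffun 'I_b.+2 -> 'I_m}) => injectiveb be)
  (fun (b : 'I_La) (be : {ffun 'I_b.+2 -> 'I_m}) => (n ^+ b.+2)^-1)) /=.
apply: sum_base_le => b; apply: le_trans (sum_inj_le b) _; exact: T_pow_le.
Qed.

Lemma pair_sum_le : \sum_(r | injr r) \sum_(s | injr s) Kc ^+ 2 / n ^+ (uni r s).+1 <=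
  Kc ^+ 2 * Cr ^+ 2 / n.
Proof.
have Cr0 : 0 <= Cr.
  by apply: le_trans sum_rep_size; apply: sumr_ge0 => r _; rewrite invr_ge0 exprn_ge0.
have e r s : Kc ^+ 2 / n ^+ (uni r s).+1 =
    Kc ^+ 2 / n * ((n ^+ #|rsp r|)^-1 * (n ^+ #|rsp s :\: rsp r|)^-1).
  have -> : uni r s = (#|rsp r| + #|rsp s :\: rsp r|)%N.
    rewrite /uni -(cardsID (rsp r) (rsp r :|: rsp s)); congr (_ + _)%N; apply: eq_card => x;
      by rewrite !inE; case: (x \in rsp r); rewrite ?andbT ?andbF.
  by rewrite [_ ^+ (_ + _).+1]exprS exprD !invfM; ring.
have Kn : 0 <= Kc ^+ 2 / n by rewrite divr_ge0 ?sqr_ge0.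
apply: (@le_trans _ _ (\sum_(r | injr r) Kc ^+ 2 / n * ((n ^+ #|rsp r|)^-1 * Cr))).
  apply: ler_sum => r ir; under eq_bigr do rewrite e.
  rewrite -mulr_sumr; apply: ler_wpM2l => //; rewrite -mulr_sumr.
  by apply: ler_wpM2l; [rewrite invr_ge0 exprn_ge0|exact: sum_rep_touch].
rewrite -mulr_sumr -mulr_suml.
have -> : Kc ^+ 2 * Cr ^+ 2 / n = Kc ^+ 2 / n * (Cr * Cr) by ring.
by apply: ler_wpM2l => //; apply: ler_wpM2r => //; exact: sum_rep_size.
Qed.

(** The number of pairs with a union of u indices is of order n^u, against probabilities of order
    n^(-u-1). *)
Lemma dep_bound : dep1 w rcyc rsp + dep2 w rcyc rsp <= 2 * (Kc ^+ 2 * Cr ^+ 2) / n.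
Proof.
have P0 r s : 0 <= Kc ^+ 2 / n ^+ (uni r s).+1 by rewrite divr_ge0 ?sqr_ge0 ?exprn_ge0.
have -> : 2 * (Kc ^+ 2 * Cr ^+ 2) / n = Kc ^+ 2 * Cr ^+ 2 / n + Kc ^+ 2 * Cr ^+ 2 / n by ring.
apply: lerD; apply: le_trans pair_sum_le.
  rewrite /dep1 (bigID injr) /= [X in _ + X]big1 ?addr0; last first.
    by move=> r nr; rewrite big1 // => s _; rewrite pev_rep0 // mul0r.
  apply: ler_sum => r ir; rewrite big_mkcond [X in _ <= X]big_mkcond; apply: ler_sum => s _.
  case: ifP => [ts|_]; last by case: ifP.
  by case: ifP => is_; [have [] := pair_bound ir is_ ts|rewrite (pev_rep0 (negbT is_)) mulr0].
rewrite /dep2 (bigID injr) /= [X in _ + X]big1 ?addr0; last first.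
  move=> r nr; rewrite big1 // => s _; rewrite -[RHS](@pw_cst _ _ m w 0 w1); apply: eq_pw => om.
  by case e: (rcyc r om) => //; case/negP: nr; exact: rcyc_inj e.
apply: ler_sum => r ir; rewrite big_mkcond [X in _ <= X]big_mkcond; apply: ler_sum => s _.
case: ifP => [/andP[sr ts]|_]; last by case: ifP.
case: ifP => is_; first by have [_] := pair_bound ir is_ ts; apply.
rewrite -[X in _ <= X](@pw_cst _ _ m w 0 w1) ler_pw // => om.
by case e: (rcyc s om); rewrite ?andbF //; case/negP: (negbT is_); exact: rcyc_inj e.
Qed.

Lemma lam_reps a : lam w rty rcyc a = \sum_(be : {ffun 'I_a.+2 -> 'I_m}) pv (Tagged _ be : rep).
Proof.
rewrite /lam; under eq_bigl do rewrite /rty.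
transitivity (\sum_(b | b == a) \sum_(be : {ffun 'I_b.+2 -> 'I_m}) pv (Tagged _ be : rep)).
  rewrite (sig_big_dep (fun b => b == a) (fun (b : 'I_La) (be : {ffun 'I_b.+2 -> 'I_m}) => true)
    (fun (b : 'I_La) (be : {ffun 'I_b.+2 -> 'I_m}) =>
       pv (Tagged (fun x : 'I_La => {ffun 'I_x.+2 -> 'I_m}) be : rep))) /=.
  by apply: eq_big => [r|[]//]; rewrite andbT.
by rewrite big_pred1_eq.
Qed.

Lemma lam_bound a : lam w rty rcyc a <= Kc * (La.+2%:R + T) ^+ La.+2.
Proof.
have K0 : 0 <= Kc by rewrite exprn_ge0 // (le_trans ler01 Kc_ge1).
rewrite lam_reps.
apply: (@le_trans _ _ (\sum_(be : {ffun 'I_a.+2 -> 'I_m} | injectiveb be) Kc * (n ^+ a.+2)^-1)).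
  rewrite [X in _ <= X]big_mkcond /=; apply: ler_sum => be _; case: ifP => ib.
    have := @pev_rep (Tagged _ be : rep) ib.
    by rewrite rsp_card.
  by rewrite (@pev_rep0 (Tagged _ be : rep)) // negbT.
rewrite -mulr_sumr; apply: ler_wpM2l => //.
apply: le_trans (sum_inj_le a) _; apply: le_trans (T_pow_le _) _.
by rewrite ler_weXn2l ?base_ge1 // !ltnS ltnW.
Qed.

End CycleBounds.

(** * Poisson approximation *)

Section ExpSeries.
Variable R : realType.

Definition epart (M : nat) (x : R) : R := \sum_(j < M.+1) x ^+ j / j`!%:R.

Lemma epart_series M x : epart M x = series (exp_coeff x) M.+1.
Proof.
by rewrite /epart /series /= big_mkord; apply: eq_bigr => i _; rewrite /exp_coeff /= mulrC.
Qed.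

Lemma epart_le_expR M x : 0 <= x -> epart M x <= expR x.
Proof.
move=> x0; rewrite epart_series; apply: nondecreasing_cvgn_le.
  by apply: nondecreasing_series => n _ _; exact: exp_coeff_ge0.
exact: is_cvg_series_exp_coeff.
Qed.

(** The remainder of the series has nonnegative coefficients, hence increases with x; a truncation
    good at the bound B is good on [0, B]. *)
Lemma expR_epart_mono M x y : 0 <= x <= y -> expR x - epart M x <= expR y - epart M y.
Proof.
move=> /andP[x0 xy]; have y0 : 0 <= y by exact: le_trans xy.
suff : expR x <= expR y - epart M y + epart M x by lra.
apply: limr_le; first exact: is_cvg_series_exp_coeff.
exists M.+1 => //= N /= MN.
have hN (z : R) : series (exp_coeff z) N = epart M z + \sum_(M.+1 <= i < N) exp_coeff z i.
  by rewrite epart_series /series /= -big_cat_nat.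
have : series (exp_coeff y) N <= expR y.
  apply: nondecreasing_cvgn_le; last exact: is_cvg_series_exp_coeff.
  by apply: nondecreasing_series => n _ _; exact: exp_coeff_ge0.
rewrite !hN.
have : \sum_(M.+1 <= i < N) exp_coeff x i <= \sum_(M.+1 <= i < N) exp_coeff y i.
  apply: ler_sum => i _; rewrite /exp_coeff /=; apply: ler_wpM2r; first by rewrite invr_ge0.
  by apply: lerXn2r; rewrite ?nnegrE.
lra.
Qed.

Lemma epart_cvg (B e : R) : 0 < e -> exists M, forall M', (M <= M')%N -> expR B - epart M' B <= e.
Proof.
move=> e0; have /cvgrPdist_le/(_ e e0) [M _ HM] := is_cvg_series_exp_coeff B.
exists M => M' MM'; rewrite epart_series; apply: le_trans (ler_norm _) _.
by apply: HM; rewrite /=; exact: leqW.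
Qed.

End ExpSeries.

Section PoissonApprox.
Variables (R : realType) (A : finType).
Implicit Types (c : {ffun A -> nat}) (L : A -> R).

Definition pois L c : R := \prod_a (expR (- L a) * (L a ^+ c a / (c a)`!%:R)).

Definition box_nat M (d : {ffun A -> 'I_M.+1}) : {ffun A -> nat} := [ffun a => val (d a)].

Lemma pow_fact_le_expR (x : R) j : 0 <= x -> x ^+ j / j`!%:R <= expR x.
Proof.
move=> x0; case: j => [|j]; first by rewrite expr0 fact0 divr1 (le_trans _ (expR_ge1Dx _)) // lerDl.
by apply: le_trans (expR_ge1Dxn j x0); rewrite lerDr.
Qed.

Lemma pois_le1 L c : (forall a, 0 <= L a) -> 0 <= pois L c <= 1.
Proof.
move=> L0; have h a : 0 <= expR (- L a) * (L a ^+ c a / (c a)`!%:R) <= 1.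
  rewrite mulr_ge0 ?expR_ge0 ?divr_ge0 ?exprn_ge0 //= expRN mulrC ler_pdivrMr ?expR_gt0 // mul1r.
  exact: pow_fact_le_expR.
rewrite prodr_ge0 /=; last by move=> a _; have /andP[] := h a.
by rewrite -[X in _ <= X](big1_eq (op := *%R) (idx := 1) (index_enum A) xpredT); apply: ler_prod => a _.
Qed.

(** The recursion fixes all values up to the factor [p 0], and the total mass, almost carried by a
    finite box, fixes that factor. The tolerance [b0] is chosen before p and L, which the later
    averages over colorings require. *)
Lemma poisson_approx (B e : R) (N : nat) : 0 <= B -> 0 < e ->
  exists2 b0 : R, 0 < b0 & forall (p : {ffun A -> nat} -> R) L,
    (forall a, 0 <= L a <= B) -> (forall c, 0 <= p c) ->
    (forall c a, (0 < c a)%N -> `|(c a)%:R * p c - L a * p (decr c a)| <= b0) ->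
    (forall M, 1 - #|A|%:R * B / M.+1%:R <= \sum_(d : {ffun A -> 'I_M.+1}) p (box_nat d) <= 1) ->
    forall c, (forall a, (c a <= N)%N) -> `|p c - pois L c| <= e.
Proof.
move=> B0 e0.
pose nA : R := #|A|%:R.
have nA0 : 0 <= nA by rewrite ler0n.
pose e1 := Num.min (e / 20) (1 / 4).
have e10 : 0 < e1 by rewrite lt_min; apply/andP; split; lra.
have e1e : e1 <= e / 20 by rewrite ge_min lexx.
have e14 : e1 <= 1 / 4 by rewrite ge_min lexx orbT.
(* Each coordinate gets this share of the relative truncation error, so that the product over A
   loses at most [e1]. *)
have x0 : 0 < e1 / (1 + nA) by rewrite divr_gt0 //; lra.
have [M1 hM1] := epart_cvg B x0.
pose M2 := Num.truncn (nA * B / e1).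
pose M := maxn M1 M2.
have hM := hM1 M (leq_maxl _ _).
have tail : nA * B / M.+1%:R <= e1.
  rewrite ler_pdivrMr ?ltr0n // -ler_pdivrMl // mulrC.
  apply: ltW; apply: lt_le_trans (truncnS_gt _) _.
  by rewrite ler_nat ltnS leq_maxr.
(* Error amplification: [KM] for the sum over the whole box of side M, [KN] for a single point with
   entries at most N. *)
pose KM : R := M.+1%:R ^+ #|A| * (1 + B) ^+ (M * #|A|).
pose KN : R := (1 + B) ^+ (N * #|A|).
have B1 : 1 <= 1 + B by lra.
have KM1 : 1 <= KM by rewrite -[1]mulr1 ler_pM // ?exprn_ege1 // ler1n.
have KN1 : 1 <= KN by rewrite exprn_ege1.
pose b0 := e1 / (KM + KN).
have b00 : 0 < b0 by rewrite divr_gt0 //; lra.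
exists b0 => // p L LB p0 rec mass c cN.
have L0 a : 0 <= L a by have /andP[] := LB a.
pose q0 c : R := \prod_a (L a ^+ c a / (c a)`!%:R).
pose z : {ffun A -> nat} := [ffun=> 0%N].
have q00 c' : 0 <= q0 c' by apply: prodr_ge0 => a _; rewrite divr_ge0 ?exprn_ge0.
have qz : q0 z = 1 by rewrite /q0 big1 // => a _; rewrite ffunE expr0 fact0 divr1.
have step c' a : (0 < c' a)%N -> q0 c' = L a / (c' a)%:R * q0 (decr c' a).
  move=> ca; rewrite /q0 (bigD1 a) //= [in RHS](bigD1 a) //= mulrA; congr (_ * _).
    rewrite ffunE eqxx subn1; case: (c' a) ca => // j _; rewrite /= factS natrM exprS.
    by field; rewrite !pnatr_eq0 -!lt0n fact_gt0 /=.
  by apply: eq_bigr => b /negbTE ba; rewrite ffunE ba subn0.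
(* Each use of the recursion adds at most [b0] and multiplies the earlier error by at most B, whence
   the growth rate 1 + B. *)
have qb c' : `|p c' - p z * q0 c'| <= b0 * (1 + B) ^+ (\sum_a c' a)%N.
  move: {2}(\sum_a c' a)%N (erefl (\sum_a c' a)%N) => s; elim: s c' => [|s IH] c' sc.
    have -> : c' = z.
      apply/ffunP => a; rewrite ffunE; apply/eqP.
      by move/eqP: sc; rewrite sum_nat_eq0 => /forall_inP /(_ a); exact.
    rewrite qz mulr1 subrr normr0 mulr_ge0 ?exprn_ge0 ?(ltW b00) //; lra.
  have [a ca] : exists a, (0 < c' a)%N.
    case: (pickP (fun a => 0 < c' a)%N) => [a ca|H]; first by exists a.
    by move: sc; rewrite big1 // => a _; apply/eqP; rewrite -leqn0 leqNgt H.
  have Ca : 1 <= (c' a)%:R :> R by rewrite ler1n.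
  have Ca0 : 0 < (c' a)%:R :> R by rewrite ltr0n.
  have sd : (\sum_b decr c' a b = s)%N.
    apply/eqP; rewrite -eqSS -sc (bigD1 a) //= [X in _ == X](bigD1 a) //= ffunE eqxx subn1.
    rewrite -addSn prednK //; apply/eqP; congr (_ + _)%N.
    by apply: eq_bigr => b /negbTE ba; rewrite ffunE ba subn0.
  have := IH (decr c' a) sd; rewrite sd sc => IHd.
  rewrite (step c' a ca).
  have -> : p c' - p z * (L a / (c' a)%:R * q0 (decr c' a)) =
     ((c' a)%:R * p c' - L a * p (decr c' a)) / (c' a)%:R +
     L a / (c' a)%:R * (p (decr c' a) - p z * q0 (decr c' a)).
    by field; rewrite lt0r_neq0.
  apply: le_trans (ler_normD _ _) _.
  have La : 0 <= L a / (c' a)%:R <= B.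
    have /andP[l0 l1] := LB a; rewrite divr_ge0 //= ler_pdivrMr //.
    by apply: le_trans l1 _; rewrite ler_peMr.
  case/andP: La => la0 la1.
  rewrite normrM normfV (gtr0_norm Ca0) normrM (ger0_norm la0).
  have t1 : `|(c' a)%:R * p c' - L a * p (decr c' a)| / (c' a)%:R <= b0.
    rewrite ler_pdivrMr //; apply: le_trans (rec _ _ ca) _.
    by rewrite ler_peMr // ltW.
  have t2 : L a / (c' a)%:R * `|p (decr c' a) - p z * q0 (decr c' a)| <= B * (b0 * (1 + B) ^+ s).
    by apply: ler_pM.
  apply: le_trans (lerD t1 t2) _; rewrite exprS.
  have : b0 * 1 <= b0 * (1 + B) ^+ s by rewrite ler_pM2l // exprn_ege1.
  set X := (1 + B) ^+ s; lra.
have qbox N' c' : (forall a, (c' a <= N')%N) -> `|p c' - p z * q0 c'| <= b0 * (1 + B) ^+ (N' * #|A|).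
  move=> cN'; apply: le_trans (qb c') _; rewrite ler_pM2l // ler_weXn2l //.
  rewrite mulnC -sum_nat_const; exact: leq_sum.
pose E : R := \prod_a epart M (L a).
pose F : R := expR (\sum_a L a).
have F0 : 0 < F by exact: expR_gt0.
have sumq0 : \sum_(d : {ffun A -> 'I_M.+1}) q0 (box_nat d) = E.
  rewrite /E /epart bigA_distr_bigA /=; apply: eq_bigr => d _.
  by apply: eq_bigr => a _; rewrite ffunE.
have EF : E <= F.
  rewrite /F expR_sum; apply: ler_prod => a _; rewrite epart_le_expR // andbT.
  by apply: sumr_ge0 => j _; rewrite divr_ge0 ?exprn_ge0.
have EF2 : (1 - e1) * F <= E.
  have xle : e1 / (1 + nA) <= 1.
    rewrite ler_pdivrMr; lra.
  apply: (@le_trans _ _ ((1 - e1 / (1 + nA)) ^+ #|A| * F)).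
    apply: ler_wpM2r; first exact: ltW.
    have := @bernoulli R (- (e1 / (1 + nA))) #|A|.
    rewrite lerN2 => /(_ xle); apply: le_trans; rewrite -/nA mulrN lerD2l lerN2.
    by rewrite mulrCA ger_pMr // ler_pdivrMr; lra.
  rewrite /F expR_sum -prodr_const -[X in X * _](eq_bigl _ _ (fun a => erefl (a \in A))) -big_split /=.
  apply: ler_prod => a _; rewrite mulr_ge0 ?expR_ge0 ?subr_ge0 //=.
  have m1 := @expR_epart_mono R M (L a) B (LB a).
  have m2 : 1 <= expR (L a) by have := expR_ge1Dx (L a); have := L0 a; lra.
  have : e1 / (1 + nA) * 1 <= e1 / (1 + nA) * expR (L a) by rewrite ler_pM2l.
  lra.
have sumdiff : `|\sum_(d : {ffun A -> 'I_M.+1}) p (box_nat d) - p z * E| <= b0 * KM.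
  rewrite -sumq0 mulr_sumr -sumrB; apply: le_trans (ler_norm_sum _ _ _) _.
  apply: (@le_trans _ _ (\sum_(d : {ffun A -> 'I_M.+1}) b0 * (1 + B) ^+ (M * #|A|))).
    by apply: ler_sum => d _; apply: qbox => a; rewrite ffunE -ltnS; exact: ltn_ord.
  rewrite sumr_cst card_ffun card_ord natrX /KM; set X := _ ^+ _; set Y := (1 + B) ^+ _.
  by apply: ler_of_eq; ring.
have b0K : b0 * KM <= e1 /\ b0 * KN <= e1.
  by rewrite /b0; split; rewrite mulrAC ler_pdivrMr ?ler_pM2l //; lra.
case: b0K => bM bN.
have /andP[mass1 mass2] := mass M.
have pz0 := p0 z.
move: sumdiff; rewrite ler_norml => /andP[sd1 sd2].
have [u1 u2] : 1 - 2 * e1 <= p z * E /\ p z * E <= 1 + e1.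
  have H : forall x1 x2 x3 x4 x5 : R, 1 - x4 <= x1 -> x1 <= 1 -> x4 <= x5 -> - x3 <= x1 - x2 ->
      x1 - x2 <= x3 -> x3 <= x5 -> 1 - 2 * x5 <= x2 /\ x2 <= 1 + x5.
    by clear; move=> x1 x2 x3 x4 x5 h1 h2 h3 h4 h5 h6; split; lra.
  exact: H mass1 mass2 tail sd1 sd2 bM.
have v1 : 1 - 2 * e1 <= p z * F by apply: le_trans u1 _; rewrite ler_wpM2l.
have v2 : p z * F <= 1 + 4 * e1.
  have : p z * ((1 - e1) * F) <= p z * E by rewrite ler_wpM2l.
  set y := p z * F; have -> : p z * ((1 - e1) * F) = (1 - e1) * y by rewrite /y; ring.
  move=> h; have : (1 - e1) * y <= 1 + e1 by lra.
  nra.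
have poisE : pois L c = q0 c / F.
  rewrite /pois big_split /= mulrC; congr (_ * _).
  by rewrite /F -expRN -sumrN expR_sum.
have /andP[po0 po1] := pois_le1 c L0.
have -> : p c - pois L c = (p c - p z * q0 c) + pois L c * (p z * F - 1).
  by rewrite poisE; field; rewrite lt0r_neq0.
apply: le_trans (ler_normD _ _) _.
have t1 : `|p c - p z * q0 c| <= e1 by apply: le_trans (qbox N c cN) _.
have t2 : `|pois L c * (p z * F - 1)| <= 4 * e1.
  rewrite normrM (ger0_norm po0).
  have : `|p z * F - 1| <= 4 * e1 by rewrite ler_norml; apply/andP; split; lra.
  by move=> h; apply: le_trans h; rewrite ler_piMl.
lra.
Qed.

End PoissonApprox.

Section BoxMass.
Variables (R : realType) (E : finType) (m : nat) (w : E -> R).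
Hypothesis w0 : forall e, 0 <= w e.
Hypothesis w1 : \sum_e w e = 1.
Local Notation Om := {ffun 'I_m -> E}.
Variables (I A : finType) (ty : I -> A) (ev : I -> Om -> bool).

Lemma sum_box_at M (om : Om) :
  \sum_(d : {ffun A -> 'I_M.+1}) (nev_at ty ev (box_nat d) om)%:R =
  ([forall a, nev ty ev a om <= M]%N)%:R :> R.
Proof.
case: forallP => [H|H].
  pose d0 : {ffun A -> 'I_M.+1} := [ffun a => inord (nev ty ev a om)].
  rewrite (bigD1 d0) //= big1 ?addr0.
    rewrite (_ : nev_at _ _ _ _) //; apply/forallP => a.
    by rewrite !ffunE /= inordK // ltnS.
  move=> d dd; rewrite (_ : nev_at _ _ _ _ = false) //; apply: contraNF dd => /forallP e.
  apply/eqP/ffunP => a; apply: val_inj; have /eqP := e a; rewrite !ffunE /= => <-.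
  by rewrite inordK // ltnS.
rewrite big1 // => d _; rewrite (_ : nev_at _ _ _ _ = false) //; apply/negP => /forallP e.
by apply: H => a; have /eqP -> := e a; rewrite ffunE -ltnS; exact: ltn_ord.
Qed.

(** Markov's inequality for each type and a union bound over the types. *)
Lemma box_mass M :
  1 - (\sum_a lam w ty ev a) / M.+1%:R <=
  \sum_(d : {ffun A -> 'I_M.+1}) pat w ty ev (box_nat d) <= 1.
Proof.
rewrite /pat -pw_sum (eq_pw _ (sum_box_at M)).
apply/andP; split; last first.
  rewrite -[X in _ <= X](@pw_cst _ _ m w 1 w1); apply: ler_pw => // om.
  by rewrite lern1 leq_b1.
have -> : (\sum_a lam w ty ev a) / M.+1%:R = pw w (fun om : Om => M.+1%:R^-1 * \sum_a (nev ty ev a om)%:R).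
  by rewrite pwZ mulrC pw_sum; congr (_ * _); apply: eq_bigr => a _; rewrite pw_nev.
rewrite -[X in X - _ <= _](@pw_cst _ _ m w 1 w1) -pwB; apply: ler_pw => // om.
case: forallP => [_|H].
  by rewrite gerBl mulr_ge0 ?invr_ge0 // sumr_ge0.
have [a ha] : exists a, (M < nev ty ev a om)%N.
  case: (pickP (fun a => M < nev ty ev a om)%N) => [a ha|h]; first by exists a.
  by case: H => a; rewrite leqNgt h.
rewrite subr_le0 mulrC ler_pdivlMr ?ltr0n // mul1r (bigD1 a) //=.
by apply: ler_wpDr; [apply: sumr_ge0|rewrite ler_nat].
Qed.

End BoxMass.

(** * Expected numbers of cycles *)

Section ConsFfun.
Variable C : finType.

Definition fcons a (x : C) (u : {ffun 'I_a -> C}) : {ffun 'I_a.+1 -> C} :=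
  [ffun j => oapp u x (unlift ord0 j)].

Lemma fcons0 a x (u : {ffun 'I_a -> C}) : fcons x u ord0 = x.
Proof. by rewrite ffunE unlift_none. Qed.

Lemma fconsS a x (u : {ffun 'I_a -> C}) j : fcons x u (lift ord0 j) = u j.
Proof. by rewrite ffunE liftK. Qed.

Lemma sum_fcons (R : nmodType) a (F : {ffun 'I_a.+1 -> C} -> R) :
  \sum_v F v = \sum_x \sum_u F (fcons x u).
Proof.
rewrite pair_bigA /= (reindex (fun p : C * {ffun 'I_a -> C} => fcons p.1 p.2)) //=.
exists (fun v : {ffun 'I_a.+1 -> C} => (v ord0, [ffun j => v (lift ord0 j)])) => [[x u] _|v _] /=.
  by rewrite fcons0; congr pair; apply/ffunP => j; rewrite ffunE fconsS.
apply/ffunP => j; case: (unliftP ord0 j) => [i ->|->]; last by rewrite fcons0.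
by rewrite fconsS ffunE.
Qed.

End ConsFfun.

Section CycleColorings.
Variables (R : realType) (C : finType).
Local Notation K := (#|C|%:R : R).

(** Indicator that x, the entries of u, and y form a properly colored path; [insub] fails exactly at
    the last index, where the next color is y. *)
Definition pathw a (x : C) (u : {ffun 'I_a -> C}) (y : C) : R :=
  \prod_(j < a.+1) (fcons x u j != (if insub (val j) is Some i then u i else y))%:R.

Lemma pathw_cons a x z (u : {ffun 'I_a -> C}) y :
  pathw x (fcons z u) y = (x != z)%:R * pathw z u y.
Proof.
rewrite /pathw big_ord_recl; congr (_ * _).
  by rewrite fcons0 /= (insubT (fun i => i < a.+1)%N (ltn0Sn a)) (_ : Sub 0%N _ = ord0) ?fcons0 //; apply: val_inj.
apply: eq_bigr => j _; rewrite fconsS; congr (~~ (_ == _))%:R.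
have [ja|ja] := boolP (val j < a)%N.
  rewrite (insubT (fun i => i < a)%N ja) (insubT (fun i => i < a.+1)%N (_ : (val (lift ord0 j) < a.+1)%N)) //.
  rewrite -[RHS](fconsS z); congr (fcons z u _); exact: val_inj.
by rewrite !insubF //=; apply/negbTE; rewrite ?ltnS.
Qed.

(** An entry of a power of the adjacency matrix of the complete graph on C, whose eigenvalues are K
    - 1 once and -1 otherwise. Setting y = x yields the count of proper colorings of a cycle. *)
Lemma sum_pathw a x y : \sum_(u : {ffun 'I_a -> C}) pathw x u y =
  ((K - 1) ^+ a.+1 - (-1) ^+ a.+1) / K + (x == y)%:R * (-1) ^+ a.+1.
Proof.
have K0 : K != 0 by rewrite pnatr_eq0 -lt0n; apply/card_gt0P; exists x.
elim: a x => [|a IH] x.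
  rewrite (big_pred1 [ffun i : 'I_0 => x]) => [|u]; last first.
    by apply/esym/eqP/ffunP => -[].
  rewrite /pathw big_ord_recl big_ord0 mulr1 insubF // fcons0.
  by rewrite !expr1; case: (x == y) => /=; field.
rewrite sum_fcons; under eq_bigr => z _ do (under eq_bigr do rewrite pathw_cons; rewrite -mulr_sumr IH).
under eq_bigr do rewrite mulrDr.
rewrite big_split /= -mulr_suml.
have -> : \sum_z (x != z)%:R = K - 1.
  rewrite -sum1_card natr_sum (bigD1 x) //= eqxx add0r [in RHS](bigD1 x) //= [RHS]addrC addKr.
  by apply: eq_bigr => z zx; rewrite eq_sym zx.
have -> : \sum_z (x != z)%:R * ((z == y)%:R * (-1) ^+ a.+1) = (x != y)%:R * (-1) ^+ a.+1 :> R.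
  rewrite (bigD1 y) //= eqxx mul1r big1 ?addr0 // => z /negbTE ->; by rewrite mul0r mulr0.
rewrite ![_ ^+ a.+2]exprS; move: (_ ^+ a.+1) ((-1) ^+ a.+1) => A B.
by case: (x == y) => /=; field.
Qed.

Definition ccol l : R := \sum_(c : {ffun 'I_l -> C}) \prod_j (c j != c (ordS j))%:R.

Lemma cycle_colorings a : ccol a.+1 = (K - 1) ^+ a.+1 + (-1) ^+ a.+1 * (K - 1).
Proof.
rewrite /ccol sum_fcons.
transitivity (\sum_x \sum_(u : {ffun 'I_a -> C}) pathw x u x).
  apply: eq_bigr => x _; apply: eq_bigr => u _; apply: eq_bigr => j _.
  congr (~~ (_ == _))%:R.
  have [ja|ja] := boolP (val j < a)%N.
    rewrite (insubT (fun i => i < a)%N ja) -[RHS](fconsS x); congr (fcons x u _).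
    by apply: val_inj; rewrite /= modn_small.
  rewrite insubF; last exact/negbTE.
  rewrite (_ : ordS j = ord0) ?fcons0 //; apply: val_inj => /=.
  have -> : val j = a by apply/eqP; rewrite eqn_leq -ltnS ltn_ord leqNgt.
  by rewrite modnn.
under eq_bigr do rewrite sum_pathw eqxx mul1r.
rewrite sumr_cst; have [c0|c0] := eqVneq #|C| 0%N; last first.
  by rewrite mulrDr mulrCA mulfV ?pnatr_eq0 //; ring.
by rewrite c0 mul0r sub0r mulrN1 exprS mulN1r subrr.
Qed.

End CycleColorings.

Lemma prod_diff_le (R : realType) (I : finType) (x y : I -> R) :
  (forall i, 0 <= x i <= 1) -> (forall i, 0 <= y i <= 1) ->
  `|\prod_i x i - \prod_i y i| <= \sum_i `|x i - y i|.
Proof.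
move=> hx hy.
suff [] : [/\ 0 <= \prod_i x i <= 1, 0 <= \prod_i y i <= 1 &
    `|\prod_i x i - \prod_i y i| <= \sum_i `|x i - y i|] by [].
apply: (big_rec3 (fun a b c => [/\ 0 <= a <= 1, 0 <= b <= 1 & `|a - b| <= c])).
  by rewrite subrr normr0 !lexx ler01.
move=> i a b c _ [/andP[a0 a1] /andP[b0 b1] abc].
have /andP[x0 x1] := hx i; have /andP[y0 y1] := hy i.
split; try by rewrite mulr_ge0 // mulr_ile1.
have -> : x i * a - y i * b = (x i - y i) * a + y i * (a - b) by ring.
apply: le_trans (ler_normD _ _) _; rewrite !normrM (ger0_norm a0) (ger0_norm y0).
apply: lerD; first by rewrite ler_piMr.
by apply: le_trans abc; rewrite ler_piMl.
Qed.

Section TypeTrace.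
Variables (R : realType) (V C : finType) (t : V -> C) (G : C -> C -> R).

Definition fib (c : C) : R := #|[set x | t x == c]%SET|%:R.

Definition trc (T : finType) (w : T -> T -> R) l : R :=
  \sum_(v : {ffun 'I_l -> T}) \prod_j w (v j) (v (ordS j)).

Lemma type_trace l : trc (fun x y => G (t x) (t y)) l =
  \sum_(c : {ffun 'I_l -> C}) (\prod_j fib (c j)) * \prod_j G (c j) (c (ordS j)).
Proof.
(* Closed walks are grouped by their sequence of types, on which the weight depends. *)
rewrite /trc (partition_big (fun v : {ffun 'I_l -> V} => [ffun j => t (v j)]) xpredT) //=.
apply: eq_bigr => c _.
transitivity (\sum_(v : {ffun 'I_l -> V} | [ffun j => t (v j)] == c) \prod_j G (c j) (c (ordS j))).
  apply: eq_bigr => v /eqP <-; apply: eq_bigr => j _; by rewrite !ffunE.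
rewrite sumr_cst; congr (_ * _).
have -> : \prod_j fib (c j) = \prod_j \sum_(x | t x == c j) 1.
  by apply: eq_bigr => j _; rewrite /fib -sum1_card natr_sum; apply: eq_bigl => x; rewrite inE.
rewrite bigA_distr_big_dep /= -sum1_card natr_sum; apply: congr_big => // [v|v _]; last by rewrite big1.
apply/eqP/familyP => [<- j|H]; first by rewrite ffunE unfold_in.
by apply/ffunP => j; rewrite ffunE; apply/eqP; exact: H.
Qed.

End TypeTrace.

Lemma ccol2 (R : realType) (C : finType) l :
  \sum_(c : {ffun 'I_l -> C * C}) \prod_j (((c j).1 != (c (ordS j)).1) && ((c j).2 != (c (ordS j)).2))%:R
  = ccol R C l ^+ 2.
Proof.
rewrite expr2 /ccol mulr_suml; under [RHS]eq_bigr do rewrite mulr_sumr.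
rewrite pair_bigA /=.
rewrite (reindex (fun p : {ffun 'I_l -> C} * {ffun 'I_l -> C} => [ffun j => (p.1 j, p.2 j)])) /=.
  apply: eq_bigr => -[a b] _ /=; rewrite -big_split /=; apply: eq_bigr => j _.
  by rewrite !ffunE /= -natrM mulnb.
exists (fun c : {ffun 'I_l -> C * C} => ([ffun j => (c j).1], [ffun j => (c j).2])) => [[a b] _|c _] /=.
  by congr pair; apply/ffunP => j; rewrite !ffunE.
by apply/ffunP => j; rewrite !ffunE; case: (c j).
Qed.

Section InjTrace.
Variables (R : realType) (V : finType) (W : R) (w : V -> V -> R).
Local Notation n := (#|V|%:R : R).
Hypothesis n0 : (0 < #|V|)%N.
Hypothesis w0 : forall x y, 0 <= w x y.
Hypothesis wW : forall x y, w x y <= W / n ^+ 2.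

Definition itrc l : R := \sum_(v : {ffun 'I_l -> V} | injectiveb v) \prod_j w (v j) (v (ordS j)).

Lemma ffact_ge (N l : nat) : (0 < N)%N -> (N%:R ^+ l * (1 - l%:R ^+ 2 / N%:R) : R) <= (N ^_ l)%:R.
Proof.
move=> N0; have N0' : 0 < N%:R :> R by rewrite ltr0n.
have [lN|Nl] := leqP l N; last first.
  apply: (@le_trans _ _ 0) => //; rewrite mulr_ge0_le0 ?exprn_ge0 //.
  rewrite subr_le0 ler_pdivlMr // mul1r -natrX ler_nat (leq_trans (ltnW Nl)) //.
  by rewrite -mulnn leq_pmull // (leq_trans _ Nl).
apply: (@le_trans _ _ (((N - l) ^ l)%:R)); last first.
  rewrite ler_nat ffact_prod -[X in (_ ^ X)%N](card_ord l) -prod_nat_const.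
  by apply: leq_prod => i _; rewrite leq_sub2l // ltnW.
rewrite natrX natrB //.
have -> : (N%:R - l%:R) ^+ l = N%:R ^+ l * (1 + - (l%:R / N%:R)) ^+ l :> R.
  by rewrite -exprMn; congr (_ ^+ _); field; rewrite lt0r_neq0.
apply: ler_wpM2l; first exact: exprn_ge0.
have := @bernoulli R (- (l%:R / N%:R)) l.
rewrite lerN2 ler_pdivrMr // mul1r ler_nat => /(_ lN); apply: le_trans.
by apply: ler_of_eq; field; rewrite lt0r_neq0.
Qed.

(** Genuine cycles need distinct vertices, but traces are computable; non-injective tuples are a
    fraction of at most l^2/n of all tuples. *)
Lemma itrc_trc l : 1 <= W -> `|itrc l - trc w l| <= l%:R ^+ 2 * W ^+ l / n ^+ l.+1.
Proof.
move=> W1; have N0 : 0 < n by rewrite ltr0n.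
have W0 : 0 <= W := le_trans ler01 W1.
rewrite /trc (bigID (fun v : {ffun 'I_l -> V} => injectiveb v)) /= opprD addrA subrr sub0r normrN.
rewrite ger0_norm; last by apply: sumr_ge0 => v _; exact: prodr_ge0.
apply: (@le_trans _ _ (\sum_(v : {ffun 'I_l -> V} | ~~ injectiveb v) (W / n ^+ 2) ^+ l)).
  apply: ler_sum => v _; have -> : (W / n ^+ 2) ^+ l = \prod_(j < l) (W / n ^+ 2) by rewrite prodr_const card_ord.
  by apply: ler_prod => j _; rewrite w0 wW.
rewrite sumr_cst.
have -> : #|[pred v : {ffun 'I_l -> V} | ~~ injectiveb v]|%:R = n ^+ l - (#|V| ^_ l)%:R :> R.
  have e : (#|V| ^_ l + #|[pred v : {ffun 'I_l -> V} | ~~ injectiveb v]| = #|V| ^ l)%N.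
    have := cardsC [set f : {ffun 'I_l -> V} | injectiveb f]%SET.
    rewrite card_inj_ffuns card_ffun card_ord => <-; congr (_ + _)%N.
    by apply: eq_card => v; rewrite !inE.
  by rewrite -natrX -e natrD addrC addKr.
apply: (@le_trans _ _ (n ^+ l * (l%:R ^+ 2 / n) * (W / n ^+ 2) ^+ l)).
  apply: ler_wpM2r; first by rewrite exprn_ge0 // divr_ge0 // exprn_ge0.
  have := ffact_ge l n0; lra.
apply: ler_of_eq; rewrite expr_div_n -exprM mulnC exprM [n ^+ l.+1]exprS.
have : n ^+ l != 0 by rewrite expf_neq0 // lt0r_neq0.
move: (n ^+ l) (W ^+ l) => X Y X0; field; by rewrite X0 lt0r_neq0.
Qed.

End InjTrace.

Section CycleExpectation.
Variables (R : realType) (V : finType) (m La : nat) (w : V * V -> R).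
Hypothesis w0 : forall e, 0 <= w e.
Hypothesis w1 : \sum_e w e = 1.
Hypothesis wsym : forall x y, w (x, y) = w (y, x).
Local Notation Om := {ffun 'I_m -> V * V}.

Definition rooted a (al : {ffun 'I_a.+2 -> 'I_m}) : bool :=
  injectiveb al && [forall j, (al j <= al ord0)%N].

Lemma ordS_neq a (j : 'I_a.+2) : ordS j != j.
Proof.
rewrite -val_eqE /=; have := ltn_ord j; rewrite ltnS leq_eqVlt => /orP[/eqP ->|ja].
  by rewrite modnn.
by rewrite modn_small // neq_ltn ltnSn orbT.
Qed.

(** The power of 2 counts orientations of the [a.+1] edges other than the root. *)
Lemma pw_cyc_at a (al : {ffun 'I_a.+2 -> 'I_m}) (v : {ffun 'I_a.+2 -> V}) :
  injective al -> injective v ->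
  pw w (fun om : Om => (cyc_at al v om)%:R) = 2 ^+ a.+1 * \prod_j w (v j, v (ordS j)).
Proof.
move=> ial iv.
pose P (j : 'I_a.+2) (e : V * V) := (e == (v j, v (ordS j))) || ((j != ord0) && (e == (v (ordS j), v j))).
pose P' (i : 'I_m) (e : V * V) := [forall j, (al j == i) ==> P j e].
transitivity (pw w (fun om : Om => ([forall i in csupp al, P' i (om i)])%:R)).
  apply: eq_pw => om; congr (nat_of_bool _)%:R; apply/forallP/forall_inP => [H i _|H j].
    by apply/forallP => j; apply/implyP => /eqP <-; exact: H.
  by have /forallP/(_ j)/implyP := H _ (mem_csupp al j); apply.
rewrite pw_cylinder // /csupp big_imset /=; last by move=> x y _ _; exact: ial.
have e j : \sum_(e | P' (al j) e) w e = (if j == ord0 then 1 else 2) * w (v j, v (ordS j)).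
  have vj : v j != v (ordS j) by rewrite (inj_eq iv) eq_sym ordS_neq.
  rewrite (eq_bigl (P j)) => [|e]; last first.
    apply/forallP/idP => [/(_ j)|H i]; first by rewrite eqxx.
    by apply/implyP; rewrite (inj_eq ial) => /eqP ->.
  rewrite /P; case: eqP => [_|_] /=.
    by under eq_bigl do rewrite orbF; rewrite big_pred1_eq mul1r.
  rewrite (bigD1 (v j, v (ordS j))) ?eqxx //= (big_pred1 (v (ordS j), v j)) => [|e].
    by rewrite (wsym (v (ordS j))); ring.
  case: (eqVneq e (v j, v (ordS j))) => [->|ne]; rewrite /= ?andbT //.
  by rewrite xpair_eqE (negbTE vj).
under eq_bigr do rewrite e.
rewrite big_split /=; congr (_ * _); last by apply: eq_bigl => j; rewrite inE.
rewrite (bigD1 ord0) ?inE //= mul1r.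
rewrite (eq_bigr (fun=> 2)) => [|j /andP[_ /negbTE ->]] //.
rewrite prodr_const; congr (_ ^+ _).
rewrite -[RHS]/(a.+2.-1) -[in RHS](card_ord a.+2) -cardsT (cardsD1 ord0 setT) inE /=.
by rewrite add0n; apply: eq_card => j; rewrite [LHS]unfold_in !inE andbC.
Qed.

(** By [cyc_same_supp] at most one vertex sequence closes the given rooted tuple, so the events for
    different v are disjoint and their probabilities add up. *)
Lemma pw_cyc a (al : {ffun 'I_a.+2 -> 'I_m}) :
  pw w (fun om : Om => (cyc al om)%:R) =
  (rooted al)%:R * (2 ^+ a.+1 * itrc (fun x y => w (x, y)) a.+2).
Proof.
rewrite /cyc; case: (boolP (rooted al)) => [ral|nral]; last first.
  rewrite mul0r -[RHS](@pw_cst _ _ m w 0 w1); apply: eq_pw => om.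
  by rewrite andbA -/(rooted al) (negbTE nral).
have /andP[/injectiveP ial /forallP mal] := ral.
rewrite mul1r /itrc mulr_sumr.
under [RHS]eq_bigr => v /injectiveP iv do rewrite -(pw_cyc_at ial iv).
rewrite -pw_sum; apply: eq_pw => om; rewrite andbA -/(rooted al) ral /=.
case: existsP => [[v /andP[iv cv]]|H]; last first.
  by rewrite big1 // => v iv; case: (boolP (cyc_at al v om)) => // cv; case: H; exists v; rewrite iv.
rewrite (bigD1 v) //= cv big1 ?addr0 // => u /andP[iu uv].
case: (boolP (cyc_at al u om)) => // cu; case/eqP: uv.
have [_ ->] // := cyc_same_supp ial ial (injectiveP _ iu) (injectiveP _ iv) mal mal cu cv erefl.
Qed.

Definition nroot a : nat := #|[set al : {ffun 'I_a.+2 -> 'I_m} | rooted al]%SET|.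

Lemma lam_cycles (a : 'I_La) : lam w (@rty m La) (@rcyc V m La) a =
  (nroot a)%:R * (2 ^+ a.+1 * itrc (fun x y => w (x, y)) a.+2).
Proof.
rewrite lam_reps.
under eq_bigr do rewrite /pev /rcyc /= pw_cyc.
rewrite -mulr_suml; congr (_ * _); rewrite /nroot -sum1_card natr_sum [RHS]big_mkcond /=.
by apply: eq_bigr => al _; rewrite inE; case: ifP.
Qed.

End CycleExpectation.

Section RootedCount.
Variables (R : realType) (m a : nat).

Lemma nroot_le : (nroot m a <= m ^ a.+2)%N.
Proof. by rewrite (leq_trans (max_card _)) // card_ffun !card_ord. Qed.

(** The root t is the largest index and the others lie below it. The sum over t is left unevaluated
    because [exponent_bound] compares its terms with the contributions of the single edges t. *)
Lemma nroot_ge : (\sum_(t < m) t ^_ a.+1 <= nroot m a)%N.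
Proof.
have -> : nroot m a = (\sum_(t < m) \sum_(u : {ffun 'I_a.+1 -> 'I_m}) rooted (fcons t u))%N.
  rewrite /nroot -sum1_card big_mkcond /=.
  rewrite (eq_bigr (fun al => nat_of_bool (rooted al))) => [|al _]; last by rewrite inE; case: ifP.
  exact: (@sum_fcons 'I_m nat a.+1 (fun al => nat_of_bool (rooted al))).
apply: leq_sum => t _.
pose D := [set s : 'I_m | (s < t)%N]%SET.
have tD : (t <= #|D|)%N.
  have i : injective (widen_ord (ltnW (ltn_ord t))) by move=> x y e; apply: val_inj; exact: (congr1 val e).
  rewrite -{1}(card_ord t) -(card_imset _ i); apply: subset_leq_card.
  by apply/fintype.subsetP => _ /imsetP[s _ ->]; rewrite inE /=.
apply: (@leq_trans #|[set f : {ffun 'I_a.+1 -> 'I_m} in ffun_on (mem D) | injectiveb f]%SET|).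
  rewrite card_inj_ffuns_on card_ord !ffact_prod.
  by apply: leq_prod => i _; exact: leq_sub2r.
rewrite -sum1_card big_mkcond /=; apply: leq_sum => u _; rewrite inE.
case: andP => // -[/ffun_onP uD /injectiveP iu].
suff -> : rooted (fcons t u) by [].
have ut j : (u j < t)%N by have := uD j; rewrite inE.
apply/andP; split; last first.
  apply/forallP => j; rewrite fcons0; case: (unliftP ord0 j) => [i ->|->]; last by rewrite fcons0.
  by rewrite fconsS ltnW.
apply/injectiveP => i j.
case: (unliftP ord0 i) => [i' ->|->]; case: (unliftP ord0 j) => [j' ->|->]; rewrite ?fcons0 ?fconsS //.
- by move=> /iu ->.
- by move=> e; have := ut i'; rewrite e ltnn.
- by move=> e; have := ut j'; rewrite -e ltnn.
Qed.

End RootedCount.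

(** * Edge kernels tilted by one or two colorings *)

Definition delt (R : realType) (K : R) l : R := (K - 1) * (- (K - 1)^-1) ^+ l.

Section Kernel.
Variables (R : realType) (V C : finType) (t : V -> C) (g : nat).
Hypothesis n0 : (0 < #|V|)%N.
Hypothesis fibg : forall c, #|[set x | t x == c]%SET| = g.
Local Notation n := (#|V|%:R : R).

Lemma card_fibers : #|V| = (#|C| * g)%N.
Proof.
rewrite -sum1_card (partition_big t xpredT) //= -sum_nat_const; apply: eq_bigr => c _.
by rewrite sum1_card -(fibg c) cardsE.
Qed.

(** The uniform law on ordered pairs of different types. With [t = id] and [g = 1] it is the base
    law on pairs of distinct vertices; with a balanced coloring it is the law tilted by that
    coloring. *)
Definition kerw (e : V * V) : R := (t e.1 != t e.2)%:R / (n * (n - g%:R)).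

Lemma sum_bichromatic : \sum_(e : V * V) (t e.1 != t e.2)%:R = n * (n - g%:R).
Proof.
rewrite -(pair_bigA _ (fun x y => (t x != t y)%:R)) /= -sumr_cst; apply: eq_bigr => x _.
rewrite -(fibg (t x)) -!sum1_card !natr_sum [X in _ - X]big_mkcond -sumrB.
by apply: eq_bigr => y _; rewrite inE eq_sym; case: eqP => _; rewrite ?subrr ?subr0.
Qed.

Hypothesis C2 : (1 < #|C|)%N.

Let g0 : (0 < g)%N. Proof. by move: n0; rewrite card_fibers muln_gt0 => /andP[]. Qed.
Let nE : n = #|C|%:R * g%:R. Proof. by rewrite card_fibers natrM. Qed.
Let K1 : 0 < #|C|%:R - 1 :> R. Proof. by rewrite subr_gt0 ltr1n. Qed.
Let G0 : 0 < g%:R :> R. Proof. by rewrite ltr0n. Qed.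
Let N0 : 0 < n. Proof. by rewrite ltr0n. Qed.

Lemma kerw_z_ge : n ^+ 2 / 2 <= n * (n - g%:R).
Proof.
rewrite expr2 -mulrA ler_pM2l //.
have : 2 * g%:R <= n by rewrite nE ler_pM2r // ler_nat.
lra.
Qed.

Lemma kerw_ge0 e : 0 <= kerw e.
Proof. by rewrite divr_ge0 // (le_trans _ kerw_z_ge) // divr_ge0 // sqr_ge0. Qed.

Lemma kerw_le e : kerw e <= 4 / n ^+ 2.
Proof.
have z0 : 0 < n ^+ 2 / 2 by rewrite divr_gt0 // exprn_gt0.
have z1 := lt_le_trans z0 kerw_z_ge.
apply: (@le_trans _ _ (1 / (n * (n - g%:R)))).
  by apply: ler_wpM2r; [rewrite invr_ge0 ltW|rewrite lern1 leq_b1].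
rewrite div1r (le_trans _ (_ : (n ^+ 2 / 2)^-1 <= _)) ?lef_pV2 ?posrE ?kerw_z_ge //.
by rewrite invf_div ler_pM2r ?invr_gt0 ?exprn_gt0 // ler_nat.
Qed.

Lemma kerw_sum : \sum_e kerw e = 1.
Proof.
rewrite -mulr_suml sum_bichromatic mulfV //; apply: lt0r_neq0.
by apply: lt_le_trans kerw_z_ge; rewrite divr_gt0 // exprn_gt0.
Qed.

Lemma kerw_sym x y : kerw (x, y) = kerw (y, x).
Proof. by rewrite /kerw /= eq_sym. Qed.

(** With equal classes the rescaled trace counts properly colored closed walks in the complete graph
    on C, relative to its degree: the eigenvalue ratios are 1 and, K - 1 times, [-1 / (K - 1)]. *)
Lemma kerw_itrc a : `|n ^+ a.+2 * itrc (fun x y => kerw (x, y)) a.+2 - (1 + delt #|C|%:R a.+2)| <=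
  a.+2%:R ^+ 2 * 4 ^+ a.+2 / n.
Proof.
have X0 : n ^+ a.+2 != 0 by rewrite expf_neq0 // lt0r_neq0.
have -> : 1 + delt #|C|%:R a.+2 = n ^+ a.+2 * trc (fun x y => kerw (x, y)) a.+2.
  rewrite (@type_trace R V C t (fun c d => (c != d)%:R / (n * (n - g%:R)))).
  under eq_bigr => c _.
    rewrite big_split /= prodr_const card_ord.
    have -> : \prod_j fib R t (c j) = g%:R ^+ a.+2.
      rewrite -[in RHS](card_ord a.+2) -prodr_const; apply: eq_bigr => j _; by rewrite /fib fibg.
    over.
  rewrite -mulr_sumr -mulr_suml -/(ccol R C a.+2) cycle_colorings.
  have -> : n - g%:R = (#|C|%:R - 1) * g%:R by rewrite nE; ring.
  rewrite /delt [(- (#|C|%:R - 1)^-1) ^+ _]exprNn !exprVn !exprMn.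
  have G' : g%:R ^+ a.+2 != 0 :> R by rewrite expf_neq0 // lt0r_neq0.
  have K' : (#|C|%:R - 1 : R) ^+ a.+2 != 0 by rewrite expf_neq0 // lt0r_neq0.
  move: (n ^+ _) (g%:R ^+ _) ((#|C|%:R - 1 : R) ^+ _) ((-1) ^+ _) X0 G' K' => X G K' s X0 G' K''.
  by field; rewrite X0 G' K''.
rewrite -mulrBr normrM ger0_norm ?exprn_ge0 //.
have := @itrc_trc R V 4 (fun x y => kerw (x, y)) n0 (fun x y => kerw_ge0 _) (fun x y => kerw_le _) a.+2.
rewrite ler1n => /(_ isT) H; apply: (le_trans (ler_wpM2l (exprn_ge0 _ _) H)) => //.
by apply: ler_of_eq; rewrite [n ^+ a.+3]exprS; field; rewrite X0 lt0r_neq0.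
Qed.

End Kernel.

Section PairKernel.
Variables (R : realType) (k h : nat) (V : finType).
Hypothesis cV : #|V| = (k * h)%N.
Hypothesis k2 : (1 < k)%N.
Hypothesis h0 : (0 < h)%N.
Local Notation col := {ffun V -> 'I_k}.
Variables sigma tau : col.
Hypothesis sb : sigma \in bal k h V.
Hypothesis tb : tau \in bal k h V.
Local Notation n := ((k * h)%:R : R).
Local Notation Q := (sqovl R sigma tau).
Local Notation S := (ovl R sigma [set: V]%SET tau).
Local Notation s := (sn R k h).
Local Notation q := (1 - k%:R^-1 : R).

Let K0 : 0 < k%:R :> R. Proof. by rewrite ltr0n ltnW. Qed.
Let H0 : 0 < h%:R :> R. Proof. by rewrite ltr0n. Qed.
Let N0 : 0 < n. Proof. by rewrite natrM mulr_gt0. Qed.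
Let nV : #|V|%:R = n. Proof. by rewrite cV. Qed.

Definition ker2 (e : V * V) : R :=
  ((sigma e.1 != sigma e.2) && (tau e.1 != tau e.2))%:R / (s + Q).

Lemma sn_gt0 : 0 < s.
Proof. by apply: lt_le_trans (sn_ge R h k2); rewrite divr_gt0 // exprn_gt0. Qed.

Lemma snQ_gt0 : 0 < s + Q.
Proof. by rewrite ltr_wpDr ?sn_gt0 // sqovl_ge0. Qed.

Lemma fib_pair (c : 'I_k * 'I_k) : fib R (fun x => (sigma x, tau x)) c = S c.1 c.2 + h%:R / k%:R.
Proof.
case: c => i j; rewrite /ovl sumrB /=.
have -> : \sum_(x in [set: V]%SET | sigma x == i) (k%:R : R)^-1 = h%:R / k%:R.
  rewrite sumr_cst; congr (_%:R * _); rewrite -[RHS](elimT (balP _ _) sb i).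
  by apply: eq_card => x; rewrite [LHS]unfold_in !inE.
rewrite subrK /fib -sum1_card natr_sum [LHS]big_mkcond [RHS]big_mkcond; apply: eq_bigr => x _.
rewrite !inE /= xpair_eqE; by case: (sigma x == i); case: (tau x == j).
Qed.

Lemma sum_ovl0 : \sum_i \sum_j S i j = 0.
Proof.
by rewrite big1 // => i _; apply: ovl_row; rewrite ltnW.
Qed.

(** Inclusion-exclusion: balance fixes the pairs monochromatic in one coloring, and those
    monochromatic in both are counted by the squared joint class sizes, that is by [Q + h^2]. *)
Lemma sum_bichromatic2 :
  \sum_(e : V * V) ((sigma e.1 != sigma e.2) && (tau e.1 != tau e.2))%:R = s + Q.
Proof.
have b1 (f : col) : f \in bal k h V -> \sum_(e : V * V) (f e.1 == f e.2)%:R = n * h%:R.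
  move=> /balP fb; rewrite -(pair_bigA _ (fun x y => (f x == f y)%:R)) /= -nV -sumr_cst.
  apply: eq_bigr => x _; rewrite -(fb (f x)) -sum1_card natr_sum [RHS]big_mkcond /=.
  by apply: eq_bigr => y _; rewrite inE eq_sym; case: eqP.
have b2 : \sum_(e : V * V) ((sigma e.1 == sigma e.2) && (tau e.1 == tau e.2))%:R = Q + h%:R ^+ 2.
  pose t x := (sigma x, tau x).
  transitivity (\sum_c fib R t c ^+ 2).
    rewrite -(pair_bigA _ (fun x y => ((sigma x == sigma y) && (tau x == tau y))%:R)) /=.
    rewrite (partition_big t xpredT) //=; apply: eq_bigr => c _.
    rewrite expr2 {1}/fib -sum1_card natr_sum mulr_suml [LHS]big_mkcond [RHS]big_mkcond.
    apply: eq_bigr => x _; rewrite inE; case: eqP => // <-; rewrite mul1r.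
    rewrite /fib -sum1_card natr_sum [RHS]big_mkcond; apply: eq_bigr => y _.
    by rewrite inE /t xpair_eqE (eq_sym (sigma y)) (eq_sym (tau y)); case: (_ && _).
  under eq_bigr do rewrite fib_pair sqrrD.
  rewrite -(pair_bigA _ (fun i j => S i j ^+ 2 + S i j * (h%:R / k%:R) *+ 2 + (h%:R / k%:R) ^+ 2)) /=.
  under eq_bigr do rewrite 2!big_split /=.
  rewrite 2!big_split /= -/Q.
  have -> : \sum_i \sum_j S i j * (h%:R / k%:R) *+ 2 = 0.
    transitivity ((\sum_i \sum_j S i j) * (h%:R / k%:R) *+ 2).
      rewrite mulr_suml -sumrMnl; apply: eq_bigr => i _.
      by rewrite mulr_suml -sumrMnl.
    by rewrite sum_ovl0 mul0r mul0rn.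
  rewrite addr0 !sumr_cst card_ord; congr (_ + _); field; by rewrite lt0r_neq0.
have -> : s = n ^+ 2 - n * h%:R - n * h%:R + h%:R ^+ 2.
  by rewrite /sn natrM; field; rewrite lt0r_neq0.
rewrite -addrA [h%:R ^+ 2 + Q]addrC -b2 -{1}(b1 _ sb) -(b1 _ tb).
have -> : n ^+ 2 = \sum_(e : V * V) 1 by rewrite sumr_cst card_prod cV mulr1 -natrX mulnn.
rewrite -!sumrB -big_split /=; apply: eq_bigr => e _.
by case: (sigma e.1 == sigma e.2); case: (tau e.1 == tau e.2); rewrite /=; ring.
Qed.

Lemma ker2_ge0 e : 0 <= ker2 e.
Proof. by rewrite divr_ge0 // ltW // snQ_gt0. Qed.

Lemma ker2_le e : ker2 e <= 4 / #|V|%:R ^+ 2.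
Proof.
rewrite nV; apply: (@le_trans _ _ (1 / (s + Q))).
  by apply: ler_wpM2r; [rewrite invr_ge0 ltW // snQ_gt0|rewrite lern1 leq_b1].
rewrite div1r -[4 / _]invf_div lef_pV2 ?posrE ?snQ_gt0 ?divr_gt0 ?exprn_gt0 //.
by apply: le_trans (sn_ge R h k2) _; rewrite lerDl sqovl_ge0.
Qed.

Lemma ker2_sum : \sum_e ker2 e = 1.
Proof. by rewrite -mulr_suml sum_bichromatic2 mulfV // lt0r_neq0 // snQ_gt0. Qed.

Lemma ker2_sym x y : ker2 (x, y) = ker2 (y, x).
Proof. by rewrite /ker2 /= (eq_sym (sigma x)) (eq_sym (tau x)). Qed.

Let q0 : 0 < q. Proof. by rewrite subr_gt0 invf_lt1 ?ltr1n. Qed.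
Let K1 : 0 < k%:R - 1 :> R. Proof. by rewrite subr_gt0 ltr1n. Qed.

Lemma ker2_trc_expand l : n ^+ l * trc (fun x y => ker2 (x, y)) l =
  (s / (s + Q)) ^+ l * (q ^+ 2) ^- l * \sum_(c : {ffun 'I_l -> 'I_k * 'I_k})
   (\prod_j (fib R (fun x => (sigma x, tau x)) (c j) / n)) *
   \prod_j (((c j).1 != (c (ordS j)).1) && ((c j).2 != (c (ordS j)).2))%:R.
Proof.
rewrite (@type_trace R V _ (fun x => (sigma x, tau x))
  (fun c d => ((c.1 != d.1) && (c.2 != d.2))%:R / (s + Q))) !mulr_sumr.
apply: eq_bigr => c _; rewrite !big_split /= !prodr_const !card_ord.
rewrite -!exprVn /sn.
move: (\prod_(j < l) fib R _ (c j)) (\prod_(i < l) (_ && _)%:R) => A B.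
have -> : s / (s + Q) = n * (q ^+ 2 * n) * (s + Q)^-1 by rewrite {1}/sn; ring.
have := snQ_gt0; rewrite {2}/sn; move: (s + Q) => Z Z0.
rewrite !exprMn !exprVn.
have nn : n ^+ l != 0 by rewrite expf_neq0 // lt0r_neq0.
have qq : q ^+ l != 0 by rewrite expf_neq0 // lt0r_neq0.
have zz : Z ^+ l != 0 by rewrite expf_neq0 // lt0r_neq0.
move: (n ^+ l) (q ^+ l) (Z ^+ l) nn qq zz => n' q' z' nn qq zz.
by field; rewrite nn qq zz.
Qed.

Lemma delt_ccol l : (1 + delt k%:R l.+1) ^+ 2 =
  (q ^+ 2) ^- l.+1 * ((k%:R ^+ 2) ^- l.+1 * ccol R 'I_k l.+1 ^+ 2).
Proof.
rewrite cycle_colorings card_ord /delt [(- (k%:R - 1)^-1) ^+ _]exprNn exprVn.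
have -> : q = (k%:R - 1) / k%:R by field; rewrite lt0r_neq0.
have kk : (k%:R : R) ^+ l.+1 != 0 by rewrite expf_neq0 // lt0r_neq0.
have KK : (k%:R - 1 : R) ^+ l.+1 != 0 by rewrite expf_neq0 // lt0r_neq0.
rewrite -!exprM ![(2 * _)%N]mulnC !exprM expr_div_n.
move: (k%:R ^+ l.+1) ((k%:R - 1 : R) ^+ l.+1) ((-1) ^+ l.+1) kk KK => A B c A0 B0.
by field; rewrite A0 B0.
Qed.

(** At Q = 0 all joint classes have relative size 1/k^2 and the trace factors into two
    single-coloring traces. For small Q each relative size moves by at most e and the normalisation
    by at most 4 e. *)
Lemma ker2_trc l (e : R) : Q <= (e * n) ^+ 2 -> 0 <= e <= 1 ->
  `|n ^+ l.+1 * trc (fun x y => ker2 (x, y)) l.+1 - (1 + delt k%:R l.+1) ^+ 2| <=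
  4 ^+ l.+1 * (l.+1%:R * ((k%:R ^+ 2) ^+ l.+1 + 4) * e).
Proof.
move=> Qe /andP[e0 e1].
rewrite ker2_trc_expand delt_ccol.
set y := s / (s + Q); set P := (q ^+ 2) ^- l.+1; set A := \sum_c _; set B := _ * ccol _ _ _ ^+ 2.
have s0 := sn_gt0; have sQ0 := snQ_gt0; have Q0 := sqovl_ge0 R sigma tau.
have y0 : 0 <= y by rewrite divr_ge0 // ltW.
have y1 : y <= 1 by rewrite ler_pdivrMr // mul1r lerDl.
have BE : B = \sum_(c : {ffun 'I_l.+1 -> 'I_k * 'I_k}) (\prod_(j < l.+1) (k%:R ^+ 2)^-1) *
   \prod_j (((c j).1 != (c (ordS j)).1) && ((c j).2 != (c (ordS j)).2))%:R.
  by rewrite -mulr_sumr ccol2 prodr_const card_ord exprVn.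
have ki : 0 <= (k%:R ^+ 2 : R)^-1 <= 1.
  rewrite invr_ge0 sqr_ge0 /= invf_le1 ?exprn_gt0 // exprn_ege1 // ler1n ltnW //.
have kn : (k%:R ^+ 2)^-1 = h%:R / k%:R / n :> R.
  by rewrite natrM; field; rewrite !lt0r_neq0.
have fi c : 0 <= fib R (fun x => (sigma x, tau x)) c / n <= 1.
  rewrite /fib divr_ge0 //= ler_pdivrMr // mul1r -cV ler_nat; exact: max_card.
have fd c : `|fib R (fun x => (sigma x, tau x)) c / n - (k%:R ^+ 2)^-1| <= e.
  rewrite fib_pair kn -mulrBl addrK normrM normfV (gtr0_norm N0) ler_pdivrMr //.
  apply: le_trans (ovl_le_sqrt R sigma tau c.1 c.2) _.
  by rewrite -[X in _ <= X]ger0_norm ?(mulr_ge0 e0 (ltW N0)) // -sqrtr_sqr ler_wsqrtr.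
have AB : `|A - B| <= (k%:R ^+ 2) ^+ l.+1 * (l.+1%:R * e).
  rewrite BE -sumrB; apply: le_trans (ler_norm_sum _ _ _) _.
  apply: (@le_trans _ _ (\sum_(c : {ffun 'I_l.+1 -> 'I_k * 'I_k}) l.+1%:R * e)).
    apply: ler_sum => c _; rewrite -mulrBl normrM.
    have b0 : 0 <= (\prod_j (((c j).1 != (c (ordS j)).1) && ((c j).2 != (c (ordS j)).2))%:R : R) <= 1.
      rewrite prodr_ge0 //= -[X in _ <= X](big1_eq (op := *%R) (idx := 1) (index_enum 'I_l.+1) xpredT).
      by apply: ler_prod => j _; rewrite ler0n lern1 leq_b1.
    case/andP: b0 => b0 b1; rewrite (ger0_norm b0).
    apply: (@le_trans _ _ (\sum_(j < l.+1) e)); last by rewrite sumr_cst card_ord.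
    apply: (@le_trans _ _ (\sum_j `|fib R (fun x => (sigma x, tau x)) (c j) / n - (k%:R ^+ 2)^-1|)).
      rewrite -[X in _ <= X]mulr1; apply: ler_pM => //; exact: prod_diff_le.
    by apply: ler_sum => j _; exact: fd.
  by rewrite sumr_cst card_ffun card_prod !card_ord natrX natrM -expr2.
have B01 : 0 <= B <= 1.
  rewrite mulr_ge0 ?sqr_ge0 ?invr_ge0 ?exprn_ge0 ?sqr_ge0 //= /B mulrC ler_pdivrMr ?mul1r ?exprn_gt0 //.
  rewrite -exprM mulnC exprM; apply: lerXn2r; rewrite ?nnegrE ?exprn_ge0 //.
    by apply: sumr_ge0 => c _; exact: prodr_ge0.
  apply: (@le_trans _ _ (\sum_(c : {ffun 'I_l.+1 -> 'I_k}) 1)).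
    apply: ler_sum => c _; rewrite -[X in _ <= X](big1_eq (op := *%R) (idx := 1) (index_enum 'I_l.+1) xpredT).
    by apply: ler_prod => j _; rewrite ler0n lern1 leq_b1.
  by rewrite sumr_cst mulr1 card_ffun !card_ord natrX.
case/andP: B01 => B0 B1.
have P0 : 0 <= P by rewrite invr_ge0 exprn_ge0 ?sqr_ge0.
have P4 : P <= 4 ^+ l.+1.
  rewrite /P -exprVn; apply: lerXn2r; rewrite ?nnegrE ?invr_ge0 ?sqr_ge0 //.
  have : k%:R^-1 <= 2^-1 :> R by rewrite lef_pV2 ?posrE // ler_nat.
  move=> kh; rewrite invf_ple ?posrE ?exprn_gt0 //.
  have : 1 / 2 <= q by lra.
  nra.
have yl0 : 0 <= y ^+ l.+1 by rewrite exprn_ge0.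
have yl1 : y ^+ l.+1 <= 1 by rewrite exprn_ile1.
have yl : 1 - y ^+ l.+1 <= l.+1%:R * (4 * e).
  have := @bernoulli R (y - 1) l.+1; rewrite subrKC lerDr => /(_ y0) b.
  have : 1 - y <= 4 * e.
    have -> : 1 - y = Q / (s + Q) by rewrite /y; field; rewrite lt0r_neq0.
    rewrite ler_pdivrMr //.
    have := sn_ge R h k2 => sg; have : Q <= e * n ^+ 2.
      apply: le_trans Qe _; rewrite exprMn; apply: ler_wpM2r; first by rewrite sqr_ge0.
      by rewrite expr2 ler_piMr.
    have : e * (n ^+ 2 / 4) <= e * (s + Q) by apply: ler_wpM2l => //; lra.
    lra.
  move=> y4; have : l.+1%:R * (1 - y) <= l.+1%:R * (4 * e) by rewrite ler_wpM2l.
  lra.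
have -> : y ^+ l.+1 * P * A - P * B = P * (y ^+ l.+1 * (A - B) - B * (1 - y ^+ l.+1)) by ring.
rewrite normrM (ger0_norm P0); apply: ler_pM => //.
apply: le_trans (ler_normB _ _) _; rewrite (normrM (y ^+ l.+1)) (normrM B) (ger0_norm yl0) (ger0_norm B0).
rewrite [`|1 - _|]ger0_norm ?subr_ge0 //.
have t1 : y ^+ l.+1 * `|A - B| <= (k%:R ^+ 2) ^+ l.+1 * (l.+1%:R * e).
  by apply: le_trans AB; rewrite ler_piMl.
have t2 : B * (1 - y ^+ l.+1) <= l.+1%:R * (4 * e).
  by apply: le_trans yl; rewrite ler_piMl // subr_ge0.
apply: le_trans (lerD t1 t2) _; apply: ler_of_eq; ring.
Qed.

Lemma ker2_itrc a (e : R) : Q <= (e * n) ^+ 2 -> 0 <= e <= 1 ->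
  `|#|V|%:R ^+ a.+2 * itrc (fun x y => ker2 (x, y)) a.+2 - (1 + delt k%:R a.+2) ^+ 2| <=
  4 ^+ a.+2 * (a.+2%:R * ((k%:R ^+ 2) ^+ a.+2 + 4) * e) + a.+2%:R ^+ 2 * 4 ^+ a.+2 / n.
Proof.
move=> Qe e01; rewrite nV.
have X0 : n ^+ a.+2 != 0 by rewrite expf_neq0 // lt0r_neq0.
have cV0 : (0 < #|V|)%N by rewrite cV muln_gt0 h0 ltnW.
have := @itrc_trc R V 4 (fun x y => ker2 (x, y)) cV0 (fun x y => ker2_ge0 _) (fun x y => ker2_le _) a.+2.
rewrite ler1n nV => /(_ isT) H1; have H2 := ker2_trc a.+1 Qe e01.
rewrite -(subrKA (n ^+ a.+2 * trc (fun x y => ker2 (x, y)) a.+2)) addrC.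
apply: le_trans (ler_normD _ _) _; apply: lerD => //.
rewrite -mulrBr normrM ger0_norm; last by rewrite exprn_ge0 // ltW.
apply: (le_trans (ler_wpM2l (exprn_ge0 _ _) H1)); first exact: ltW.
apply: ler_of_eq; rewrite [n ^+ a.+3]exprS; move: (n) (lt0r_neq0 N0) X0 => N N0' X0.
by field; rewrite X0 N0'.
Qed.

End PairKernel.

Lemma pw_bool_le1 (R : realType) (E : finType) (m : nat) (w : E -> R) (P : pred {ffun 'I_m -> E}) :
  (forall e, 0 <= w e) -> \sum_e w e = 1 -> 0 <= pw w (fun om => (P om)%:R) <= 1.
Proof.
move=> w0 w1; rewrite pw_ge0 //=.
by rewrite -[X in _ <= X](@pw_cst _ _ m w 1 w1); apply: ler_pw => // om; rewrite lern1 leq_b1.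
Qed.

Lemma nat_gt_div (R : realType) (C b : R) : 0 < b ->
  exists n0 : nat, (0 < n0)%N /\ forall n : nat, (n0 <= n)%N -> C / n%:R <= b.
Proof.
move=> b0; exists (Num.truncn (C / b)).+1; split => // n hn.
have n0 : 0 < n%:R :> R by rewrite ltr0n (leq_trans _ hn).
rewrite ler_pdivrMr // mulrC -ler_pdivrMr //; apply: ltW.
by apply: lt_le_trans (truncnS_gt _) _; rewrite ler_nat.
Qed.

(** All thresholds precede V, m, w and L: the same approximation is used for the base law and
    simultaneously for all its tilts. *)
Lemma cycle_poisson (R : realType) (T B e : R) (La N : nat) : 0 <= T -> 0 <= B -> 0 < e ->
  exists2 b : R, 0 < b & exists n0 : nat,
  forall (V : finType) (m : nat) (w : V * V -> R) (L : 'I_La -> R), (n0 <= #|V|)%N ->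
    (forall e, 0 <= w e) -> \sum_e w e = 1 -> (forall e, w e <= 4 / #|V|%:R ^+ 2) ->
    m%:R <= T * #|V|%:R -> (forall a, 0 <= L a <= B) ->
    (forall a, `|lam w (@rty m La) (@rcyc V m La) a - L a| <= b) ->
    forall c : {ffun 'I_La -> nat}, (forall a, (c a <= N)%N) ->
    `|pat w (@rty m La) (@rcyc V m La) c - pois L c| <= e.
Proof.
move=> T0 B0 e0.
(* [poisson_approx] wants one constant for the limiting means and for the tail of the counts, so the
   bound on the actual means is added to B. *)
pose B1 := Kc 4 La * (La.+2%:R + T) ^+ La.+2.
have B10 : 0 <= B1.
  by rewrite mulr_ge0 ?exprn_ge0 ?mulr_ge0 ?exprn_ge0 // addr_ge0.
have BB : 0 <= B + B1 by rewrite addr_ge0.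
have [b0 b00 H] := @poisson_approx R 'I_La (B + B1) e N BB e0.
have b2 : 0 < b0 / 2 by rewrite divr_gt0.
exists (b0 / 2) => //.
have [n0 [n00 Hn]] := nat_gt_div (2 * (Kc 4 La ^+ 2 * Cr T La ^+ 2)) b2.
exists n0 => V m w L nV w0 w1 wW mT LB Lb c cN.
have V0 : (0 < #|V|)%N by exact: leq_trans nV.
have W1 : 1 <= 4 :> R by rewrite ler1n.
have pat1 c' := @pw_bool_le1 R _ m w (nev_at (@rty m La) (@rcyc V m La) c') w0 w1.
apply: H cN => [a|c'|c' a ca|M].
- by have /andP[-> La1] /= := LB a; apply: le_trans La1 _; rewrite lerDl.
- by case/andP: (pat1 c').
- have sc := @stein_chen R _ m w w0 w1 _ _ (@rty m La) (@rcyc V m La) (@rsp m La) (@rcyc_dep V m La) c' a ca (@rsp_neq0 m La).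
  have db := @dep_bound R V m w 4 T La w0 w1 V0 wW W1 mT.
  have h1 := le_trans sc (le_trans db (Hn _ nV)).
  set p := pat _ _ _ _ in h1 *; set p' := pat _ _ _ (decr _ _) in h1 *.
  have -> : (c' a)%:R * p - L a * p' =
     ((c' a)%:R * p - lam w (@rty m La) (@rcyc V m La) a * p') + (lam w (@rty m La) (@rcyc V m La) a - L a) * p' by ring.
  apply: le_trans (ler_normD _ _) _; rewrite [b0]splitr; apply: lerD => //.
  have /andP[p0 p1] := pat1 (decr c' a).
  by rewrite normrM (ger0_norm p0) -[X in _ <= X]mulr1; apply: ler_pM => //; exact: Lb.
- have /andP[h1 h2] := @box_mass R _ m w w0 w1 _ _ (@rty m La) (@rcyc V m La) M.
  rewrite h2 andbT; apply: le_trans h1; rewrite lerD2l lerN2; apply: ler_wpM2r; first by rewrite invr_ge0.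
  rewrite -sumr_cst; apply: ler_sum => a _; apply: le_trans (@lam_bound R V m w 4 T La w0 w1 V0 wW W1 mT a) _.
  by rewrite -/B1 lerDr.
Qed.

(** * Cycle means against the exponent of the second moment *)

Section Means.
Variables (R : realType) (k : nat) (T : R) (La : nat).
Hypothesis k3 : (2 < k)%N.
Hypothesis T0 : 0 <= T.

(** About [(2m/n)^l / (2l)] with [l = a.+2], kept in exact finite form so that it can be matched
    term by term with the sum over edges. *)
Definition mu (n m a : nat) : R := (nroot m a)%:R * 2 ^+ a.+1 / n%:R ^+ a.+2.
Definition dl (a : nat) : R := delt (k%:R : R) a.+2.
Definition Bm : R := (2 * T + 1) ^+ La.+2.

Lemma mu_bounds n m (a : 'I_La) : (0 < n)%N -> m%:R <= T * n%:R -> 0 <= mu n m a <= Bm.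
Proof.
move=> n0 mT; have N0 : 0 < n%:R :> R by rewrite ltr0n.
apply/andP; split; first by rewrite /mu divr_ge0 ?exprn_ge0 // mulr_ge0 ?exprn_ge0.
rewrite /mu ler_pdivrMr ?exprn_gt0 //.
apply: (@le_trans _ _ ((2 * T * n%:R) ^+ a.+2)).
  apply: (@le_trans _ _ (m%:R ^+ a.+2 * 2 ^+ a.+2)).
    apply: ler_pM; rewrite ?exprn_ge0 //; first by rewrite -natrX ler_nat nroot_le.
    by rewrite ler_eXn2l // ltr1n.
  rewrite -exprMn; apply: lerXn2r; rewrite ?nnegrE ?mulr_ge0 //; lra.
rewrite exprMn; apply: ler_wpM2r; first by rewrite exprn_ge0.
apply: (@le_trans _ _ ((2 * T + 1) ^+ a.+2)).
  by apply: lerXn2r; rewrite ?nnegrE ?addr_ge0 ?mulr_ge0 // lerDl.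
by apply: ler_weXn2l; [rewrite lerDr mulr_ge0|rewrite !ltnS ltnW].
Qed.

Lemma delt_le (K : R) (a : nat) : 2 <= K -> `|delt K a.+2| <= (K - 1)^-1.
Proof.
move=> K2; have K1 : 0 < K - 1 by lra.
rewrite /delt normrM normrX normrN normfV (gtr0_norm K1) exprS mulrA mulfV ?lt0r_neq0 // mul1r exprS.
rewrite ger_pMr ?invr_gt0 // exprn_ile1 ?invr_ge0 ?(ltW K1) // invf_le1 //; lra.
Qed.

Lemma dl_le a : `|dl a| <= 1 / 2.
Proof.
have K3 : 3 <= k%:R :> R by rewrite ler_nat.
have K2 : 2 <= k%:R :> R by lra.
apply: le_trans (delt_le a K2) _; rewrite div1r lef_pV2 ?posrE; lra.
Qed.

Lemma dl_sqr a : dl a ^+ 2 = ((k%:R - 1) ^+ 2) ^- a.+1.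
Proof.
have K1 : k%:R - 1 != 0 :> R by rewrite subr_eq0 pnatr_eq1; case: k k3 => [|[]].
rewrite /dl /delt exprNn mulrCA exprMn sqrr_sign mul1r [(k%:R - 1)^-1 ^+ _]exprS mulrA mulfV // mul1r.
by rewrite -[LHS]exprM exprVn; congr (_ ^-1); rewrite mulnC exprM.
Qed.

Lemma lam_mu (V : finType) m (w : V * V -> R) (a : 'I_La) (th e : R) :
  (0 < #|V|)%N -> (forall e, 0 <= w e) -> \sum_e w e = 1 -> (forall x y, w (x, y) = w (y, x)) ->
  m%:R <= T * #|V|%:R ->
  `|#|V|%:R ^+ a.+2 * itrc (fun x y => w (x, y)) a.+2 - th| <= e ->
  `|lam w (@rty m La) (@rcyc V m La) a - mu #|V| m a * th| <= Bm * e.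
Proof.
move=> V0 w0 w1 ws mT He; have /andP[m0 m1] := mu_bounds a V0 mT.
have -> : lam w (@rty m La) (@rcyc V m La) a - mu #|V| m a * th =
    mu #|V| m a * (#|V|%:R ^+ a.+2 * itrc (fun x y => w (x, y)) a.+2 - th).
  rewrite lam_cycles // /mu; field.
  by rewrite expf_neq0 // pnatr_eq0 -lt0n.
by rewrite normrM (ger0_norm m0); apply: ler_pM.
Qed.

(** Expanding [1 / (1 - x_t)] geometrically, the constant terms cancel [m / n], the power [a.+1]
    summed over t is essentially [mu a * dl a ^+ 2], and [x_t <= 1/2] makes the tail beyond La at
    most [2 ^- La] per edge. The error in 1/n comes from falling factorials replacing powers of
    t. *)
Lemma exponent_bound n m : (0 < n)%N -> m%:R <= T * n%:R -> 2 * T / (k%:R - 1) ^+ 2 <= 1 / 2 ->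
  - (m%:R / n%:R) + \sum_(t < m) (n%:R * (1 - 2 * t%:R / (n%:R * (k%:R - 1) ^+ 2)))^-1
    - \sum_(a < La) mu n m a * dl a ^+ 2 <= T * (2 ^- La + 2 * La%:R ^+ 3 / n%:R).
Proof.
move=> n0 mT T2; have N0 : 0 < n%:R :> R by rewrite ltr0n.
have K1 : 1 < (k%:R - 1) ^+ 2 :> R.
  have K3 : 3 <= k%:R :> R by rewrite ler_nat.
  nra.
have K0 : 0 < (k%:R - 1) ^+ 2 :> R := lt_trans ltr01 K1.
(* Chosen so that [x_t = t * u]. *)
set u : R := 2 / (n%:R * (k%:R - 1) ^+ 2).
have u0 : 0 < u by rewrite divr_gt0 // mulr_gt0.
have un : u <= 2 / n%:R.
  rewrite ler_pM2l // lef_pV2 ?posrE ?(mulr_gt0 N0 K0) //.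
  by rewrite ler_peMr ?ltW.
have muE a : \sum_(t < m) n%:R^-1 * ((t ^_ a.+1)%:R * u ^+ a.+1) <= mu n m a * dl a ^+ 2.
  rewrite dl_sqr; under eq_bigr do rewrite mulrCA.
  rewrite -mulr_suml -natr_sum /mu.
  have -> : (nroot m a)%:R * 2 ^+ a.+1 / n%:R ^+ a.+2 * (k%:R - 1) ^+ 2 ^- a.+1 =
      (nroot m a)%:R * (n%:R^-1 * u ^+ a.+1) :> R.
    rewrite /u expr_div_n [(n%:R * _) ^+ _]exprMn [n%:R ^+ a.+2]exprS.
    have x1 : n%:R ^+ a.+1 != 0 :> R by rewrite expf_neq0 // lt0r_neq0.
    have x2 : ((k%:R - 1) ^+ 2) ^+ a.+1 != 0 :> R by rewrite expf_neq0 // lt0r_neq0.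
    have x3 : n%:R != 0 :> R by rewrite lt0r_neq0.
    move: (n%:R ^+ a.+1 : R) (((k%:R - 1) ^+ 2) ^+ a.+1 : R) (2 ^+ a.+1 : R) (n%:R : R) x1 x2 x3 => y1 y2 y3 y4 x1 x2 x3.
    by field; rewrite x1 x2 x3.
  apply: ler_wpM2r; last by rewrite ler_nat nroot_ge.
  by rewrite mulr_ge0 ?invr_ge0 ?exprn_ge0 // ltW.
have step (t : 'I_m) : (n%:R * (1 - 2 * t%:R / (n%:R * (k%:R - 1) ^+ 2)))^-1 - n%:R^-1
    - \sum_(a < La) n%:R^-1 * ((t ^_ a.+1)%:R * u ^+ a.+1) <= n%:R^-1 * (2 ^- La + 2 * La%:R ^+ 3 / n%:R).
  set x : R := 2 * t%:R / (n%:R * (k%:R - 1) ^+ 2).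
  have xu : x = t%:R * u by rewrite /x /u; ring.
  have x0 : 0 <= x by rewrite xu mulr_ge0 // ltW.
  have x2 : x <= 1 / 2.
    apply: le_trans T2; rewrite /x invfM mulrA; apply: ler_wpM2r; first by rewrite invr_ge0; lra.
    rewrite ler_pdivrMr // -mulrA ler_pM2l //; apply: le_trans mT.
    by rewrite ler_nat ltnW.
  rewrite invfM -mulr_sumr -[X in _ - X - _]mulr1 -!mulrBr; apply: ler_wpM2l; first by rewrite invr_ge0.
  have fa (a : 'I_La) : x ^+ a.+1 - La%:R ^+ 2 * (2 / n%:R) <= (t ^_ a.+1)%:R * u ^+ a.+1.
    have La2 : a.+1%:R ^+ 2 <= La%:R ^+ 2 :> R by apply: lerXn2r; rewrite ?nnegrE // ler_nat.
    have [t0|t0] := posnP t.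
      rewrite xu t0 mul0r expr0n /= sub0r ffact0n /= mul0r oppr_le0 mulr_ge0 ?sqr_ge0 // divr_ge0 //.
    have := @ffact_ge R t a.+1 t0; rewrite -(ler_pM2r (exprn_gt0 a.+1 u0)); apply: le_trans.
    have -> : t%:R ^+ a.+1 * (1 - a.+1%:R ^+ 2 / t%:R) * u ^+ a.+1 = x ^+ a.+1 - a.+1%:R ^+ 2 * (u * x ^+ a) :> R.
      rewrite xu [(t%:R * u) ^+ a.+1]exprMn [(t%:R * u) ^+ a]exprMn [t%:R ^+ a.+1]exprS [u ^+ a.+1]exprS.
      by field; rewrite pnatr_eq0 -lt0n.
    rewrite lerD2l lerN2; apply: ler_pM => //; first exact: (mulr_ge0 (ltW u0) (exprn_ge0 a x0)).
    apply: le_trans un; rewrite ger_pMr // exprn_ile1 //; lra.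
  have : \sum_(a < La) (x ^+ a.+1 - La%:R ^+ 2 * (2 / n%:R)) <= \sum_(a < La) (t ^_ a.+1)%:R * u ^+ a.+1.
    by apply: ler_sum => a _; exact: fa.
  rewrite sumrB sumr_cst card_ord.
  have geo : \sum_(a < La) x ^+ a.+1 = (1 - x)^-1 - 1 - x ^+ La.+1 / (1 - x).
    have x1 : 1 - x != 0 by rewrite lt0r_neq0 //; lra.
    elim: La => [|L IH]; first by rewrite big_ord0; field.
    by rewrite big_ord_recr /= IH [x ^+ L.+2]exprS; field.
  rewrite geo.
  have : x ^+ La.+1 / (1 - x) <= 2 ^- La.
    rewrite ler_pdivrMr; last lra.
    apply: (@le_trans _ _ ((1 / 2) ^+ La.+1)); first by apply: lerXn2r; rewrite ?nnegrE //; lra.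
    rewrite exprS div1r exprVn mulrC ler_pM2l ?invr_gt0 ?exprn_gt0 //; lra.
  have -> : La%:R * (La%:R ^+ 2 * (2 / n%:R)) = 2 * La%:R ^+ 3 / n%:R :> R by rewrite [_ ^+ 3]exprS; ring.
  lra.
apply: (@le_trans _ _ (\sum_(t < m) n%:R^-1 * (2 ^- La + 2 * La%:R ^+ 3 / n%:R))); last first.
  rewrite sumr_cst card_ord mulrA; apply: ler_wpM2r.
    by rewrite addr_ge0 ?invr_ge0 ?divr_ge0 ?mulr_ge0 ?exprn_ge0.
  by rewrite ler_pdivrMr.
have hs := @ler_sum R _ (index_enum 'I_m) xpredT _ _ (fun t _ => step t).
apply: le_trans hs; rewrite !sumrB sumr_cst card_ord exchange_big /=.
have : \sum_(a < La) \sum_(t < m) n%:R^-1 * ((t ^_ a.+1)%:R * u ^+ a.+1) <= \sum_(a < La) mu n m a * dl a ^+ 2.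
  by apply: ler_sum => a _; exact: muE.
lra.
Qed.

End Means.

(** * Conditioning on the cycle counts *)

Section Tilt.
Variables (R : realType) (E : finType) (m : nat).
Local Notation Om := {ffun 'I_m -> E}.

Lemma pw_tilt (w g : E -> R) (F : Om -> R) :
  pw w (fun om => (\prod_i g (om i)) * F om) = pw (fun e => w e * g e) F.
Proof. by apply: eq_bigr => om _; rewrite [in RHS]big_split /=; ring. Qed.

Lemma pw_scale (w : E -> R) (a : R) (F : Om -> R) : pw (fun e => a * w e) F = a ^+ m * pw w F.
Proof.
rewrite /pw mulr_sumr; apply: eq_bigr => om _; rewrite big_split /= prodr_const card_ord; ring.
Qed.

Lemma eq_pww (w w' : E -> R) (F : Om -> R) : w =1 w' -> pw w F = pw w' F.
Proof. by move=> ww; apply: eq_bigr => om _; congr (_ * _); apply: eq_bigr => i _; rewrite ww. Qed.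

Lemma pw_avg (T : finType) (A : {set T}) (w : E -> R) (G : T -> Om -> R) :
  pw w (fun om => avg A (fun s => G s om)) = avg A (fun s => pw w (G s)).
Proof.
rewrite /avg -pw_sum mulrC -pwZ; apply: eq_pw => om; by rewrite mulrC.
Qed.

(** Either no event [ev d] occurs, or M lies below half of the value [wd d] expected there, and its
    squared deviation is at least [wd d ^+ 2 / 4]. *)
Lemma conditional_chebyshev (w : E -> R) (D : finType) (ev : D -> Om -> bool) (wd : D -> R) (M : Om -> R) (e0 : R) :
  (forall e, 0 <= w e) -> \sum_e w e = 1 ->
  (forall om, \sum_d (ev d om)%:R <= 1 :> R) -> (forall d, 0 < wd d) -> (forall d, e0 <= wd d / 2) ->
  pw w (fun om => (M om < e0)%R%:R) <= (1 - \sum_d pw w (fun om => (ev d om)%:R)) +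
    \sum_d 4 / wd d ^+ 2 * pw w (fun om => (M om - wd d) ^+ 2 * (ev d om)%:R).
Proof.
move=> w0 w1 evs wd0 we.
under [X in _ <= _ + X]eq_bigr do rewrite -pwZ.
rewrite -!pw_sum -[X in X - _](@pw_cst _ _ m w 1 w1) -pwB -pwD; apply: ler_pw => // om.
have q0 d : 0 <= 4 / wd d ^+ 2 * ((M om - wd d) ^+ 2 * (ev d om)%:R).
  by apply: mulr_ge0; [rewrite divr_ge0 // sqr_ge0|rewrite mulr_ge0 ?sqr_ge0].
case: ltP => hM; last first.
  by apply: addr_ge0; [rewrite subr_ge0 evs|exact: sumr_ge0].
rewrite -addrA lerDl addrC subr_ge0.
apply: ler_sum => d _; have := q0 d; case: (ev d om); rewrite ?mulr0 // !mulr1 => _.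
have w2 : 0 < wd d ^+ 2 by rewrite exprn_gt0.
rewrite mulrAC ler_pdivlMr // mul1r.
have := we d; have := wd0 d; nra.
Qed.

End Tilt.

Section Moments.
Variables (R : realType) (k h : nat) (V : finType) (m : nat).
Hypothesis cV : #|V| = (k * h)%N.
Hypothesis k2 : (1 < k)%N.
Hypothesis h0 : (0 < h)%N.
Local Notation col := {ffun V -> 'I_k}.
Local Notation Om := {ffun 'I_m -> V * V}.
Local Notation n := ((k * h)%:R : R).
Local Notation w0 := (kerw R (@id V) 1).

(** The density of the law tilted by s with respect to the base law, off the diagonal. [Mom]
    averages the product densities and so has mean 1. *)
Definition kst (s : col) (e : V * V) : R := (s e.1 != s e.2)%:R * ((n - 1) / (n - h%:R)).
Definition Mom (om : Om) : R := avg (bal k h V) (fun s => \prod_i kst s (om i)).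

Let nE : n = k%:R * h%:R. Proof. by rewrite natrM. Qed.
Let N2 : 2 <= n. Proof. by rewrite ler_nat (leq_trans k2) // leq_pmulr. Qed.
Let Nh : 0 < n - h%:R. Proof. by rewrite subr_gt0 ltr_nat ltn_Pmull. Qed.
Let K0 : k%:R != 0 :> R. Proof. by rewrite pnatr_eq0 -lt0n ltnW. Qed.

Lemma tilt1 s e : w0 e * kst s e = kerw R s h e.
Proof.
rewrite /kerw /kst cV /=; case: eqP => [->|ne] /=; first by rewrite eqxx !mul0r.
case: (s e.1 == s e.2); rewrite /= ?mul0r ?mulr0 //.
move: (n) (h%:R : R) N2 Nh => x y x2 xh; field; rewrite !lt0r_neq0 //; lra.
Qed.

Lemma tilt2 (s t : col) e : w0 e * (kst s e * kst t e) =
  (1 - n^-1) * (1 + sqovl R s t / sn R k h) * ker2 R h s t e.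
Proof.
rewrite /kerw /kst /ker2 cV /=; case: eqP => [->|ne] /=; first by rewrite !eqxx !mul0r mulr0.
case: (s e.1 == s e.2); rewrite /= ?mul0r ?mulr0 //.
case: (t e.1 == t e.2); rewrite /= ?mul0r ?mulr0 //.
have s0 := sn_gt0 R k2 h0; have sQ := snQ_gt0 R k2 h0 s t.
have sE : sn R k h = (n - h%:R) ^+ 2.
  by rewrite /sn nE; congr (_ ^+ 2); field.
rewrite sE in sQ *; move: (sqovl R s t) (n) (h%:R : R) N2 Nh sQ => Q x y x2 xh sQ.
by field; rewrite !lt0r_neq0 //; lra.
Qed.

Lemma Mom_first (F : Om -> R) :
  pw w0 (fun om => Mom om * F om) = avg (bal k h V) (fun s => pw (kerw R s h) F).
Proof.
under eq_pw do rewrite /Mom -avgZr.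
rewrite pw_avg; apply: eq_avg => s _; rewrite pw_tilt; apply: eq_pww => e; exact: tilt1.
Qed.

Lemma Mom_second (F : Om -> R) :
  pw w0 (fun om => Mom om ^+ 2 * F om) = avg (bal k h V) (fun s => avg (bal k h V) (fun t =>
    (1 - n^-1) ^+ m * phi R h s m t * pw (ker2 R h s t) F)).
Proof.
transitivity (pw w0 (fun om => avg (bal k h V) (fun s => avg (bal k h V) (fun t =>
    (\prod_i (kst s (om i) * kst t (om i))) * F om)))).
  apply: eq_pw => om; rewrite expr2 {1}/Mom -!avgZr; apply: eq_avg => s _.
  transitivity (avg (bal k h V) (fun t => (\prod_i kst s (om i) * \prod_i kst t (om i)) * F om)).
    by rewrite avgZr avgZ.
  by apply: eq_avg => t _; rewrite [in RHS]big_split.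
rewrite pw_avg; apply: eq_avg => s _; rewrite pw_avg; apply: eq_avg => t _.
rewrite (@pw_tilt _ _ m _ (fun e => kst s e * kst t e)) (eq_pww _ (tilt2 s t)) pw_scale.
by rewrite exprMn.
Qed.

End Moments.

Section PoissonTilt.
Variables (R : realType) (La : nat) (mu d : 'I_La -> R).

(** The likelihood ratio of the tilted Poisson law at c: the value around which [Mom] concentrates
    when the cycle counts equal c. *)
Definition wtilt (c : {ffun 'I_La -> nat}) : R := \prod_a ((1 + d a) ^+ c a * expR (- (mu a * d a))).

Lemma pois_tilt1 c : pois (fun a => mu a * (1 + d a)) c = pois mu c * wtilt c.
Proof.
rewrite /pois /wtilt -big_split /=; apply: eq_bigr => a _.
have -> : - (mu a * (1 + d a)) = - mu a + - (mu a * d a) by ring.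
by rewrite expRD [(mu a * _) ^+ _]exprMn; ring.
Qed.

(** The double tilt differs from the square of the single tilt by exactly the factor that
    [overlap_growth] contributes to the second moment. This cancellation makes the conditional
    variance small. *)
Lemma pois_tilt2 c : pois (fun a => mu a * (1 + d a) ^+ 2) c =
  pois mu c * wtilt c ^+ 2 * expR (- \sum_a mu a * d a ^+ 2).
Proof.
rewrite /pois /wtilt -sumrN expR_sum expr2 -!big_split /=; apply: eq_bigr => a _.
have -> : - (mu a * (1 + d a) ^+ 2) = - mu a + - (mu a * d a) + - (mu a * d a) + - (mu a * d a ^+ 2) by ring.
rewrite !expRD [(mu a * _) ^+ _]exprMn -exprM mulnC exprM.
move: (expR _) (expR _) (expR _) => x y z; ring.
Qed.

Lemma wtilt_bounds (B : R) (N : nat) (c : {ffun 'I_La -> nat}) :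
  (forall a, 0 <= mu a <= B) -> (forall a, `|d a| <= 1 / 2) -> (forall a, (c a <= N)%N) ->
  ((1 / 2) ^+ N * expR (- B)) ^+ La <= wtilt c <= (2 ^+ N * expR B) ^+ La.
Proof.
move=> mB dB cN.
have cst (x : R) : x ^+ La = \prod_(a < La) x by rewrite prodr_const card_ord.
have db a : 1 / 2 <= 1 + d a <= 2 by have := dB a; rewrite ler_norml => /andP[? ?]; apply/andP; split; lra.
have md a : `|mu a * d a| <= B.
  rewrite normrM; have /andP[m0 m1] := mB a; rewrite (ger0_norm m0) -[X in _ <= X]mulr1.
  apply: ler_pM => //; have := dB a; lra.
have h2 a : (1 / 2) ^+ N <= (1 + d a) ^+ c a <= 2 ^+ N.
  have /andP[d0 d1] := db a; apply/andP; split.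
    apply: (@le_trans _ _ ((1 / 2) ^+ c a)); first by apply: ler_wiXn2l; [lra|lra|exact: cN].
    by apply: lerXn2r => //; rewrite ?nnegrE; lra.
  apply: (@le_trans _ _ (2 ^+ c a)); last by apply: ler_weXn2l; [lra|exact: cN].
  by apply: lerXn2r => //; rewrite ?nnegrE; lra.
rewrite !cst; apply/andP; split; apply: ler_prod => a _; have /andP[x0 x1] := h2 a;
  have := md a; rewrite ler_norml => /andP[y0 y1]; have h0 : 0 <= (1 / 2 : R) ^+ N by (apply: exprn_ge0; lra).
  apply/andP; split; first by rewrite mulr_ge0 ?expR_ge0.
  by apply: ler_pM; rewrite ?expR_ge0 // ler_expR; lra.
apply/andP; split; first by rewrite mulr_ge0 ?expR_ge0 // (le_trans h0).
by apply: ler_pM; rewrite ?expR_ge0 ?(le_trans h0 x0) // ler_expR; lra.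
Qed.

Lemma pois_box_le1 (N : nat) : (forall a, 0 <= mu a) ->
  \sum_(c : {ffun 'I_La -> 'I_N.+1}) pois mu (box_nat c) <= 1.
Proof.
move=> m0.
have -> : \sum_(c : {ffun 'I_La -> 'I_N.+1}) pois mu (box_nat c) =
    \prod_a (expR (- mu a) * epart N (mu a)).
  under [RHS]eq_bigr do rewrite /epart mulr_sumr.
  rewrite bigA_distr_bigA /=; apply: eq_bigr => c _; apply: eq_bigr => a _.
  by rewrite ffunE.
rewrite -[X in _ <= X](big1_eq (op := *%R) (idx := 1) (index_enum 'I_La) xpredT).
apply: ler_prod => a _; apply/andP; split.
  by rewrite mulr_ge0 ?expR_ge0 // sumr_ge0 // => j _; rewrite divr_ge0 ?exprn_ge0.
by rewrite expRN mulrC ler_pdivrMr ?expR_gt0 // mul1r epart_le_expR.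
Qed.

End PoissonTilt.

Lemma fib_id (V : finType) (c : V) : #|[set x | id x == c]%SET| = 1%N.
Proof. by rewrite -(cards1 c); apply: eq_card => x; rewrite !inE. Qed.

Lemma small_factor (R : realType) (B D b : R) : 0 <= B -> 0 <= D -> 0 < b ->
  exists2 e : R, 0 < e <= 1 & B * (D * e) <= b / 2.
Proof.
move=> B0 D0 b0; have BD : 0 <= B * D by rewrite mulr_ge0.
have x0 : 0 < 2 * (B * D) + b by rewrite ltr_wpDl // mulr_ge0.
exists (b / (2 * (B * D) + b)).
  by rewrite divr_gt0 //= ler_pdivrMr // mul1r lerDr mulr_ge0.
rewrite mulrA mulrA ler_pdivrMr //; move: (B * D) BD x0 => x BD x0; nra.
Qed.

(** One radius [e'] serves all pairs of colorings: as long as their overlap deviation is below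
    [e' n], the doubly tilted cycle counts follow the Poisson law of an exactly uncorrelated
    pair. *)
Lemma cycle_laws (R : realType) (k : nat) (T : R) (La Nb : nat) (e : R) :
  (2 < k)%N -> 0 <= T -> 0 < e ->
  exists2 e' : R, 0 < e' & exists n0 : nat, forall (h : nat) (V : finType) (m : nat),
    (n0 <= #|V|)%N -> (0 < h)%N -> #|V| = (k * h)%N -> m%:R <= T * #|V|%:R ->
    forall c : {ffun 'I_La -> nat}, (forall a, (c a <= Nb)%N) ->
    [/\ `|pat (kerw R (@id V) 1) (@rty m La) (@rcyc V m La) c -
            pois (fun a : 'I_La => mu R #|V| m a) c| <= e,
        forall s, s \in bal k h V -> `|pat (kerw R s h) (@rty m La) (@rcyc V m La) c -
            pois (fun a : 'I_La => mu R #|V| m a * (1 + dl R k a)) c| <= e &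
        forall s t, s \in bal k h V -> t \in bal k h V ->
          sqovl R s t <= (e' * (k * h)%:R) ^+ 2 ->
          `|pat (ker2 R h s t) (@rty m La) (@rcyc V m La) c -
            pois (fun a : 'I_La => mu R #|V| m a * (1 + dl R k a) ^+ 2) c| <= e].
Proof.
move=> k3 T0 e0.
have B1 : 1 <= Bm T La by rewrite exprn_ege1 // lerDr mulr_ge0.
have B0 : 0 <= 4 * Bm T La by rewrite mulr_ge0 // (le_trans ler01).
have [b b0 [n1 H1]] := @cycle_poisson R T (4 * Bm T La) e La Nb T0 B0 e0.
pose D : R := 4 ^+ La.+2 * (La.+2%:R * ((k%:R ^+ 2) ^+ La.+2 + 4)).
pose G : R := La.+2%:R ^+ 2 * 4 ^+ La.+2.
have D0 : 0 <= D.
  by rewrite mulr_ge0 ?exprn_ge0 // mulr_ge0 // addr_ge0 // exprn_ge0 // exprn_ge0.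
have G0 : 0 <= G by rewrite mulr_ge0 ?exprn_ge0.
have Bm0 : 0 <= Bm T La := le_trans ler01 B1.
have [e' /andP[e'0 e'1] e'b] := small_factor Bm0 D0 b0.
have b2 : 0 < b / 2 by rewrite divr_gt0.
(* The base law is the kernel with [#|V|] types, whose own [delt] is at most 2/n; this accounts for
   the summand 2. *)
have [n2 [n20 H2]] := nat_gt_div (Bm T La * (G + 2)) b2.
exists e' => //; exists (maxn 2 (maxn n1 n2)) => h V m.
rewrite !geq_max => /andP[V2 /andP[Vn1 Vn2]] h0 cV mT c cN; pose mu (a : 'I_La) := mu R #|V| m a; pose d (a : nat) := dl R k a.
have V0 : (0 < #|V|)%N by exact: ltnW.
have k2 : (1 < k)%N by exact: ltnW.
have N0 : 0 < #|V|%:R :> R by rewrite ltr0n.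
have Gn := H2 _ Vn2.
have Gn' : Bm T La * (G / #|V|%:R) <= b / 2.
  apply: le_trans Gn; rewrite mulrA; apply: ler_wpM2r; first by rewrite invr_ge0.
  by apply: ler_wpM2l; [|rewrite lerDl].
have aG (a : 'I_La) : a.+2%:R ^+ 2 * 4 ^+ a.+2 / #|V|%:R <= G / #|V|%:R :> R.
  apply: ler_wpM2r; first by rewrite invr_ge0.
  apply: ler_pM; rewrite ?exprn_ge0 //.
    by apply: lerXn2r; rewrite ?nnegrE // ler_nat !ltnS ltnW.
  by apply: ler_weXn2l; rewrite ?ler1n // !ltnS ltnW.
have muB (a : 'I_La) : 0 <= mu a <= Bm T La by exact: mu_bounds.
have d2 a : `|d a| <= 1 / 2 by exact: dl_le.
have thB (a : 'I_La) th : 0 <= th <= 4 -> 0 <= mu a * th <= 4 * Bm T La.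
  move=> /andP[t0 t4]; have /andP[m0 m1] := muB a.
  by rewrite mulr_ge0 //= [4 * _]mulrC; apply: ler_pM.
have d4 a : 0 <= 1 + d a <= 4 /\ 0 <= (1 + d a) ^+ 2 <= 4.
  have := d2 a; rewrite ler_norml => /andP[x0 x1]; have s0 := sqr_ge0 (1 + d a).
  move: (d a) x0 x1 s0 => x x0 x1 s0; rewrite s0; split; first by apply/andP; split; lra.
  nra.
split.
- have C2 : (1 < #|V|)%N by [].
  apply: (H1 V m (kerw R id 1) (fun a => mu a)) => //.
  + by apply: kerw_ge0 => //; exact: fib_id.
  + by apply: kerw_sum => //; exact: fib_id.
  + by apply: kerw_le => //; exact: fib_id.
  + by move=> a; rewrite -[mu a]mulr1; apply: thB; rewrite ler01 ler1n.
  move=> a; rewrite -[mu a]mulr1.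
  apply: le_trans (@lam_mu R T La T0 V m _ a 1 ((G + 2) / #|V|%:R) V0 _ _ _ mT _) _.
  + by apply: kerw_ge0 => //; exact: fib_id.
  + by apply: kerw_sum => //; exact: fib_id.
  + exact: kerw_sym.
  + have := @kerw_itrc R V V id 1 V0 (@fib_id V) C2 a => h1.
    have h2 : `|delt (#|V|%:R : R) a.+2| <= 2 / #|V|%:R.
      have V2' : 2 <= #|V|%:R :> R by rewrite ler_nat.
      apply: le_trans (delt_le a V2') _; rewrite -[2 / _]invf_div lef_pV2 ?posrE ?divr_gt0 //.
        lra.
      by rewrite subr_gt0 ltr1n.
    rewrite -[X in X - 1](subrK (1 + delt #|V|%:R a.+2)) -addrA [1 + delt _ _]addrC addrK.
    apply: le_trans (ler_normD _ _) _; rewrite mulrDl; apply: lerD => //.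
    by rewrite [delt _ _ + 1]addrC; exact: le_trans h1 (aG a).
  by rewrite mulrA; apply: le_trans Gn _; lra.
- move=> s /[dup] sb /balP sb'.
  have C2 : (1 < #|'I_k|)%N by rewrite card_ord.
  apply: (H1 V m (kerw R s h) (fun a => mu a * (1 + d a))) => //.
  + by apply: kerw_ge0.
  + by apply: kerw_sum.
  + by apply: kerw_le.
  + by move=> a; apply: thB; case: (d4 a).
  move=> a; apply: le_trans (@lam_mu R T La T0 V m _ a _ (G / #|V|%:R) V0 _ _ _ mT _) _.
  + by apply: kerw_ge0.
  + by apply: kerw_sum.
  + exact: kerw_sym.
  + have := @kerw_itrc R V 'I_k s h V0 sb' C2 a; rewrite card_ord => h1.
    exact: le_trans h1 (aG a).
  by apply: le_trans Gn' _; lra.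
move=> s t sb tb Q.
apply: (H1 V m (ker2 R h s t) (fun a => mu a * (1 + d a) ^+ 2)) => //.
+ exact: ker2_ge0.
+ exact: ker2_sum.
+ exact: ker2_le.
+ by move=> a; apply: thB; case: (d4 a).
move=> a; apply: le_trans (@lam_mu R T La T0 V m _ a _ (D * e' + G / #|V|%:R) V0 _ _ _ mT _) _.
+ exact: ker2_ge0.
+ exact: ker2_sum.
+ exact: ker2_sym.
+ have e'01 : 0 <= e' <= 1 by rewrite (ltW e'0).
  apply: le_trans (@ker2_itrc R k h V cV k2 h0 s t sb a e' Q e'01) _; rewrite -cV; apply: lerD; last exact: aG.
  rewrite mulrA; apply: ler_wpM2r; first exact: ltW.
  have k0 l : 0 <= (k%:R ^+ 2) ^+ l + 4 :> R by rewrite addr_ge0 // exprn_ge0 // sqr_ge0.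
  apply: ler_pM; [exact: exprn_ge0|exact: mulr_ge0| |].
    by apply: ler_weXn2l; rewrite ?ler1n // !ltnS ltnW.
  apply: ler_pM => //; first by rewrite ler_nat !ltnS ltnW.
  rewrite lerD2r; apply: ler_weXn2l; last by rewrite !ltnS ltnW.
  by rewrite exprn_ege1 // ler1n ltnW // ltnW.
by rewrite mulrDr; apply: le_trans (lerD e'b Gn') _; lra.
Qed.

Lemma bal_gt0 (R : realType) (k h : nat) (V : finType) :
  #|V| = (k * h)%N -> (0 < k)%N -> (0 < h)%N -> (0 < #|bal k h V|)%N.
Proof.
move=> cV k0 h0; rewrite lt0n; apply/eqP => b0.
have := @card_bal_ge k h V cV R k0 h0; rewrite b0 mul0r leNgt divr_gt0 ?exprn_gt0 ?ltr0n //.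
exact: cmult1_gt0.
Qed.

(** * Second moment restricted to a fixed vector of cycle counts *)

Section OneColoring.
Variables (R : realType) (k h : nat) (V : finType).
Hypothesis cV : #|V| = (k * h)%N.
Hypothesis k3 : (2 < k)%N.
Hypothesis h0 : (0 < h)%N.
Variables (s : {ffun V -> 'I_k}) (T eta C1 : R) (m : nat).
Hypothesis sb : s \in bal k h V.
Hypothesis mT : m%:R <= T * (k * h)%:R.
Hypothesis hC1 : avg (bal k h V)
  (fun t => expR ((T / (1 - k%:R^-1) ^+ 2 + eta) / (k * h)%:R * sqovl R s t)) <= C1.
Local Notation n := ((k * h)%:R : R).

Let k2 : (1 < k)%N. Proof. exact: ltnW. Qed.
Let N0 : 0 < n. Proof. by rewrite ltr0n muln_gt0 h0 ltnW // ltnW. Qed.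
Let n1 : 0 <= 1 - n^-1 <= 1.
Proof. by rewrite subr_ge0 invf_le1 // ler1n -(ltr0n R) N0 /= gerBl invr_ge0 ltW. Qed.

(** Pairs of small overlap see the cycle probability p. The others, whatever their cycle counts, are
    exponentially rare: the spare rate eta in the exponential moment gains [eta e'^2 n]. *)
Lemma overlap_split (e' A p : R) (P : {ffun V -> 'I_k} -> R) :
  0 < eta -> 0 < e' -> 0 <= p -> (1 - n^-1) ^+ m * avg (bal k h V) (phi R h s m) <= A ->
  (forall t, t \in bal k h V -> P t <= 1) ->
  (forall t, t \in bal k h V -> sqovl R s t <= (e' * n) ^+ 2 -> P t <= p) ->
  avg (bal k h V) (fun t => (1 - n^-1) ^+ m * phi R h s m t * P t) <=
  A * p + C1 * expR (- (eta * e' ^+ 2 * n)).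
Proof.
move=> eta0 e'0 p0 hA P1 Pp; case/andP: n1 => n10 n11.
apply: (@le_trans _ _ (avg (bal k h V) (fun t => (1 - n^-1) ^+ m * p * phi R h s m t +
   expR (- (eta * e' ^+ 2 * n)) * expR ((T / (1 - k%:R^-1) ^+ 2 + eta) / n * sqovl R s t)))); last first.
  rewrite avgD !avgZ; apply: lerD; first by rewrite mulrAC ler_wpM2r.
  by rewrite mulrC ler_wpM2r ?expR_ge0.
apply: ler_avg => t tb.
have ph1 := phi_ge1 R s m t k2 h0.
have ph0 : 0 <= phi R h s m t := le_trans ler01 ph1.
have x0 : 0 <= (1 - n^-1) ^+ m by rewrite exprn_ge0.
have x1 : (1 - n^-1) ^+ m <= 1 by rewrite exprn_ile1.
have xp0 : 0 <= (1 - n^-1) ^+ m * phi R h s m t by rewrite mulr_ge0.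
have [Qs|Qb] := leP (sqovl R s t) ((e' * n) ^+ 2).
  apply: ler_wpDr; first by rewrite mulr_ge0 ?expR_ge0.
  by rewrite [X in _ <= X]mulrAC ler_wpM2l // Pp.
apply: ler_wpDl; first by rewrite !mulr_ge0.
apply: (@le_trans _ _ (phi R h s m t)).
  apply: (@le_trans _ _ ((1 - n^-1) ^+ m * phi R h s m t)); first by rewrite ler_piMr // P1.
  by rewrite ler_piMl.
have := phi_le_expR s eta t k2 h0 mT => H.
rewrite expRN mulrC ler_pdivlMr ?expR_gt0 //; apply: le_trans H; apply: ler_wpM2l => //.
rewrite ler_expR -mulrA ler_pM2l // ler_pdivlMr // -mulrA -expr2 -exprMn; exact: ltW.
Qed.

Lemma overlap_growth (La : nat) (z : R) : 0 <= T -> 0 < eta -> 0 <= C1 ->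
  2 * T / (k%:R - 1) ^+ 2 <= 1 / 2 ->
  T * 2 ^- La <= z / 3 -> T * (2 * La%:R ^+ 3) / n <= z / 3 ->
  8 * steinC k T eta * C1 * T / Num.sqrt n <= z / 3 ->
  (1 - n^-1) ^+ m * avg (bal k h V) (phi R h s m) <=
  expR (z + \sum_(a < La) mu R (k * h) m a * dl R k a ^+ 2).
Proof.
move=> T0 eta0 C10 T2 z1 z2 z3; case/andP: n1 => n10 n11.
have om := overlap_moment cV sb k2 h0 T0 eta0 mT C10 T2 hC1.
have pe : (1 - n^-1) ^+ m <= expR (- (m%:R / n)).
  have := @pow_le_expR R (- n^-1) m; rewrite mulrN; apply.
  by rewrite lerN2 -subr_ge0.
apply: le_trans (ler_pM _ _ pe om) _.
- exact: exprn_ge0.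
- by apply: avg_ge0 => t _; apply: le_trans ler01 (phi_ge1 R s m t k2 h0).
rewrite -expRD ler_expR.
have nn : (0 < k * h)%N by rewrite -(ltr0n R).
have := exponent_bound La k3 nn mT T2; rewrite /xt mulrDr => eb; rewrite -[T * _ / n]mulrA in z2.
set S1 := \sum_(t < m) _ in eb *; set S2 := \sum_(a < La) _ in eb *.
set x3 := 8 * _ * _ * _ / _ in z3 *.
move: (T * 2 ^- La) (T * (2 * La%:R ^+ 3 / n)) x3 S1 S2 (m%:R / n) z1 z2 z3 eb => y1 y2 y3 y4 y5 y6.
lra.
Qed.

End OneColoring.

(** Expanding the square, the leading terms are [pi w^2] times e^z, -2 and 1. They would cancel at z
    = 0, leaving only the approximation errors. *)
Lemma sqdev_bound (R : realType) (p0 ph p2 pi w e z S tl Rx : R) :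
  0 <= w -> 0 <= e -> `|p0 - pi| <= e -> pi * w - e <= ph ->
  p2 <= expR (z + S) * (pi * w ^+ 2 * expR (- S) + e) + tl -> expR (z + S) <= Rx ->
  p2 - 2 * w * ph + w ^+ 2 * p0 <= pi * w ^+ 2 * (expR z - 1) + ((Rx + 2 * w + w ^+ 2) * e + tl).
Proof.
move=> w0 e0; rewrite ler_norml => /andP[_ h1] h2 h3 h4.
have E : expR (z + S) * (pi * w ^+ 2 * expR (- S) + e) = pi * w ^+ 2 * expR z + expR (z + S) * e.
  rewrite mulrDr; congr (_ + _); rewrite mulrCA -expRD -addrA subrr addr0 mulrC; ring.
have t1 : w ^+ 2 * p0 <= w ^+ 2 * (pi + e) by rewrite ler_wpM2l ?sqr_ge0 //; lra.
have t2 : 2 * w * (pi * w - e) <= 2 * w * ph by rewrite ler_wpM2l // mulr_ge0.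
have t3 : expR (z + S) * e <= Rx * e by rewrite ler_wpM2r.
rewrite E in h3.
have -> : pi * w ^+ 2 * (expR z - 1) + ((Rx + 2 * w + w ^+ 2) * e + tl) =
  (pi * w ^+ 2 * expR z + Rx * e + tl) - 2 * w * (pi * w - e) + w ^+ 2 * (pi + e) by ring.
lra.
Qed.

Lemma half_pow_small (R : realType) (T z : R) : 0 <= T -> 0 < z ->
  exists La : nat, T * 2 ^- La <= z.
Proof.
move=> T0 z0; have [n0 [n00 H]] := nat_gt_div T z0.
exists n0; apply: le_trans (H n0 (leqnn _)); apply: ler_wpM2l => //.
rewrite lef_pV2 ?posrE ?ltr0n ?exprn_gt0 // -natrX ler_nat; apply: ltnW; exact: ltn_expl.
Qed.

Lemma sqrt_gt_div (R : realType) (C b : R) : 0 < b ->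
  exists n0 : nat, forall n : nat, (n0 <= n)%N -> C / Num.sqrt n%:R <= b.
Proof.
move=> b0; have [n1 [n10 H]] := nat_gt_div `|C| b0.
exists (n1 ^ 2)%N => n nn; have n1R : 0 < n1%:R :> R by rewrite ltr0n.
have sq : n1%:R <= Num.sqrt n%:R :> R.
  by rewrite -[X in X <= _]ger0_norm // -sqrtr_sqr ler_wsqrtr // -natrX ler_nat.
apply: le_trans (H n1 (leqnn _)).
apply: (@le_trans _ _ (`|C| / Num.sqrt n%:R)).
  by rewrite ler_wpM2r ?ler_norm // invr_ge0 sqrtr_ge0.
by rewrite ler_wpM2l // lef_pV2 ?posrE // (lt_le_trans n1R).
Qed.

Lemma exp_tail_small (R : realType) (C a b : R) : 0 <= C -> 0 < a -> 0 < b ->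
  exists n0 : nat, forall n : nat, (n0 <= n)%N -> C * expR (- (a * n%:R)) <= b.
Proof.
move=> C0 a0 b0; have [n1 [n10 H]] := nat_gt_div (C / a) b0.
exists n1 => n nn; have n0 : 0 < n%:R :> R by rewrite ltr0n (leq_trans n10).
apply: le_trans (H n nn); rewrite expRN -mulrA -invfM; apply: ler_wpM2l => //.
rewrite lef_pV2 ?posrE ?expR_gt0 ?mulr_gt0 //.
have := expR_ge1Dx (a * n%:R); lra.
Qed.

(** The constants depend on one another in a strict order: z on eps, the number La of lengths on z,
    the cap Nb on La, the accuracy e of the Poisson laws on all of these, the overlap radius on e,
    and h last. *)
Lemma Mom_not_small (R : realType) (k : nat) (T eta kap : R) :
  (2 < k)%N -> 0 <= T -> 0 < eta -> 0 < kap -> T / (1 - k%:R^-1) ^+ 2 + eta < k%:R * kap ->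
  (forall u : R, 0 <= u <= k%:R -> kap / k%:R * (u - 1) ^+ 2 <= u * ln u - u + 1) ->
  2 * T / (k%:R - 1) ^+ 2 <= 1 / 2 ->
  forall eps : R, 0 < eps -> exists2 e0 : R, 0 < e0 & exists h0 : nat,
  forall (h : nat) (V : finType) (m : nat), (h0 <= h)%N -> #|V| = (k * h)%N -> m%:R <= T * (k * h)%:R ->
  pw (kerw R (@id V) 1) (fun om : {ffun 'I_m -> V * V} => (Mom R k h om < e0)%R%:R) <= eps.
Proof.
move=> k3 T0 eta0 kap0 ck entr T2 eps eps0.
have k2 : (1 < k)%N by exact: ltnW.
have k0 : (0 < k)%N by exact: ltnW.
have q2 : 0 <= T / (1 - k%:R^-1) ^+ 2 by rewrite divr_ge0 ?sqr_ge0.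
have c10 : 0 <= T / (1 - k%:R^-1) ^+ 2 + eta by rewrite addr_ge0 // ltW.
have [C1' [hC HC]] := bal_exp_bound k0 kap0 c10 ck entr.
pose C1 := Num.max C1' 0.
have C10 : 0 <= C1 by rewrite le_max lexx orbT.
(* Chebyshev's factor 4 turns the relative excess [e^z - 1 = eps / 16] into eps/4. *)
pose z := ln (1 + eps / 16).
have eps16 : 1 < 1 + eps / 16 by rewrite ltrDl divr_gt0.
have z0 : 0 < z by rewrite ln_gt0.
have expz : expR z = 1 + eps / 16 by rewrite lnK // posrE (lt_trans ltr01).
have z3 : 0 < z / 3 by rewrite divr_gt0.
have [La HLa] := half_pow_small T0 z3.
pose B := Bm T La.
have B1 : 1 <= B by rewrite exprn_ege1 // lerDr mulr_ge0.
have B0 : 0 <= B := le_trans ler01 B1.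
pose BL := Kc 4 La * (La.+2%:R + T) ^+ La.+2.
have eps4 : 0 < eps / 4 by rewrite divr_gt0.
(* Cycle counts above Nb are discarded at a cost of eps/4; on the remaining box the ratios [wd] stay
   between two positive constants. *)
have [Nb [Nb0 HNb]] := nat_gt_div (La%:R * BL) eps4.
pose wmin : R := ((1 / 2) ^+ Nb * expR (- B)) ^+ La.
pose wmax : R := (2 ^+ Nb * expR B) ^+ La.
have wmin0 : 0 < wmin by rewrite exprn_gt0 // mulr_gt0 ?expR_gt0 // exprn_gt0 // divr_gt0.
have wmax0 : 0 < wmax by rewrite exprn_gt0 // mulr_gt0 ?expR_gt0 // exprn_gt0.
pose Nx : R := #|{ffun 'I_La -> 'I_Nb.+1}|%:R.
have Nx0 : 0 < Nx by rewrite ltr0n card_ffun !card_ord expn_gt0.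
pose Rx := expR (z + La%:R * B).
have Rx0 : 0 < Rx by exact: expR_gt0.
pose F := Nx * (4 / wmin ^+ 2).
have F0 : 0 < F by rewrite mulr_gt0 // divr_gt0 // exprn_gt0.
pose G := Rx + 2 * wmax + wmax ^+ 2.
have G0 : 0 < G := addr_gt0 (addr_gt0 Rx0 (mulr_gt0 (ltr0Sn R 1) wmax0)) (exprn_gt0 2 wmax0).
(* F sums the Chebyshev factors over the box and G collects the coefficients of e in [sqdev_bound],
   so these errors total eps/4. *)
pose e := eps / 4 / (F * G).
have e0 : 0 < e by rewrite divr_gt0 // mulr_gt0.
have [e' e'0 [n1 Hl]] := @cycle_laws R k T La Nb e k3 T0 e0.
have ea0 : 0 < eta * e' ^+ 2 by rewrite mulr_gt0 // exprn_gt0.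
have ep4F : 0 < eps / 4 / F by rewrite divr_gt0.
have [n2 Hn2] := exp_tail_small C10 ea0 ep4F.
have [n3 [_ Hn3]] := nat_gt_div (T * (2 * La%:R ^+ 3)) z3.
have [n4 Hn4] := sqrt_gt_div (8 * steinC k T eta * C1 * T) z3.
exists (wmin / 2); first by rewrite divr_gt0.
exists (maxn 1 (maxn hC (maxn n1 (maxn n2 (maxn n3 n4))))) => h V m.
rewrite !geq_max => /andP[h1 /andP[hhC /andP[hn1 /andP[hn2 /andP[hn3 hn4]]]]] cV mT.
have hn x : (x <= h)%N -> (x <= k * h)%N by move=> /leq_trans; apply; exact: leq_pmull.
have mT' : m%:R <= T * #|V|%:R by rewrite cV.
have V2 : (1 < #|V|)%N by rewrite cV (leq_trans k2) // leq_pmulr.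
have V0 : (0 < #|V|)%N by exact: ltnW.
have W1 : 1 <= 4 :> R by rewrite ler1n.
pose w0 := kerw R (@id V) 1.
have w00 e1 : 0 <= w0 e1 by apply: kerw_ge0 => //; exact: fib_id.
have w01 : \sum_e1 w0 e1 = 1 by apply: kerw_sum => //; exact: fib_id.
have w0W e1 : w0 e1 <= 4 / #|V|%:R ^+ 2 by apply: kerw_le => //; exact: fib_id.
pose mum (a : 'I_La) := mu R #|V| m a; pose d (a : 'I_La) := dl R k a.
have mub a : 0 <= mum a <= B by exact: mu_bounds.
have dB a : `|d a| <= 1 / 2 by exact: dl_le.
pose cb (c : {ffun 'I_La -> 'I_Nb.+1}) := box_nat c.
have cbN c a : (cb c a <= Nb)%N by rewrite ffunE -ltnS; exact: ltn_ord.
pose wd c := wtilt mum d (cb c).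
have wdb c : wmin <= wd c <= wmax by apply: wtilt_bounds.
have wd0 c : 0 < wd c by apply: lt_le_trans wmin0 _; case/andP: (wdb c).
pose ev (c : {ffun 'I_La -> 'I_Nb.+1}) (om : {ffun 'I_m -> V * V}) := nev_at (@rty m La) (@rcyc V m La) (cb c) om.
pose S := \sum_(a < La) mum a * d a ^+ 2.
have sumc (x : R) : \sum_(a < La) x = La%:R * x by rewrite sumr_cst card_ord.
have SB : S <= La%:R * B.
  rewrite -(sumc B); apply: ler_sum => a _.
  have /andP[m0 m1] := mub a; rewrite -[X in _ <= X]mulr1; apply: ler_pM => //; first exact: sqr_ge0.
  have := dB a; rewrite ler_norml => /andP[x0 x1]; move: (d a) x0 x1 => x x0 x1; nra.
have avC s : s \in bal k h V -> avg (bal k h V)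
   (fun t => expR ((T / (1 - k%:R^-1) ^+ 2 + eta) / (k * h)%:R * sqovl R s t)) <= C1.
  by move=> sb; rewrite le_max (HC h V s hhC cV sb).
apply: le_trans (@conditional_chebyshev R _ m w0 _ ev wd (Mom R k h (m := m)) (wmin / 2) w00 w01 _ wd0 _) _.
- by move=> om; rewrite sum_box_at lern1 leq_b1.
- by move=> c; rewrite ler_pM2r ?invr_gt0 //; case/andP: (wdb c).
have out : 1 - \sum_c pw w0 (fun om => (ev c om)%:R) <= eps / 4.
  have /andP[bm _] := @box_mass R _ m w0 w00 w01 _ _ (@rty m La) (@rcyc V m La) Nb.
  rewrite lerBlDl -lerBlDr; apply: le_trans bm; rewrite lerD2l lerN2.
  apply: (@le_trans _ _ (La%:R * BL / Nb.+1%:R)); last by apply: HNb; exact: leqnSn.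
  apply: ler_wpM2r; first by rewrite invr_ge0.
  rewrite -(sumc BL); apply: ler_sum => a _.
  exact: (@lam_bound R V m w0 4 T La w00 w01 V0 w0W W1 mT' a).
pose tl := C1 * expR (- (eta * e' ^+ 2 * (k * h)%:R)).
have tlb : tl <= eps / 4 / F by apply: Hn2; exact: hn.
have main c : 4 / wd c ^+ 2 * pw w0 (fun om => (Mom R k h om - wd c) ^+ 2 * (ev c om)%:R) <=
    pois mum (cb c) * (eps / 4) + 4 / wmin ^+ 2 * (G * e + tl).
  have nV : (n1 <= #|V|)%N by rewrite cV hn.
  have [l1 l2 l3] := Hl h V m nV h1 cV mT' (cb c) (cbN c).
  have /andP[wl wu] := wdb c; have w0' := wd0 c.
  have -> : pw w0 (fun om => (Mom R k h om - wd c) ^+ 2 * (ev c om)%:R) =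
      pw w0 (fun om => Mom R k h om ^+ 2 * (ev c om)%:R) -
      2 * wd c * pw w0 (fun om => Mom R k h om * (ev c om)%:R) +
      wd c ^+ 2 * pw w0 (fun om => (ev c om)%:R).
    by rewrite -!pwZ -pwB -pwD; apply: eq_pw => om; ring.
  rewrite (Mom_second cV k2 h1) (Mom_first cV k2 h1).
  have po0 : 0 <= pois mum (cb c) by have /andP[] := pois_le1 (cb c) (fun a => proj1 (andP (mub a))).
  have b0 := bal_gt0 R cV k0 h1.
  apply: (@le_trans _ _ (4 / wd c ^+ 2 * (pois mum (cb c) * wd c ^+ 2 * (expR z - 1) +
     ((Rx + 2 * wd c + wd c ^+ 2) * e + tl)))).
    apply: ler_wpM2l; first by rewrite divr_ge0 // sqr_ge0.
    apply: (@sqdev_bound _ _ _ _ _ _ _ _ S); [exact: ltW|exact: ltW|exact: l1| | |].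
    - rewrite -[X in X <= _](avg_cst _ b0); apply: ler_avg => s sb.
      rewrite -pois_tilt1; have := l2 s sb; rewrite ler_norml => /andP[x0 _].
      by move: x0; rewrite lerBrDl addrC.
    - rewrite -[X in _ <= X](avg_cst _ b0); apply: ler_avg => s sb.
      apply: (overlap_split k3 h1 mT (avC s sb)) => //.
      - exact: (addr_ge0 (mulr_ge0 (mulr_ge0 po0 (sqr_ge0 _)) (expR_ge0 _)) (ltW e0)).
      - rewrite /S /mum /d cV; apply: (overlap_growth cV k3 h1 sb mT (avC s sb)) => //.
        + by apply: Hn3; exact: hn.
        + by apply: Hn4; exact: hn.
      - move=> t tb; have := @pw_bool_le1 R _ m (ker2 R h s t) (ev c).
        by case/(_ (@ker2_ge0 R k h V k2 h1 s t) (ker2_sum R cV k2 h1 sb tb))/andP.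
      - move=> t tb Q; rewrite -pois_tilt2.
        have := l3 s t sb tb Q; rewrite ler_norml => /andP[_ x1].
        by move: x1; rewrite lerBlDl.
    - by rewrite /Rx ler_expR lerD2l.
  have wsq : 0 < wd c ^+ 2 by rewrite exprn_gt0.
  rewrite mulrDr; apply: lerD.
    rewrite expz; apply: ler_of_eq; field; by rewrite lt0r_neq0.
  have tl0 : 0 <= tl by rewrite mulr_ge0 ?expR_ge0.
  have y0 : 0 <= Rx + 2 * wd c + wd c ^+ 2.
    exact: (addr_ge0 (addr_ge0 (ltW Rx0) (mulr_ge0 (ler0n R 2) (ltW w0'))) (sqr_ge0 _)).
  apply: ler_pM; [by rewrite divr_ge0 // sqr_ge0|exact: (addr_ge0 (mulr_ge0 y0 (ltW e0)) tl0)| |].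
    have wm2 : 0 < wmin ^+ 2 := exprn_gt0 2 wmin0.
    rewrite ler_pM2l // lef_pV2 ?posrE //.
    by apply: lerXn2r => //; rewrite nnegrE; exact: ltW.
  rewrite lerD2r; apply: ler_wpM2r; first exact: ltW.
  apply: lerD; first by rewrite lerD2l ler_pM2l.
  by apply: lerXn2r => //; rewrite nnegrE; exact: ltW.
have tot : \sum_c 4 / wd c ^+ 2 * pw w0 (fun om => (Mom R k h om - wd c) ^+ 2 * (ev c om)%:R) <=
   eps / 4 + (eps / 4 + eps / 4).
  apply: le_trans (ler_sum _ (fun c _ => main c)) _; rewrite big_split /=; apply: lerD.
    rewrite -mulr_suml ler_piMl ?(ltW eps4) //; apply: pois_box_le1 => a.
    by case/andP: (mub a).
  rewrite sumr_cst -/Nx mulrA -/F mulrDr; apply: lerD.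
    apply: ler_of_eq; rewrite /e; field; by rewrite !lt0r_neq0.
  by rewrite mulrC -ler_pdivlMr.
move: (1 - _) (\sum_c 4 / _ * _) out tot => x y; clear -x y; lra.
Qed.

(** * From random sequences of edges to G(n,m) *)

Section Presentations.
Variables (n m : nat).
Local Notation Om := {ffun 'I_m -> 'I_n * 'I_n}.
Implicit Types (G : graph n) (e : {set 'I_n}).

Definition presents G (om : Om) : bool := [set ends (om j) | j : 'I_m]%SET == edges G.

Lemma edge_card G e : e \in edges G -> #|e| = 2.
Proof. by move=> eG; apply/eqP; have /forall_inP := edges_card2 G; apply. Qed.

Variable x0 : 'I_n.
Definition lo e : 'I_n := odflt x0 [pick x in e].
Definition hi e : 'I_n := odflt x0 [pick x in e :\ lo e].

Lemma lo_hi e : #|e| = 2 -> e = [set lo e; hi e]%SET /\ lo e != hi e.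
Proof.
move=> e2.
have lo_e : lo e \in e.
  rewrite /lo; case: pickP => // H; move: e2; rewrite (eq_card0 H); by [].
have hi_e : hi e \in e :\ lo e.
  rewrite /hi; case: pickP => // H.
  by have := cardsD1 (lo e) e; rewrite e2 lo_e (eq_card0 H).
have /andP[hl he] : (hi e != lo e) && (hi e \in e) by rewrite -in_setD1.
have lh : lo e != hi e by rewrite eq_sym.
split=> //; apply/esym/eqP; rewrite eqEcard cards2 lh e2 leqnn andbT.
by apply/fintype.subsetP => x; rewrite !inE => /orP[] /eqP ->.
Qed.

(** An order of the edges and an orientation of each edge determine a sequence. *)
Lemma card_presents G : G \in graphs_with n m ->
  (m`! * 2 ^ m <= #|[set om : Om | presents G om]%SET|)%N.
Proof.
rewrite inE => /eqP Gm.
pose inj := [set f : {ffun 'I_m -> {set 'I_n}} in ffun_on (mem (edges G)) | injectiveb f]%SET.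
have ci : #|inj| = m`! by rewrite card_inj_ffuns_on card_ord Gm ffactnn.
pose g (p : {ffun 'I_m -> {set 'I_n}} * {ffun 'I_m -> bool}) : Om :=
  [ffun j => if p.2 j then (lo (p.1 j), hi (p.1 j)) else (hi (p.1 j), lo (p.1 j))].
have gE p j : p.1 \in inj -> ends (g p j) = p.1 j.
  rewrite inE => /andP[/ffun_onP pG _]; have [e1 _] := lo_hi (edge_card (pG j)).
  by rewrite /ends ffunE; case: (p.2 j) => /=; rewrite [in RHS]e1 // setUC.
have gi : {in setX inj [set: {ffun 'I_m -> bool}]%SET &, injective g}.
  move=> [f b] [f' b'] /setXP[/= fi _] /setXP[/= fi' _] e.
  have ff : f = f'.
    by apply/ffunP => j; rewrite -(gE (f, b) j fi) -(gE (f', b') j fi') e.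
  subst f'; congr (_, _); apply/ffunP => j.
  have := congr1 (fun om : Om => om j) e; rewrite !ffunE /=.
  move: fi; rewrite inE => /andP[/ffun_onP pG _]; have [_ ne] := lo_hi (edge_card (pG j)).
  by case: (b j); case: (b' j) => // -[]; move=> /eqP; rewrite ?(negbTE ne) // eq_sym (negbTE ne).
have := card_in_imset gi; rewrite cardsX ci cardsT card_ffun card_bool card_ord => <-.
apply: subset_leq_card; apply/fintype.subsetP => _ /imsetP[[f b] /setXP[/= fi _] ->].
rewrite inE /presents; apply/eqP.
have -> : [set ends (g (f, b) j) | j : 'I_m]%SET = f @: [set: 'I_m]%SET.
  by apply/setP => e; apply/imsetP/imsetP => -[j _ ->]; exists j; rewrite // gE.
move: fi; rewrite inE => /andP[/ffun_onP pG /injectiveP ij].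
apply/eqP; rewrite eqEcard Gm card_imset // cardsT card_ord leqnn andbT.
by apply/fintype.subsetP => _ /imsetP[j _ ->]; exact: pG.
Qed.

Lemma presents_uniq G G' om : presents G om -> presents G' om -> G = G'.
Proof. by move=> /eqP e1 /eqP e2; apply: val_inj; rewrite /= -e1 -e2. Qed.

Lemma presents_nonloop G om j : presents G om -> (om j).1 != (om j).2.
Proof.
move=> /eqP e; have : ends (om j) \in edges G by rewrite -e; apply/imsetP; exists j.
by move=> /edge_card; rewrite /ends cards2; case: eqP.
Qed.

Lemma presents_proper k G om (s : coloring k n) : presents G om ->
  (forall j, s (om j).1 != s (om j).2) -> s \in colorings_of k G.
Proof.
move=> /eqP e H; rewrite inE; apply/forallP => x; apply/forallP => y; apply/implyP.
rewrite /adj => /[dup] /edge_card; rewrite cards2 -e => xy /imsetP[j _ ej].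
have xj : x \in ends (om j) by rewrite -ej !inE eqxx.
have yj : y \in ends (om j) by rewrite -ej !inE eqxx orbT.
move: xj yj xy; rewrite !inE => /orP[] /eqP xE /orP[] /eqP yE; rewrite xE yE ?eqxx // => _.
by rewrite eq_sym; exact: H.
Qed.

End Presentations.

Lemma card_restrict (n n' k : nat) (le : (n <= n')%N) (A : {set {ffun 'I_n -> 'I_k}}) :
  (0 < n')%N -> (n' <= n + k)%N ->
  (#|[set s : {ffun 'I_n' -> 'I_k} | [ffun x => s (widen_ord le x)] \in A]%SET| <= #|A| * k ^ k)%N.
Proof.
move=> n0 nk; set X := finset _.
(* The second component records the colors of the added vertices, at most k in number; indices
   beyond the last vertex fall back to vertex 0, harmlessly for injectivity. *)
pose g (s : {ffun 'I_n' -> 'I_k}) : {ffun 'I_n -> 'I_k} * {ffun 'I_k -> 'I_k} :=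
  ([ffun x => s (widen_ord le x)], [ffun j : 'I_k => s (insubd (Ordinal n0) (n + j)%N)]).
have gi : injective g.
  move=> s t [e1 e2]; apply/ffunP => x.
  have [xn|nx] := ltnP x n.
    have := congr1 (fun f : {ffun 'I_n -> 'I_k} => f (Ordinal xn)) e1; rewrite !ffunE.
    by have -> : widen_ord le (Ordinal xn) = x by exact: val_inj.
  have xk : (x - n < k)%N by rewrite ltn_subLR // (leq_trans (ltn_ord x)).
  have := congr1 (fun f : {ffun 'I_k -> 'I_k} => f (Ordinal xk)) e2; rewrite !ffunE /= subnKC //.
  by have -> : insubd (Ordinal n0) (val x) = x by exact: valKd.
rewrite -(card_imset _ gi).
have -> : (#|A| * k ^ k)%N = #|setX A [set: {ffun 'I_k -> 'I_k}]%SET|.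
  by rewrite cardsX cardsT card_ffun card_ord.
apply: subset_leq_card; apply/fintype.subsetP => _ /imsetP[s sX ->].
by rewrite inE /= inE andbT; move: sX; rewrite inE.
Qed.

Section Transfer.
Variables (R : realType) (n m k h : nat).
Local Notation n' := (k * h)%N.
Hypothesis n0 : (0 < n)%N.
Hypothesis nn' : (n <= n')%N.
Hypothesis n'n : (n' <= n + k)%N.
Hypothesis k2 : (1 < k)%N.
Hypothesis h0 : (0 < h)%N.
Local Notation V := 'I_n'.

Definition ncol (G : graph n) : nat := #|colorings_of k G|.
Definition wid (om : {ffun 'I_m -> 'I_n * 'I_n}) : {ffun 'I_m -> V * V} :=
  [ffun j => (widen_ord nn' (om j).1, widen_ord nn' (om j).2)].

Let cV : #|V| = n'. Proof. by rewrite card_ord. Qed.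
Let n'0 : (0 < n')%N. Proof. exact: leq_trans nn'. Qed.
Let N0 : 0 < n'%:R :> R. Proof. by rewrite ltr0n. Qed.
Let Nh : 0 < n'%:R - h%:R :> R. Proof. by rewrite subr_gt0 ltr_nat ltn_Pmull. Qed.
Let N1 : 0 <= n'%:R - 1 :> R. Proof. by rewrite subr_ge0 ler1n. Qed.
Local Notation r := ((n'%:R - 1) / (n'%:R - h%:R) : R).

Lemma widen_inj : injective (widen_ord nn').
Proof. by move=> x y e; apply: val_inj; exact: (congr1 val e). Qed.

Lemma wid_inj : injective wid.
Proof.
move=> om om' /ffunP e; apply/ffunP => j; have := e j; rewrite !ffunE => -[e1 e2].
by apply: injective_projections; apply: widen_inj; apply: val_inj.
Qed.

(** A balanced coloring of the padded vertex set with positive weight restricts to a proper coloring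
    of G, and at most k^k colorings have the same restriction. *)
Lemma Mom_le_ncol G om : presents G om ->
  Mom R k h (wid om) <= r ^+ m * (ncol G * k ^ k)%:R / #|bal k h V|%:R.
Proof.
move=> pG; rewrite /Mom /avg; apply: ler_wpM2r; first by rewrite invr_ge0.
have r0 : 0 <= r by rewrite divr_ge0 // ltW.
apply: (@le_trans _ _ (\sum_(s : {ffun V -> 'I_k} | [ffun x => s (widen_ord nn' x)] \in colorings_of k G) r ^+ m)).
  rewrite big_mkcond [X in _ <= X]big_mkcond /=; apply: ler_sum => s _.
  have rm : 0 <= r ^+ m by rewrite exprn_ge0.
  case: ifP => _; last by case: ifP.
  under eq_bigr do rewrite /kst.
  rewrite big_split /= prodr_const card_ord.
  have [/forallP H|/forallPn [j Hj]] := boolP [forall j, s (wid om j).1 != s (wid om j).2].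
    rewrite (presents_proper pG); last by move=> j; have := H j; rewrite !ffunE.
    by rewrite big1 ?mul1r // => j _; rewrite H.
  rewrite (bigD1 j) //= (negbTE Hj) !mul0r; by case: ifP.
rewrite sumr_cst mulrC; apply: ler_wpM2l; first by rewrite exprn_ge0.
rewrite ler_nat; apply: leq_trans (card_restrict nn' (colorings_of k G) n'0 n'n).
by rewrite cardsE.
Qed.

(** Simple graphs are compared with sequences by counting alone: the presentations of different
    graphs are disjoint, have no loops, and all make [Mom] small, so they are part of one event of
    the base law. *)
Lemma bad_graphs (B : {set graph n}) (e0 : R) :
  B \subset graphs_with n m ->
  (forall G, G \in B -> r ^+ m * (ncol G * k ^ k)%:R / #|bal k h V|%:R < e0) ->
  #|B|%:R * (m`! * 2 ^ m)%:R <= (n'%:R * (n'%:R - 1)) ^+ m *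
    pw (kerw R (@id V) 1) (fun om : {ffun 'I_m -> V * V} => (Mom R k h om < e0)%R%:R).
Proof.
move=> /fintype.subsetP Bm Be.
have x0 : 'I_n := Ordinal n0.
pose nl (om : {ffun 'I_m -> V * V}) : R := \prod_j ((om j).1 != (om j).2)%:R.
have nl0 om : 0 <= nl om by apply: prodr_ge0.
have -> : (n'%:R * (n'%:R - 1)) ^+ m *
    pw (kerw R (@id V) 1) (fun om : {ffun 'I_m -> V * V} => (Mom R k h om < e0)%R%:R) =
    \sum_(om : {ffun 'I_m -> V * V}) (Mom R k h om < e0)%R%:R * nl om.
  rewrite /pw mulr_sumr; apply: eq_bigr => om _; rewrite mulrCA; congr (_ * _).
  under eq_bigr do rewrite /kerw cV.
  rewrite big_split /= prodr_const card_ord mulrCA -exprMn.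
  have N2 : (1 < n')%N by rewrite (leq_trans k2) // leq_pmulr.
  by rewrite mulfV ?expr1n ?mulr1 // mulf_neq0 // lt0r_neq0 // subr_gt0 ltr1n.
apply: (@le_trans _ _ (\sum_(om : {ffun 'I_m -> 'I_n * 'I_n}) (Mom R k h (wid om) < e0)%R%:R * nl (wid om))); last first.
  rewrite -(big_imset (fun om => (Mom R k h om < e0)%R%:R * nl om) (fun x y _ _ => @wid_inj x y)) /=.
  rewrite big_mkcond /=; apply: ler_sum => om _; case: ifP => // _.
  by rewrite mulr_ge0.
apply: (@le_trans _ _ (\sum_(G in B) \sum_(om : {ffun 'I_m -> 'I_n * 'I_n}) (presents G om)%:R)).
  rewrite mulrC mulr_natr -sumr_const; apply: ler_sum => G GB.
  apply: le_trans (_ : (#|[set om : {ffun 'I_m -> 'I_n * 'I_n} | presents G om]%SET|)%:R <= _).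
    by rewrite ler_nat; apply: card_presents => //; exact: Bm.
  rewrite -sum1_card natr_sum big_mkcond /=; apply: ler_sum => om _.
  by rewrite inE; case: ifP.
rewrite exchange_big /=; apply: ler_sum => om _.
have [G /andP[GB pG]|H] := pickP (fun G => (G \in B) && presents G om); last first.
  rewrite big1 ?mulr_ge0 // => G GB; have := H G; rewrite GB /= => ->; by [].
rewrite (bigD1 G) //= big1 ?addr0 => [|G' /andP[_ ne]]; last first.
  by case: (boolP (presents G' om)) => // pG'; case/eqP: ne; exact: presents_uniq pG' pG.
rewrite (le_lt_trans (Mom_le_ncol pG) (Be _ GB)) pG mul1r /nl big1 // => j _.
rewrite ffunE /= (inj_eq widen_inj) (presents_nonloop _ pG) //.
Qed.

End Transfer.

(** * Counting graphs and bichromatic pairs *)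

Section GraphCounts.
Variables (n m : nat).

Definition pairs : {set {set 'I_n}} := [set e : {set 'I_n} | #|e| == 2]%SET.

Lemma card_graphs_sub (P : {set {set 'I_n}}) : P \subset pairs ->
  #|[set G in graphs_with n m | edges G \subset P]%SET| = 'C(#|P|, m).
Proof.
move=> /fintype.subsetP P2; rewrite -cards_draws -(card_imset _ (val_inj : injective (@edges n))).
apply: eq_card => E; apply/imsetP/idP => [[G + ->]|]; first by rewrite !inE andbC.
rewrite inE => /andP[EP Em].
have p : [forall e in E, #|e| == 2].
  by apply/forall_inP => e eE; have := P2 e (fintype.subsetP EP e eE); rewrite inE.
by exists (Graph p) => //; rewrite !inE /= Em.
Qed.

Lemma card_graphs_with : #|graphs_with n m| = 'C('C(n, 2), m).
Proof.
rewrite -[in RHS](card_ord n) -card_draws -(card_graphs_sub (subxx pairs)).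
apply: eq_card => G; rewrite !inE; case: eqP => //= _; apply/esym/fintype.subsetP => e eG.
by rewrite inE (edge_card eG).
Qed.

Variable k : nat.

Definition bipairs (s : coloring k n) : {set {set 'I_n}} :=
  [set e in pairs | [forall x, forall y, (e == [set x; y]%SET) ==> (s x != s y)]]%SET.

Lemma proper_bipairs (G : graph n) (s : coloring k n) :
  proper_coloring G s = (edges G \subset bipairs s).
Proof.
apply/forallP/fintype.subsetP => [H e eG|H x].
  rewrite !inE (edge_card eG) /=; apply/forallP => x; apply/forallP => y; apply/implyP => /eqP exy.
  by have /forallP/(_ y)/implyP := H x; apply; rewrite /adj -exy.
apply/forallP => y; apply/implyP => a; have := H _ a; rewrite !inE => /andP[_ /forallP/(_ x)/forallP/(_ y)].
by rewrite eqxx.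
Qed.

(** By convexity the monochromatic ordered pairs number at least n^2/k, whatever the class sizes.
    The bound is therefore valid for unbalanced colorings too, as the planted model requires. *)
Lemma card_bipairs (R : realType) (s : coloring k n) : (0 < k)%N ->
  #|bipairs s|%:R <= (1 - k%:R^-1) * (n%:R ^+ 2 / 2) :> R.
Proof.
move=> k0; have [n0|n0] := posnP n.
  rewrite (eq_card0 (A := bipairs s)) ?mulr_ge0 ?divr_ge0 ?sqr_ge0 ?subr_ge0 ?invf_le1 ?ler1n ?ltr0n // => e.
  rewrite !inE; apply/negbTE; rewrite negb_and; apply/orP; left.
  by apply/eqP => e2; have := max_card (mem e); rewrite e2 card_ord n0.
have K0 : 0 < k%:R :> R by rewrite ltr0n.
pose x0 : 'I_n := Ordinal n0.
pose D := [set p : 'I_n * 'I_n | s p.1 != s p.2]%SET.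
have h1 : (#|bipairs s| * 2 <= #|D|)%N.
  pose g (p : {set 'I_n} * bool) := if p.2 then (lo x0 p.1, hi x0 p.1) else (hi x0 p.1, lo x0 p.1).
  have lh e : e \in bipairs s -> e = [set lo x0 e; hi x0 e]%SET /\ lo x0 e != hi x0 e.
    by rewrite !inE => /andP[/eqP e2 _]; exact: lo_hi.
  have gi : {in setX (bipairs s) [set: bool]%SET &, injective g}.
    move=> [e b] [e' b'] /setXP[/= eb _] /setXP[/= eb' _].
    have [e1 ne] := lh e eb; have [e2 ne'] := lh e' eb'.
    have ends_g (d : {set 'I_n}) (c : bool) : ends (g (d, c)) = [set lo x0 d; hi x0 d]%SET.
      by rewrite /ends /g; case: c => //=; rewrite setUC.
    move=> gg; have ee : e = e' by rewrite e1 e2 -(ends_g e b) -(ends_g e' b') gg.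
    subst e'; congr (_, _); move: gg; rewrite /g /=.
    by case: b; case: b' => // -[] /eqP; rewrite ?(negbTE ne) // eq_sym (negbTE ne).
  have := card_in_imset gi; rewrite cardsX cardsT card_bool => <-.
  apply: subset_leq_card; apply/fintype.subsetP => _ /imsetP[[e b] /setXP[/= eb _] ->].
  have [e1 ne] := lh e eb; move: eb; rewrite !inE => /andP[_ /forallP H].
  have slh : s (lo x0 e) != s (hi x0 e) by have /forallP/(_ (hi x0 e)) := H (lo x0 e); rewrite -e1 eqxx.
  by rewrite /g; case: b => //=; rewrite eq_sym.
pose a (i : 'I_k) : R := #|[set x | s x == i]%SET|%:R.
have suma : \sum_i a i = n%:R.
  rewrite /a -natr_sum; congr (_%:R); rewrite -[RHS](card_ord n) -sum1_card (partition_big s xpredT) //=.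
  by apply: eq_bigr => i _; rewrite sum1_card cardsE.
have DE : #|D|%:R = n%:R ^+ 2 - \sum_i a i ^+ 2 :> R.
  rewrite -sum1_card natr_sum big_mkcond /=.
  rewrite (eq_bigr (fun p : 'I_n * 'I_n => (s p.1 != s p.2)%:R)) => [|p _]; last by rewrite inE; case: ifP.
  rewrite -(pair_bigA _ (fun x y => (s x != s y)%:R)) /=.
  transitivity (\sum_x (n%:R - a (s x))).
    have ns : n%:R = \sum_(y < n) 1 :> R by rewrite sumr_cst card_ord mulr1.
    apply: eq_bigr => x _; rewrite ns /a -sum1_card natr_sum [X in _ - X]big_mkcond -sumrB.
    by apply: eq_bigr => y _; rewrite inE eq_sym; case: eqP => _; rewrite ?subrr ?subr0.
  rewrite sumrB sumr_cst card_ord -expr2; congr (_ - _).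
  rewrite (partition_big s xpredT) //=; apply: eq_bigr => i _.
  rewrite (eq_bigr (fun=> a i)) => [|x /eqP -> //].
  by rewrite sumr_cst expr2 /a cardsE.
have cs : n%:R ^+ 2 / k%:R <= \sum_i a i ^+ 2.
  have : 0 <= \sum_i (a i - n%:R / k%:R) ^+ 2 by apply: sumr_ge0 => i _; exact: sqr_ge0.
  under eq_bigr do rewrite sqrrB.
  rewrite big_split /= sumrB sumr_cst card_ord sumrMnl -mulr_suml suma.
  have -> : k%:R * (n%:R / k%:R) ^+ 2 = n%:R ^+ 2 / k%:R :> R by field; rewrite lt0r_neq0.
  have -> : n%:R * (n%:R / k%:R) *+ 2 = 2 * (n%:R ^+ 2 / k%:R) :> R by ring.
  lra.
have : #|bipairs s|%:R * 2 <= #|D|%:R :> R by rewrite -natrM ler_nat.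
rewrite DE => h2.
have -> : (1 - k%:R^-1) * (n%:R ^+ 2 / 2) = (n%:R ^+ 2 - n%:R ^+ 2 / k%:R) / 2 :> R by ring.
lra.
Qed.

End GraphCounts.

Section Asymptotics.
Variable R : realType.

Lemma expRN2_le (x : R) : 0 <= x <= 1 / 2 -> expR (- (2 * x)) <= 1 - x.
Proof.
move=> /andP[x0 x1]; rewrite expRN -div1r ler_pdivrMr ?expR_gt0 //.
have h := expR_ge1Dx (2 * x); have x2 : 0 <= 1 - x by lra.
have : (1 - x) * (1 + 2 * x) <= (1 - x) * expR (2 * x) by rewrite ler_wpM2l.
nra.
Qed.

Lemma bin2R (n : nat) : 'C(n, 2)%:R * 2 = n%:R * (n%:R - 1) :> R.
Proof.
have := bin_ffact n 2; rewrite ffactnS ffactn1 => /(congr1 (fun x : nat => x%:R : R)).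
rewrite !natrM => ->; case: n => [|n]; first by rewrite !mul0r.
by congr (_ * _); rewrite -[n.+1%:R]natr1 addrK.
Qed.

Lemma bin2_ge (n : nat) : (1 < n)%N -> n%:R ^+ 2 / 4 <= 'C(n, 2)%:R :> R.
Proof.
move=> n1; have N2 : 2 <= n%:R :> R by rewrite ler_nat.
have := bin2R n; move: (n%:R : R) ('C(n, 2)%:R : R) N2 => x y x2 e; nra.
Qed.

(** With m = O(n) draws from about n^2/2 pairs, the chance that all are distinct stays bounded
    below, since m^2 divided by the number of pairs is bounded. *)
Lemma bin_lower (T : R) (n m : nat) : 8 * T <= n%:R -> 0 <= T -> (1 < n)%N -> m%:R <= T * n%:R ->
  ('C(n, 2)%:R : R) ^+ m * expR (- (8 * T ^+ 2)) <= ('C('C(n, 2), m) * m`!)%:R.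
Proof.
move=> Tn T0 n1 mT; have n0 : 0 < n%:R :> R by rewrite ltr0n ltnW.
have Ng := bin2_ge n1; set N := 'C(n, 2) in Ng *.
have N0 : 0 < N%:R :> R by apply: lt_le_trans Ng; rewrite divr_gt0 // exprn_gt0.
have m0 : 0 <= m%:R :> R by [].
have mN2 : m%:R <= N%:R / 2 :> R.
  apply: le_trans mT _; have : T * n%:R <= n%:R / 8 * n%:R by rewrite ler_pM2r //; lra.
  rewrite expr2 in Ng; lra.
have mN : (m <= N)%N by rewrite -(ler_nat R); lra.
rewrite bin_ffact; apply: (@le_trans _ _ (((N - m) ^ m)%:R)); last first.
  rewrite ler_nat ffact_prod -[X in (_ ^ X)%N](card_ord m) -prod_nat_const.
  by apply: leq_prod => i _; rewrite leq_sub2l // ltnW.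
rewrite natrX natrB //.
have -> : (N%:R - m%:R) ^+ m = N%:R ^+ m * (1 - m%:R / N%:R) ^+ m :> R.
  by rewrite -exprMn; congr (_ ^+ _); field; rewrite lt0r_neq0.
apply: ler_wpM2l; first by rewrite exprn_ge0.
apply: (@le_trans _ _ (expR (- (2 * (m%:R / N%:R))) ^+ m)); last first.
  apply: lerXn2r; rewrite ?nnegrE ?expR_ge0 //.
    by rewrite subr_ge0 ler_pdivrMr // mul1r ler_nat.
  apply: expRN2_le; rewrite divr_ge0 //= ler_pdivrMr //; lra.
rewrite -expRM_natl ler_expR mulrN lerN2.
have -> : m%:R * (2 * (m%:R / N%:R)) = 2 * m%:R ^+ 2 / N%:R :> R by ring.
rewrite ler_pdivrMr //.
have : m%:R ^+ 2 <= (T * n%:R) ^+ 2 :> R by apply: lerXn2r; rewrite ?nnegrE ?mulr_ge0.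
have : 8 * T ^+ 2 * (n%:R ^+ 2 / 4) <= 8 * T ^+ 2 * N%:R by rewrite ler_wpM2l // mulr_ge0 // sqr_ge0.
rewrite exprMn; lra.
Qed.

Lemma pow_ratio (T : R) (n m : nat) : (1 < n)%N -> m%:R <= T * n%:R ->
  (n%:R ^+ 2 / 2) ^+ m <= expR (2 * T) * ('C(n, 2)%:R) ^+ m :> R.
Proof.
move=> n1 mT; have n0 : 0 < n%:R :> R by rewrite ltr0n ltnW.
have N2 : 2 <= n%:R :> R by rewrite ler_nat.
apply: (@le_trans _ _ ((expR (2 / n%:R) * 'C(n, 2)%:R) ^+ m)).
  apply: lerXn2r; rewrite ?nnegrE ?mulr_ge0 ?expR_ge0 ?divr_ge0 ?sqr_ge0 //.
  have : expR (- (2 * (n%:R : R)^-1)) <= 1 - n%:R^-1.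
    by apply: expRN2_le; rewrite invr_ge0 ler0n /= div1r lef_pV2 ?posrE.
  rewrite expRN => h; rewrite -ler_pdivrMl ?expR_gt0 //.
  apply: (@le_trans _ _ ((1 - n%:R^-1) * (n%:R ^+ 2 / 2))).
    by apply: ler_wpM2r => //; rewrite divr_ge0 ?sqr_ge0.
  have := bin2R n => e; apply: ler_of_eq.
  apply: (@mulIf _ 2) => //; rewrite e; by field; rewrite lt0r_neq0.
rewrite exprMn; apply: ler_wpM2r; first by rewrite exprn_ge0.
rewrite -expRM_natl ler_expR mulrCA ler_pM2l // ler_pdivrMr //.
Qed.

End Asymptotics.

Lemma Pr_Gnm (R : realType) (n m : nat) (B : {set graph n}) :
  Pr (@Gnm R n m) B = #|B :&: graphs_with n m|%:R / #|graphs_with n m|%:R.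
Proof.
transitivity (\sum_(G in B :&: graphs_with n m) (#|graphs_with n m|%:R : R)^-1); last first.
  by rewrite sumr_const -[LHS]mulr_natl.
rewrite /Pr /Gnm /uniform_mass big_mkcond [RHS]big_mkcond /=.
by apply: eq_bigr => G _; rewrite in_setI; case: (G \in B).
Qed.

(** * Lower tail of the number of colorings of G(n,m) *)

Section ManyColorings.
Variables (R : realType) (k : nat) (T : R).
Hypothesis k2 : (1 < k)%N.
Hypothesis T0 : 0 <= T.
Hypothesis Hmom : forall eps : R, 0 < eps -> exists2 e0 : R, 0 < e0 & exists h0 : nat,
  forall (h : nat) (V : finType) (m : nat), (h0 <= h)%N -> #|V| = (k * h)%N -> m%:R <= T * (k * h)%:R ->
  pw (kerw R (@id V) 1) (fun om : {ffun 'I_m -> V * V} => (Mom R k h om < e0)%R%:R) <= eps.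
Local Notation q := (1 - k%:R^-1 : R).

Let K0 : 0 < k%:R :> R. Proof. by rewrite ltr0n ltnW. Qed.
Let q0 : 0 < q. Proof. by rewrite subr_gt0 invf_lt1 ?ltr1n. Qed.

Definition thr (c : R) (n m : nat) : R := c * (k%:R ^+ n * q ^+ m) / (n + k)%:R ^+ k.

Lemma ncol_lower (eta : R) : 0 < eta -> exists2 c : R, 0 < c & exists n0 : nat,
  forall n m : nat, (n0 <= n)%N -> m%:R <= T * n%:R ->
  Pr (@Gnm R n m) [set G : graph n | ((ncol k G)%:R < thr c n m)%R]%SET <= eta.
Proof.
move=> eta0.
(* The three factors bound the cost of padding to at most n + k vertices, of replacing n^2/2 by the
   binomial coefficient, and of forbidding repeated pairs. Asking for probability [eta / Kr] for
   sequences pays for all of them. *)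
pose Kr := expR (2 * k%:R * T) * expR (2 * T) * expR (8 * T ^+ 2).
have Kr0 : 0 < Kr by rewrite !mulr_gt0 ?expR_gt0.
have ek : 0 < eta / Kr by rewrite divr_gt0.
have [e0 e00 [h0 H]] := Hmom ek.
have cm0 : 0 < cmult k R 1 by apply: cmult1_gt0; exact: ltnW.
pose c := e0 * cmult k R 1 / k%:R ^+ k.
have kk0 : 0 < k%:R ^+ k :> R by rewrite exprn_gt0.
have c0 : 0 < c by rewrite divr_gt0 // mulr_gt0.
exists c => //.
exists (maxn 2 (maxn (k * h0) (Num.truncn (8 * T)).+1)) => n m.
rewrite !geq_max => /andP[n2 /andP[nh nT]] mT.
have n0 : (0 < n)%N by exact: ltnW.
have k0 : (0 < k)%N by exact: ltnW.
pose h := (n %/ k).+1.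
have hh0 : (h0 <= h)%N by rewrite /h leqW // leq_divRL // mulnC.
have nn' : (n <= k * h)%N by rewrite /h mulnC ltnW // ltn_ceil.
have n'n : (k * h <= n + k)%N by rewrite /h mulnS addnC leq_add2r mulnC leq_trunc_div.
have n'0 : (0 < k * h)%N by exact: leq_trans nn'.
have cV : #|'I_(k * h)| = (k * h)%N by rewrite card_ord.
have mT' : m%:R <= T * (k * h)%:R by apply: le_trans mT _; rewrite ler_wpM2l // ler_nat.
have := H h 'I_(k * h)%N m hh0 cV mT'; set P := pw _ _ => HP.
set B := finset _; rewrite Pr_Gnm; set B' := B :&: _.
have n'R : 0 < (k * h)%:R :> R by rewrite ltr0n.
have n8 : 8 * T <= n%:R.
  by apply: ltW; apply: lt_le_trans (truncnS_gt _) _; rewrite ler_nat.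
have Nh : 0 < (k * h)%:R - h%:R :> R by rewrite subr_gt0 ltr_nat ltn_Pmull.
have Be G : G \in B' -> (((k * h)%:R - 1) / ((k * h)%:R - h%:R)) ^+ m * (ncol k G * k ^ k)%:R /
    #|bal k h 'I_(k * h)|%:R < e0.
  rewrite !inE => /andP[ZG _].
  have r0 : 0 <= ((k * h)%:R - 1) / ((k * h)%:R - h%:R) :> R.
    by rewrite divr_ge0 ?(ltW Nh) // subr_ge0 ler1n.
  have rq : ((k * h)%:R - 1) / ((k * h)%:R - h%:R) <= q^-1 :> R.
    rewrite ler_pdivrMr // natrM; have -> : q^-1 * (k%:R * h%:R - h%:R) = k%:R * h%:R :> R.
      by field; rewrite !lt0r_neq0 // subr_gt0 ltr1n.
    by rewrite gerBl.
  have hb : cmult k R 1 * k%:R ^+ n / (n + k)%:R ^+ k <= #|bal k h 'I_(k * h)|%:R.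
    have := @card_bal_ge k h 'I_(k * h) cV R k0 (ltn0Sn _).
    rewrite ler_pdivlMr ?exprn_gt0 //; apply: le_trans; rewrite mulrAC; apply: ler_pM.
    - by rewrite divr_ge0 ?exprn_ge0 // ltW.
    - by rewrite exprn_ge0.
    - rewrite ler_pM2l // lef_pV2 ?posrE ?exprn_gt0 ?ltr0n ?addn_gt0 ?n0 //.
      apply: lerXn2r; rewrite ?nnegrE // ler_nat; apply: leq_trans n'n; exact: leq_pmull.
    - by apply: ler_weXn2l; rewrite ?ler1n.
  have X0 : 0 < cmult k R 1 * k%:R ^+ n / (n + k)%:R ^+ k.
    have nkR : 0 < (n + k)%:R :> R by rewrite ltr0n addn_gt0 n0.
    exact: (divr_gt0 (mulr_gt0 cm0 (exprn_gt0 n K0)) (exprn_gt0 k nkR)).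
  have b0 := lt_le_trans X0 hb.
  rewrite ltr_pdivrMr //; apply: lt_le_trans (_ : e0 * (cmult k R 1 * k%:R ^+ n / (n + k)%:R ^+ k) <= _); last first.
    by rewrite ler_pM2l.
  rewrite [(ncol k G * _)%:R]natrM natrX.
  apply: (@le_lt_trans _ _ (q^-1 ^+ m * ((ncol k G)%:R * k%:R ^+ k))).
    apply: ler_wpM2r; first by rewrite mulr_ge0 // exprn_ge0.
    by apply: lerXn2r; rewrite ?nnegrE // invr_ge0 ltW.
  have qm : 0 < q ^+ m by rewrite exprn_gt0.
  rewrite exprVn ltr_pdivrMl // -ltr_pdivlMr //; apply: lt_le_trans ZG _.
  rewrite /thr /c; apply: ler_of_eq.
  have nk : (n + k)%:R ^+ k != 0 :> R by rewrite expf_neq0 // pnatr_eq0 -lt0n addn_gt0 n0.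
  move: ((n + k)%:R ^+ k) (k%:R ^+ n) (q ^+ m) nk => x1 x2 x3 x10.
  by field; rewrite x10 lt0r_neq0.
have := bad_graphs n0 nn' n'n k2 (ltn0Sn _) (subsetIr _ _ : B' \subset graphs_with n m) Be.
rewrite -/P => bg.
have Cb := bin_lower n8 T0 n2 mT; have pr := pow_ratio n2 mT.
rewrite card_graphs_with.
have N0 : 0 < 'C(n, 2)%:R :> R by rewrite ltr0n bin_gt0.
have C0 : 0 < ('C('C(n, 2), m) * m`!)%:R :> R.
  by apply: lt_le_trans Cb; rewrite mulr_gt0 ?expR_gt0 // exprn_gt0.
have [C1 m1] : 0 < 'C('C(n, 2), m)%:R :> R /\ 0 < m`!%:R :> R.
  by split; [move: C0; rewrite !ltr0n muln_gt0 => /andP[]|rewrite ltr0n fact_gt0].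
have m2 : 0 < 2 ^+ m :> R by rewrite exprn_gt0.
have m3 : 0 < (m`! * 2 ^ m)%:R :> R by rewrite natrM natrX mulr_gt0.
rewrite ler_pdivrMr // -(ler_pM2r m3); apply: le_trans bg _.
apply: (@le_trans _ _ (((n + k)%:R ^+ 2) ^+ m * (eta / Kr))).
  apply: ler_pM => //; first by rewrite exprn_ge0 // mulr_ge0 // subr_ge0 ler1n.
    by apply: pw_ge0 => // e; apply: kerw_ge0; rewrite ?card_ord //; [exact: fib_id|rewrite (leq_trans n2)].
  apply: lerXn2r; rewrite ?nnegrE ?sqr_ge0 ?mulr_ge0 // ?subr_ge0 ?ler1n // expr2.
  apply: ler_pM; rewrite ?subr_ge0 ?ler1n ?ler_nat //.
  by apply: (@le_trans _ _ (k * h)%:R); [rewrite gerBl|rewrite ler_nat].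
have nR : 0 < n%:R :> R by rewrite ltr0n.
have g1 : ((n + k)%:R ^+ 2) ^+ m <= expR (2 * k%:R * T) * (n%:R ^+ 2) ^+ m :> R.
  have : (n + k)%:R ^+ 2 <= expR (2 * k%:R / n%:R) * n%:R ^+ 2 :> R.
    have -> : (n + k)%:R = (1 + k%:R / n%:R) * n%:R :> R by rewrite natrD; field; rewrite lt0r_neq0.
    rewrite exprMn; apply: ler_wpM2r; first exact: sqr_ge0.
    have -> : 2 * k%:R / n%:R = 2%:R * (k%:R / n%:R) :> R by rewrite mulrA.
    rewrite expRM_natl; apply: lerXn2r; rewrite ?nnegrE ?expR_ge0 ?addr_ge0 ?divr_ge0 //; exact: expR_ge1Dx.
  move=> h1; have := lerXn2r m _ _ h1; rewrite !nnegrE sqr_ge0 mulr_ge0 ?expR_ge0 ?sqr_ge0 // => /(_ isT isT).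
  move=> h2; apply: le_trans h2 _; rewrite exprMn; apply: ler_wpM2r; first by rewrite exprn_ge0 // sqr_ge0.
  rewrite -expRM_natl ler_expR.
  have -> : m%:R * (2 * k%:R / n%:R) = 2 * k%:R * (m%:R / n%:R) :> R by ring.
  by apply: ler_wpM2l; [rewrite mulr_ge0|rewrite ler_pdivrMr].
have g2 : (n%:R ^+ 2) ^+ m = (n%:R ^+ 2 / 2) ^+ m * 2 ^+ m :> R by rewrite -exprMn divfK.
apply: (@le_trans _ _ (expR (2 * k%:R * T) * ((expR (2 * T) * ('C(n, 2)%:R) ^+ m) * 2 ^+ m) * (eta / Kr))).
  apply: ler_wpM2r; first by rewrite ltW.
  apply: le_trans g1 _; rewrite g2 ler_pM2l ?expR_gt0 // ler_pM2r //.
have e8 : expR (- (8 * T ^+ 2)) = (expR (8 * T ^+ 2))^-1 by rewrite expRN.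
have -> : expR (2 * k%:R * T) * (expR (2 * T) * 'C(n, 2)%:R ^+ m * 2 ^+ m) * (eta / Kr) =
   eta * ('C(n, 2)%:R ^+ m * expR (- (8 * T ^+ 2))) * 2 ^+ m :> R.
  rewrite e8 /Kr; field; by rewrite !lt0r_neq0 ?expR_gt0.
have -> : eta * 'C('C(n, 2), m)%:R * (m`! * 2 ^ m)%:R = eta * ('C('C(n, 2), m) * m`!)%:R * 2 ^+ m :> R.
  by rewrite !natrM natrX; ring.
by rewrite ler_pM2r // ler_pM2l.
Qed.

End ManyColorings.

(** * Planted and uniform pairs *)

Lemma uniform_mass_ge0 (R : realType) (T : finType) (A : {set T}) x : 0 <= uniform_mass R A x.
Proof. by rewrite /uniform_mass; case: ifP => // _; rewrite invr_ge0. Qed.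

Lemma sum_uniform_mass (R : realType) (T : finType) (A : {set T}) : \sum_x uniform_mass R A x <= 1.
Proof.
rewrite /uniform_mass -big_mkcond /= sumr_const -[_ *+ _]mulr_natr.
have [->|A0] := eqVneq #|A| 0%N; first by rewrite mulr0.
by rewrite mulVf // pnatr_eq0.
Qed.

Lemma Pr_ge0 (R : realType) (T : finType) (mu : T -> R) A : (forall x, 0 <= mu x) -> 0 <= Pr mu A.
Proof. by move=> h; apply: sumr_ge0. Qed.

Lemma Pr_mono (R : realType) (T : finType) (mu : T -> R) (A B : {set T}) :
  (forall x, 0 <= mu x) -> A \subset B -> Pr mu A <= Pr mu B.
Proof.
move=> h /fintype.subsetP AB; rewrite /Pr big_mkcond [X in _ <= X]big_mkcond; apply: ler_sum => x _.
by case: ifP => [/AB ->|_]; last case: ifP.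
Qed.

Lemma Pr_setID (R : realType) (T : finType) (mu : T -> R) (A B : {set T}) :
  Pr mu A = Pr mu (B :&: A) + Pr mu (A :\: B).
Proof.
rewrite /Pr (bigID (mem B)) /=; congr (_ + _); apply: eq_bigl => x; rewrite !inE; first by rewrite andbC.
by rewrite andbC.
Qed.

Section OneSize.
Variables (R : realType) (k n m : nat).
Hypothesis k2 : (1 < k)%N.
Hypothesis n0 : (0 < n)%N.
Local Notation q := (1 - k%:R^-1 : R).
Local Notation gw := (graphs_with n m).

Lemma Pnm_ge0 p : 0 <= @Pnm R k n m p.
Proof. by rewrite mulr_ge0 ?uniform_mass_ge0. Qed.

Lemma Unm_ge0 p : 0 <= @Unm R k n m p.
Proof. by rewrite mulr_ge0 ?uniform_mass_ge0. Qed.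

Lemma Pr_Pnm_le1 A : Pr (@Pnm R k n m) A <= 1.
Proof.
apply: le_trans (Pr_mono Pnm_ge0 (subsetT A)) _; rewrite /Pr.
under eq_bigl do rewrite inE.
rewrite -(pair_bigA _ (fun G s => @Pnm R k n m (G, s))) /= exchange_big /=.
apply: le_trans (sum_uniform_mass R [set: coloring k n]%SET); apply: ler_sum => s _.
rewrite /Pnm /= -mulr_sumr ler_piMr ?uniform_mass_ge0 //; exact: sum_uniform_mass.
Qed.

Lemma Pr_Unm_le1 A : Pr (@Unm R k n m) A <= 1.
Proof.
apply: le_trans (Pr_mono Unm_ge0 (subsetT A)) _; rewrite /Pr.
under eq_bigl do rewrite inE.
rewrite -(pair_bigA _ (fun G s => @Unm R k n m (G, s))) /=.
apply: le_trans (sum_uniform_mass R gw); apply: ler_sum => G _.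
rewrite /Unm /= -mulr_sumr ler_piMr ?uniform_mass_ge0 //; exact: sum_uniform_mass.
Qed.

Let K0 : 0 < k%:R :> R. Proof. by rewrite ltr0n ltnW. Qed.
Let q0 : 0 < q. Proof. by rewrite subr_gt0 invf_lt1 ?ltr1n. Qed.
(** An upper bound for the number of m-edge graphs compatible with any one coloring. *)
Let X : R := (q * (n%:R ^+ 2 / 2)) ^+ m / m`!%:R.
Let X0 : 0 < X.
Proof.
have nR : 0 < n%:R :> R by rewrite ltr0n.
by rewrite divr_gt0 ?ltr0n ?fact_gt0 // exprn_gt0 // mulr_gt0 // divr_gt0 // exprn_gt0.
Qed.

Lemma Pnm_lower p : p \in Lambda k n m -> (k%:R ^+ n * X)^-1 <= @Pnm R k n m p.
Proof.
case: p => G s; rewrite inE /= => /andP[Gm pG].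
rewrite /Pnm /uniform_mass !inE /= cardsT card_ffun !card_ord natrX.
move: (Gm); rewrite inE => ->; rewrite pG /= invfM; apply: ler_wpM2l; first by rewrite invr_ge0 exprn_ge0.
have -> : #|[set G0 in gw | proper_coloring G0 s]%SET| = 'C(#|bipairs s|, m).
  rewrite -card_graphs_sub; last by apply/fintype.subsetP => e; rewrite inE => /andP[].
  by apply: eq_card => H; rewrite !inE proper_bipairs.
have c0 : (0 < 'C(#|bipairs s|, m))%N.
  rewrite -card_graphs_sub; last by apply/fintype.subsetP => e; rewrite inE => /andP[].
  by apply/card_gt0P; exists G; rewrite inE Gm -proper_bipairs.
rewrite lef_pV2 ?posrE ?ltr0n // ler_pdivlMr ?ltr0n ?fact_gt0 // -natrM bin_ffact.
apply: (@le_trans _ _ (#|bipairs s|%:R ^+ m)); last first.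
  apply: lerXn2r; rewrite ?nnegrE //; last by apply: card_bipairs; exact: ltnW.
  by rewrite mulr_ge0 ?(ltW q0) // divr_ge0 // sqr_ge0.
rewrite -natrX ler_nat ffact_prod -[X in (_ ^ X)%N](card_ord m) -prod_nat_const.
by apply: leq_prod => i _; exact: leq_subr.
Qed.

(** A lower bound on every planted weight converts planted probability into a count of pairs, while
    [ncol >= th] bounds the uniform weight of a pair from above. The graphs with fewer colorings are
    removed beforehand. *)
Lemma planted_transfer (D : {set graph n}) (E : {set graph n * coloring k n}) (f th : R) :
  E \subset Lambda k n m -> 0 < th -> (0 < #|gw|)%N ->
  1 - expR (- f) <= cPr (@Pnm R k n m) E (graph_event k D) ->
  Pr (@Gnm R n m) D - Pr (@Gnm R n m) [set G : graph n | ((ncol k G)%:R < th)%R]%SET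
    - expR (- f) * (k%:R ^+ n * X) / (#|gw|%:R * th) <= Pr (@Unm R k n m) E.
Proof.
move=> EL th0 g0 hc.
set DE := graph_event k D in hc.
have g0' : 0 < #|gw|%:R :> R by rewrite ltr0n.
have Y0 : 0 < k%:R ^+ n * X by rewrite mulr_gt0 // exprn_gt0.
pose bad := (Lambda k n m :&: DE) :\: E.
have bad1 : Pr (@Pnm R k n m) bad <= expR (- f).
  apply: (@le_trans _ _ (Pr (@Pnm R k n m) (DE :\: E))).
    by apply: Pr_mono; [exact: Pnm_ge0|apply: setSD; exact: subsetIr].
  have x1 := Pr_Pnm_le1 DE; have x0 := Pr_ge0 DE Pnm_ge0.
  have d := Pr_setID (@Pnm R k n m) DE E.
  have y0 := Pr_ge0 (E :&: DE) Pnm_ge0; have z0 := Pr_ge0 (DE :\: E) Pnm_ge0.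
  have ef := expR_ge0 (- f).
  move: hc; rewrite /cPr; move: (Pr _ DE) (Pr _ (E :&: DE)) (Pr _ (DE :\: E)) (expR _) x1 x0 d y0 z0 ef.
  (* If D has planted probability 0, the conditional probability is 0 by convention, but then the
     failing pairs in D have mass 0 anyway. *)
  move=> x y z e x1 x0 d y0 z0 ef; have [xz|xp] := eqVneq x 0; first by move=> _; lra.
  have {}xp : 0 < x by rewrite lt_neqAle eq_sym xp.
  rewrite ler_pdivlMr // => h; have : e * x <= e by rewrite ler_piMr.
  lra.
have badc : #|bad|%:R <= expR (- f) * (k%:R ^+ n * X).
  rewrite -ler_pdivrMr //; apply: le_trans bad1; rewrite /Pr mulrC mulr_natr -sumr_const.
  by apply: ler_sum => p; rewrite inE => /andP[_]; rewrite inE => /andP[pL _]; exact: Pnm_lower.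
pose C := [set p : graph n * coloring k n | [&& p \in Lambda k n m, p.1 \in D & (th <= (ncol k p.1)%:R)%R]]%SET.
have CU p : p \in Lambda k n m -> @Unm R k n m p = #|gw|%:R^-1 / (ncol k p.1)%:R.
  case: p => G s; rewrite inE /= => /andP[Gm pG].
  by rewrite /Unm /Gnm /uniform_mass /= Gm inE pG.
have step1 : Pr (@Unm R k n m) C <= Pr (@Unm R k n m) E + #|bad|%:R / (#|gw|%:R * th).
  rewrite (Pr_setID _ C E); apply: lerD; first by apply: Pr_mono; [exact: Unm_ge0|exact: subsetIl].
  apply: (@le_trans _ _ (\sum_(p in C :\: E) (#|gw|%:R * th)^-1)).
    apply: ler_sum => p; rewrite inE => /andP[_]; rewrite inE => /and3P[pL _ pt].
    have z0 : 0 < (ncol k p.1)%:R :> R by exact: lt_le_trans pt.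
    rewrite CU // invfM ler_pM2l ?invr_gt0 // lef_pV2 ?posrE //.
  rewrite sumr_const -[_ *+ _]mulr_natl; apply: ler_wpM2r; first by rewrite invr_ge0 mulr_ge0 // ltW.
  rewrite ler_nat; apply: subset_leq_card; apply/fintype.subsetP => p.
  by rewrite !in_setD in_setI !in_set => /andP[-> /and3P[-> -> _]].
have step2 : Pr (@Gnm R n m) D - Pr (@Gnm R n m) [set G : graph n | ((ncol k G)%:R < th)%R]%SET <= Pr (@Unm R k n m) C.
  have -> : Pr (@Unm R k n m) C = \sum_(G in D | (th <= (ncol k G)%:R)%R) @Gnm R n m G.
    rewrite /Pr big_mkcond /=.
    rewrite (eq_bigr (fun p => if (p.1, p.2) \in C then @Unm R k n m (p.1, p.2) else 0)) => [|[G s] _ //].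
    rewrite -(pair_bigA _ (fun G s => if (G, s) \in C then @Unm R k n m (G, s) else 0)) /=.
    rewrite [RHS]big_mkcond /=; apply: eq_bigr => G _.
    case: ifP => [/andP[GD Gt]|nG]; last first.
      by rewrite big1 // => s _; rewrite inE /= nG andbF.
    rewrite -big_mkcond /= /Gnm /uniform_mass; case: ifP => Gm; last first.
      by rewrite big1 // => s; rewrite in_set /= [_ \in Lambda _ _ _]in_set /= Gm.
    have z0 : 0 < (ncol k G)%:R :> R by exact: lt_le_trans Gt.
    rewrite (eq_bigr (fun=> #|gw|%:R^-1 / (ncol k G)%:R)) => [|s]; last first.
      by rewrite inE => /and3P[pL _ _]; rewrite CU.
    rewrite sumr_cst.
    have -> : #|[pred s | (G, s) \in C]| = ncol k G.
      by apply: eq_card => s; rewrite [LHS]unfold_in in_set /= [_ \in Lambda _ _ _]in_set /= Gm GD Gt /= andbT [RHS]in_set.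
    by rewrite mulrC divfK // lt0r_neq0.
  rewrite lerBlDr /Pr (bigID (fun G => (th <= (ncol k G)%:R)%R)) /=; apply: lerD => //.
  rewrite big_mkcond [X in _ <= X]big_mkcond; apply: ler_sum => G _; rewrite inE -ltNge.
  by case: (G \in D); case: ifP => //= _; exact: uniform_mass_ge0.
have : #|bad|%:R / (#|gw|%:R * th) <= expR (- f) * (k%:R ^+ n * X) / (#|gw|%:R * th).
  by apply: ler_wpM2r => //; rewrite invr_ge0 mulr_ge0 // ltW.
lra.
Qed.

End OneSize.

(** * Choice of constants and conclusion *)

Lemma ln_le_sqrt (R : realType) (x : R) : 0 < x -> ln x <= 2 * Num.sqrt x.
Proof.
move=> x0; have s0 : 0 < Num.sqrt x by rewrite sqrtr_gt0.
have -> : ln x = 2 * ln (Num.sqrt x) by rewrite -[in LHS](sqr_sqrtr (ltW x0)) lnXn // mulr2n; ring.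
by rewrite ler_pM2l //; have := ln_le_sub1 s0; lra.
Qed.

Local Open Scope classical_set_scope.
Local Open Scope ring_scope.

Lemma log_littleo (R : realType) (k : nat) :
  (fun n : nat => k.+1%:R * ln ((n + k)%:R : R)) =o_\oo (fun n : nat => n%:R : R).
Proof.
apply/eqoP => e e0.
have [n1 H] := sqrt_gt_div (k.+1%:R * 4) e0.
exists (maxn 1 (maxn k n1)) => //= n /=; rewrite !geq_max => /andP[n0 /andP[kn nn1]].
have nR : 0 < n%:R :> R by rewrite ltr0n.
have s0 : 0 < Num.sqrt (n%:R : R) by rewrite sqrtr_gt0.
have nk1 : 1 <= (n + k)%:R :> R by rewrite ler1n addn_gt0 n0.
rewrite !ger0_norm ?mulr_ge0 ?ln_ge0 //.
have h1 := ln_le_sqrt (lt_le_trans ltr01 nk1).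
have h2 : Num.sqrt ((n + k)%:R : R) <= 2 * Num.sqrt n%:R.
  rewrite -[X in _ <= X]ger0_norm ?mulr_ge0 ?sqrtr_ge0 // -sqrtr_sqr ler_wsqrtr //.
  rewrite exprMn sqr_sqrtr ?(ltW nR) // -natrX -natrM ler_nat.
  by rewrite (_ : 2 ^ 2 = 4)%N //; clear -kn; lia.
have h3 : ln ((n + k)%:R : R) <= 4 * Num.sqrt n%:R by lra.
apply: (@le_trans _ _ (k.+1%:R * (4 * Num.sqrt n%:R))); first by rewrite ler_wpM2l.
have := H n nn1; rewrite ler_pdivrMr // => h4.
have ss : n%:R = Num.sqrt n%:R * Num.sqrt n%:R :> R by rewrite -expr2 sqr_sqrtr // ltW.
by rewrite [X in _ <= e * X]ss !mulrA ler_pM2r.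
Qed.

(** For large k, replacing [T] by [T / (1 - 1/k)^2] costs a factor at most 1 + eps/8, and the
    entropy inequality loses another eps/8; the margin eps/2 in T covers both and the spare rate
    eta. *)
Lemma density_constants (R : realType) (eps : R) : 0 < eps -> eps <= 1 / 2 ->
  exists k0 : nat, forall k : nat, (k0 <= k)%N ->
  let T := (1 - eps / 2) * (k%:R * ln (k%:R : R)) in
  [/\ (2 < k)%N, 0 <= T, 2 * T / (k%:R - 1) ^+ 2 <= 1 / 2 & exists eta kap : R,
    [/\ 0 < eta, 0 < kap, T / (1 - k%:R^-1) ^+ 2 + eta < k%:R * kap &
      forall u : R, 0 <= u <= k%:R -> kap / k%:R * (u - 1) ^+ 2 <= u * ln u - u + 1]].
Proof.
move=> e0 e1.
have e80 : 0 < eps / 8 by rewrite divr_gt0.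
have e81 : eps / 8 < 1 by lra.
have [X HX] := xlnx_quadratic e80 e81.
have half : 0 < 1 / 2 :> R by rewrite divr_gt0.
have [n1 H1] := sqrt_gt_div (16 : R) half.
have e320 : 0 < eps / 32 by rewrite divr_gt0.
have [n2 [n20 H2]] := nat_gt_div (1 : R) e320.
exists (maxn 3 (maxn n1 (maxn n2 (Num.truncn (expR X)).+1))) => k.
rewrite !geq_max => /andP[k3 /andP[kn1 /andP[kn2 kX]]] T.
have K3 : 3 <= k%:R :> R by rewrite ler_nat.
have K0 : 0 < k%:R :> R by lra.
have lnk : 0 < ln (k%:R : R) by rewrite ln_gt0 //; lra.
have XK : X <= ln (k%:R : R).
  rewrite -ler_expR lnK ?posrE //; apply: ltW; apply: lt_le_trans (truncnS_gt _) _.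
  by rewrite ler_nat.
set P := k%:R * ln (k%:R : R).
have P0 : 0 < P by rewrite mulr_gt0.
have T0 : 0 <= T by rewrite mulr_ge0 ?(ltW P0) //; lra.
have TP : T <= P by rewrite ler_piMl ?(ltW P0) //; lra.
split => //.
  have s0 : 0 < Num.sqrt (k%:R : R) by rewrite sqrtr_gt0.
  have := H1 k kn1; rewrite ler_pdivrMr // => h1.
  have h2 := ln_le_sqrt K0.
  have ss : k%:R = Num.sqrt k%:R * Num.sqrt k%:R :> R by rewrite -expr2 sqr_sqrtr // ltW.
  have d0 : 0 < (k%:R - 1) ^+ 2 :> R by rewrite exprn_gt0 //; lra.
  rewrite ler_pdivrMr //.
  have h3 : 8 * ln (k%:R : R) <= k%:R / 2.
    have : 16 * Num.sqrt (k%:R : R) <= 1 / 2 * Num.sqrt k%:R * Num.sqrt k%:R by rewrite ler_pM2r.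
    rewrite -mulrA -ss; lra.
  have h4 : 8 * P <= k%:R / 2 * k%:R by rewrite /P mulrCA mulrC ler_pM2r.
  clear -TP h4 K3; move: (k%:R : R) K3 h4 => x x3 h4; nra.
(* In units of k ln k: [(1 - eps/2) (1 + eps/8) <= 1 - 3 eps/8], and adding eta gives 1 - eps/4,
   below the 1 - eps/8 supplied by kap. *)
exists (eps / 8 * P), ((1 - eps / 8) * ln (k%:R : R)).
have e9 : 0 < 1 - eps / 8 by lra.
split; [by rewrite mulr_gt0|by rewrite mulr_gt0| |].
  have -> : k%:R * ((1 - eps / 8) * ln k%:R) = (1 - eps / 8) * P by rewrite /P; ring.
  have := H2 k kn2; rewrite div1r; set y : R := k%:R^-1 => hy.
  have y0 : 0 < y by rewrite invr_gt0.
  have q0 : 0 < (1 - y) ^+ 2 by rewrite exprn_gt0 //; lra.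
  have qq : ((1 - y) ^+ 2)^-1 <= 1 + eps / 8.
    rewrite -div1r ler_pdivrMr //; clear -y0 hy e0 e1; nra.
  have : T / (1 - y) ^+ 2 <= T * (1 + eps / 8) by rewrite ler_wpM2l.
  have : T * (1 + eps / 8) <= (1 - 3 * eps / 8) * P.
    rewrite /T mulrAC ler_pM2r //; clear -e0 e1; nra.
  have : (1 - 3 * eps / 8) * P + eps / 8 * P < (1 - eps / 8) * P.
    rewrite -mulrDl ltr_pM2r //; lra.
  lra.
by move=> u hu; apply: HX.
Qed.

Theorem theorem6 (R : realType) (eps : R) (heps : 0 < eps) :
  exists k0 : nat, forall k : nat, (k0 <= k)%N ->
  forall m : nat -> nat,
  (forall n : nat, (0 < n)%N ->
     2 * (m n)%:R / n%:R <= (2 - eps) * k%:R * ln (k%:R : R)) ->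
  exists f : nat -> R,
    f =o_\oo (fun n : nat => n%:R : R) /\
    forall (D : forall n : nat, {set graph n})
           (E : forall n : nat, {set graph n * coloring k n}),
      (forall n : nat, E n \subset Lambda k n (m n)) ->
      Pr (@Gnm R n (m n)) (D n) @[n --> \oo] --> (1 : R) ->
      (\forall n \near \oo,
         1 - expR (- f n) <=
           cPr (@Pnm R k n (m n)) (E n) (graph_event k (D n))) ->
      Pr (@Unm R k n (m n)) (E n) @[n --> \oo] --> (1 : R).
Proof.
(* Lowering eps only weakens the density bound, so it may be assumed at most 1/2. *)
pose e := Num.min eps (1 / 2).
have e0 : 0 < e by rewrite lt_min heps divr_gt0.
have e1 : e <= 1 / 2 by rewrite ge_min lexx orbT.
have ee : e <= eps by rewrite ge_min lexx.
have [k0 Hk] := density_constants e0 e1.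
exists k0 => k kk0 m hm.
have [k3 T0 T2 [eta [kap [eta0 kap0 ck entr]]]] := Hk k kk0.
set T := (1 - e / 2) * _ in T0 T2 ck.
have k2 : (1 < k)%N by exact: ltnW.
have k00 : (0 < k)%N by exact: ltnW.
have Hmom := Mom_not_small k3 T0 eta0 kap0 ck entr T2.
have mT n : (0 < n)%N -> (m n)%:R <= T * n%:R.
  move=> n0; have n0' : 0 < n%:R :> R by rewrite ltr0n.
  have lnk : 0 <= ln (k%:R : R) by rewrite ln_ge0 // ler1n.
  have P0 : 0 <= k%:R * ln (k%:R : R) by rewrite mulr_ge0.
  have := hm n n0; rewrite ler_pdivrMr // => h.
  have : (2 - eps) * k%:R * ln k%:R * n%:R <= (2 - e) * (k%:R * ln k%:R) * n%:R.
    by rewrite ler_pM2r // -mulrA; apply: ler_wpM2r => //; lra.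
  rewrite /T; move: (k%:R * ln k%:R) h => x h h'; lra.
exists (fun n => k.+1%:R * ln ((n + k)%:R : R)); split; first exact: log_littleo.
move=> D E EL cD near_f; apply/cvgrPdist_le => d d0.
have d4 : 0 < d / 4 by rewrite divr_gt0.
have [c c0 [n1 Hc]] := ncol_lower k2 T0 Hmom d4.
pose Kf := expR (2 * T) * expR (8 * T ^+ 2) / c.
have [n2 [n20 Hn2]] := nat_gt_div Kf d4.
case: near_f => n3 _ Hf; move/cvgrPdist_le/(_ _ d4): cD => [n4 _ HD].
exists (maxn 2 (maxn n1 (maxn n2 (maxn n3 (maxn n4 (Num.truncn (8 * T)).+1))))) => //= n /=.
rewrite !geq_max => /andP[n_2 /andP[nn1 /andP[nn2 /andP[nn3 /andP[nn4 nT]]]]].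
have n0 : (0 < n)%N by exact: ltnW.
have mn := mT n n0.
have n8 : 8 * T <= n%:R.
  by apply: ltW; apply: lt_le_trans (truncnS_gt _) _; rewrite ler_nat.
have Cb := bin_lower n8 T0 n_2 mn; have pr := pow_ratio n_2 mn.
have N0 : 0 < 'C(n, 2)%:R :> R by rewrite ltr0n bin_gt0.
have m1 : 0 < (m n)`!%:R :> R by rewrite ltr0n fact_gt0.
have C0 : 0 < ('C('C(n, 2), m n) * (m n)`!)%:R :> R.
  by apply: lt_le_trans Cb; rewrite mulr_gt0 ?expR_gt0 // exprn_gt0.
have g0 : (0 < #|graphs_with n (m n)|)%N.
  by move: C0; rewrite card_graphs_with ltr0n muln_gt0 => /andP[].
have q0 : 0 < 1 - k%:R^-1 :> R by rewrite subr_gt0 invf_lt1 ?ltr1n // ltr0n.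
have K0 : 0 < k%:R :> R by rewrite ltr0n.
have nk0 : 0 < (n + k)%:R :> R by rewrite ltr0n addn_gt0 n0.
have th0 : 0 < thr k c n (m n).
  by rewrite divr_gt0 ?exprn_gt0 // mulr_gt0 // mulr_gt0 // exprn_gt0.
have pt := planted_transfer k2 n0 (EL n) th0 g0 (Hf n nn3).
have h1 := Hc n (m n) nn1 mn.
have h2 := HD n nn4; rewrite ler_norml in h2; case/andP: h2 => _ h2.
have u1 := @Pr_Unm_le1 R k n (m n) (E n).
(* The factor [(n + k)^(k + 1)] from f exceeds the loss [(n + k)^k] in the threshold by one power,
   which sends this error to 0 at rate 1/(n + k). *)
have h3 : expR (- (k.+1%:R * ln ((n + k)%:R : R))) *
   (k%:R ^+ n * (((1 - k%:R^-1) * (n%:R ^+ 2 / 2)) ^+ m n / (m n)`!%:R)) /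
   (#|graphs_with n (m n)|%:R * thr k c n (m n)) <= d / 4.
  have n0' : 0 < n%:R :> R by rewrite ltr0n.
  apply: le_trans (Hn2 n nn2); rewrite card_graphs_with.
  have -> : expR (- (k.+1%:R * ln ((n + k)%:R : R))) = ((n + k)%:R ^+ k.+1)^-1.
    by rewrite expRN expRM_natl lnK // posrE.
  have C1 : 0 < 'C('C(n, 2), m n)%:R :> R by rewrite -card_graphs_with ltr0n.
  have a1 : (k%:R : R) ^+ n != 0 by rewrite expf_neq0 // lt0r_neq0.
  have a2 : (1 - k%:R^-1 : R) ^+ m n != 0 by rewrite expf_neq0 // lt0r_neq0.
  have a3 : ((n + k)%:R : R) ^+ k != 0 by rewrite expf_neq0 // lt0r_neq0.
  have a4 := lt0r_neq0 nk0; have a5 := lt0r_neq0 C1; have a6 := lt0r_neq0 m1; have a7 := lt0r_neq0 c0.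
  have -> : ((n + k)%:R ^+ k.+1)^-1 * (k%:R ^+ n * (((1 - k%:R^-1) * (n%:R ^+ 2 / 2)) ^+ m n / (m n)`!%:R)) /
     ('C('C(n, 2), m n)%:R * thr k c n (m n)) =
     (n%:R ^+ 2 / 2) ^+ m n / ('C('C(n, 2), m n) * (m n)`!)%:R / c / (n + k)%:R :> R.
    rewrite /thr exprMn exprS natrM.
    move: ((k%:R : R) ^+ n) ((1 - k%:R^-1 : R) ^+ m n) ((n + k)%:R : R) (((n + k)%:R : R) ^+ k)
      ('C('C(n, 2), m n)%:R : R) ((m n)`!%:R : R) ((n%:R ^+ 2 / 2 : R) ^+ m n) a1 a2 a3 a4 a5 a6 a7.
    move=> x1 x2 x4 x3 x5 x6 x7 b1 b2 b3 b4 b5 b6 b7.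
    by field; rewrite ?b1 ?b2 ?b3 ?b4 ?b5 ?b6 ?b7.
  apply: ler_pM.
  - rewrite divr_ge0 ?(ltW c0) // divr_ge0 ?(ltW C0) // exprn_ge0 // divr_ge0 // sqr_ge0.
  - by rewrite invr_ge0.
  - apply: ler_wpM2r; first by rewrite invr_ge0 ltW.
    rewrite ler_pdivrMr //; apply: le_trans pr _.
    rewrite -mulrA ler_pM2l ?expR_gt0 // -ler_pdivrMl ?expR_gt0 // mulrC.
    by move: Cb; rewrite expRN.
  - by rewrite lef_pV2 ?posrE // ler_nat leq_addr.
rewrite ger0_norm; last by rewrite subr_ge0.
move: pt h1 h2 h3; set p1 := Pr _ (D n); set p2 := Pr _ [set _ | _]%SET; set p3 := Pr _ (E n); set p4 := _ / _.
move=> pt h1 h2 h3; lra.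
Qed.
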